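(* Fix $\alpha > 0$. For each positive integer $d$ (large enough that $\lfloor \alpha d^2\rfloor\geq 1$), let $\rho_d$ be a random state on $\mathbb{C}^d \otimes \mathbb{C}^d$ chosen according to the measure $\mu_{d^2,\lfloor \alpha d^2 \rfloor}$. Then for every interval $I=[a,b] \subset \mathbb{R}$ and every $\varepsilon >0$, \[ \lim_{d \to \infty} \mathbf{P} \left( \left| N_{d^2 \rho_d^\Gamma}(I) - \mu_{SC(1,1/\alpha)}(I) \right| > \varepsilon \right) = 0 .\]
   Context: A state on $\mathbb{C}^n$ is a positive semidefinite operator on $\mathbb{C}^n$ with trace $1$. For positive integers $n,p$, $\mu_{n,p}$ is the distribution of the random state $\mathrm{Tr}_{\mathbb{C}^p}|x\rangle\langle x|$, where $x$ is uniformly distributed on the unit sphere of $\mathbb{C}^n\otimes\mathbb{C}^p$ and $\mathrm{Tr}_{\mathbb{C}^p}=\mathrm{Id}_{M(\mathbb{C}^n)}\otimes \mathrm{Tr}: M(\mathbb{C}^n\otimes\mathbb{C}^p)\to M(\mathbb{C}^n)$ is the partial trace. Here $n=d^2$ and $\mathbb{C}^{d^2}$ is identified with $\mathbb{C}^d\otimes\mathbb{C}^d$. For an operator $A$ on $\mathbb{C}^d\otimes\mathbb{C}^d$, $A^\Gamma=(\mathrm{Id}\otimes T)(A)$ is the partial transposition, where $T$ is the usual transposition on $M(\mathbb{C}^d)$ (equivalently, view $A$ as a $d\times d$ block matrix with $d\times d$ blocks and transpose each block). For a Hermitian $n\times n$ matrix $A$ with eigenvalues $\lambda_1,\dots,\lambda_n$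 (with multiplicity), $N_A=\frac1n\sum_{i=1}^n\delta_{\lambda_i}$; thus $N_{d^2\rho_d^\Gamma}([a,b])$ is the proportion of eigenvalues of $\rho_d^\Gamma$ in $[a/d^2,b/d^2]$. For $m\in\mathbb{R}$, $\sigma>0$, $\mu_{SC(m,\sigma^2)}$ is the semicircular distribution with support $[m-2\sigma,m+2\sigma]$ and density $\frac{1}{2\pi\sigma^2}\sqrt{4\sigma^2-(x-m)^2}$ there. *)

(* Defs.v *)
From HB Require Import structures.
From mathcomp Require Import all_boot all_order all_algebra.
From mathcomp Require Import complex mxtens.
From mathcomp Require Import all_classical all_reals all_analysis.

Set Implicit Arguments.
Unset Strict Implicit.
Unset Printing Implicit Defensive.

Import Order.TTheory GRing.Theory Num.Theory.
Import numFieldNormedType.Exports.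

Local Open Scope classical_set_scope.
Local Open Scope ring_scope.
Local Open Scope sesquilinear_scope.

(* The ascription lets the field, norm and topology of the complex numbers be
   inferred on matrix types; the bare type [complex R] carries no canonical
   topology. *)
Definition Cplx (R : realType) : numClosedFieldType := complex R.

Definition borelM (R : realType) (m n : nat) :=
  @g_sigma_algebraType 'M[Cplx R]_(m, n) open.

Section tensor_operators.
Context {K : pzRingType}.

(* Id (x) Tr : M(C^m (x) C^n) -> M(C^m).  The basis vector e_i (x) e_j of
   C^m (x) C^n has index [mxtens_index (i, j)], i.e. i * n + j. *)
Definition ptrace {m n : nat} (A : 'M[K]_(m * n)) : 'M[K]_m :=
  \matrix_(i, j) \sum_(k < n) A (mxtens_index (i, k)) (mxtens_index (j, k)).

(* Id (x) T: the entry at ((i, j), (k, l)) is the entry of A at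
   ((i, l), (k, j)). *)
Definition ptranspose {m n : nat} (A : 'M[K]_(m * n)) : 'M[K]_(m * n) :=
  \matrix_(r, c)
    A (mxtens_index ((mxtens_unindex r).1, (mxtens_unindex c).2))
      (mxtens_index ((mxtens_unindex c).1, (mxtens_unindex r).2)).

End tensor_operators.

Lemma ptrace_tens (K : comPzRingType) (m n : nat) (A : 'M[K]_m) (B : 'M[K]_n) :
  ptrace (tensmx A B) = \tr B *: A.
Proof.
apply/matrixP => i j; rewrite !mxE mulrC /mxtrace mulr_sumr.
by apply: eq_bigr => k _; rewrite !mxE !mxtens_indexK.
Qed.

Lemma ptranspose_tens (K : pzRingType) (m n : nat)
    (A : 'M[K]_m) (B : 'M[K]_n) :
  ptranspose (tensmx A B) = tensmx A B^T.
Proof. by apply/matrixP => r c; rewrite !mxE !mxtens_indexK. Qed.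

Section random_states.
Context {R : realType}.

Definition unit_sphere (N : nat) : set 'cV[Cplx R]_N :=
  [set x | \sum_(i < N) `|x i 0| ^+ 2 = 1].

(* The uniform measure on the unit sphere of C^N is the unique Borel
   probability measure carried by the sphere and invariant under U(N). *)
Definition uniform_on_sphere (N : nat) (nu : probability (borelM R N 1) R) :=
  nu (@unit_sphere N) = 1%E /\
  (forall U : 'M[Cplx R]_N, U \is unitarymx ->
   forall A : set (borelM R N 1), measurable A ->
     nu ((fun x : 'cV[Cplx R]_N => U *m x) @^-1` A) = nu A).

(* Tr_{C^p} |x><x| for x in C^n (x) C^p *)
Definition reduced_state (n p : nat) (x : 'cV[Cplx R]_(n * p)) :
    'M[Cplx R]_n :=
  ptrace (x *m x ^t*).

(* rho has distribution mu_{n,p}, the image of the uniform measure under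
   [reduced_state]. *)
Definition has_law_mu (disp : measure_display) (T : measurableType disp)
    (P : probability T R) (n p : nat) (rho : {RV P >-> borelM R n n}) :=
  exists nu : probability (borelM R (n * p) 1) R,
    uniform_on_sphere nu /\
    (forall A : set (borelM R n n), measurable A ->
       distribution P rho A = nu (@reduced_state n p @^-1` A)).

(* For Hermitian A the entries of [spectral_diag A] are the (real) eigenvalues
   of A with multiplicity. *)
Definition spectral_measure (n : nat) (A : 'M[Cplx R]_n) (S : set R) : R :=
  n%:R^-1 * \sum_(i < n) \1_S (complex.Re (spectral_diag A 0 i)).

(* The law SC(m, v); v is the variance (sigma^2), as in the usual notation. *)
Definition semicircle_pdf (m v x : R) : R :=
  (2 * pi * v)^-1 * Num.sqrt (4 * v - (x - m) ^+ 2).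

Definition semicircle (m v : R) (S : set R) : R :=
  \int[@lebesgue_measure R]_(x in S `&`
      `[m - 2 * Num.sqrt v, m + 2 * Num.sqrt v])
    semicircle_pdf m v x.

End random_states.

(* Main.v *)
(** Invariance of the sphere measure under the unitary group yields
    Schwinger-Dyson equations for the expectation of a monomial in the
    coordinates and their conjugates.  The traces of powers of the rescaled
    partial transpose M are sums of monomials over index patterns ("networks")
    encoded by a pair of permutations (g, h), and the equations become a
    recursion that removes one point of a network at a time, each removal being
    weighted by powers of d and p according to the cycles it splits or merges.
    After normalisation only the removals that split cycles of both g and h
    survive as d grows; partial transposition makes h = g^-1, and the limits are
    products over the cycles of numbers c_k with
      c_(k+1) = c_k + alpha^-1 * sum_(m < k) c_m c_(k-1-m),
    the moments of SC(1, 1/alpha).  Two cycles give E[tr_k tr_l] -> c_k c_l, so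
    that normalised traces of polynomials in M converge in mean square.
    Polynomials above and below the indicator of [a, b], with integrals close to
    the semicircle measure of [a, b], transfer this to the spectral measure by
    Chebyshev's inequality. *)

Require Import Defs.
From HB Require Import structures.
From mathcomp Require Import all_boot all_order all_algebra all_fingroup.
From mathcomp Require Import complex mxtens.
From mathcomp Require Import all_classical all_reals all_analysis measurable_realfun.
From mathcomp Require Import ring lra.

Set Implicit Arguments.
Unset Strict Implicit.
Unset Printing Implicit Defensive.

Import Order.TTheory GRing.Theory Num.Theory.
Import numFieldNormedType.Exports.

(** * Splicing points out of permutations *)

(** Splicing does not commute with inversion. If [t r1 s r2] is a cycle of [g], removing [s] leaves
    [t] with [r2], whereas the same removal from the inverse leaves [t] with the reversed [r1]. So h
    = g^-1 is lost after one removal. But then [t] is the only common point of the two cycles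
    through it, so its own removal, of limit weight 1, is the only one that survives; it restores h
    = g^-1 with [r1] and [r2] as separate cycles. This is where the product c_m c_(k-1-m) comes
    from.

    The derivative at the identity that yields the Schwinger-Dyson equations is taken algebraically:
    unitaries with an integer parameter give polynomial identities, and no differentiation under the
    integral occurs.

    No bound on the spectrum of M uniform in d is established, so approximation on a compact
    interval is not enough: the polynomials must bound the indicator on the whole line. A large even
    power, negligible on the support of the semicircle, corrects them far away. *)

Section splice.
Variable S : finType.
Implicit Types (s t x y : S) (g : {perm S}) (A : {set S}) (q r : seq S).

(* What is left of [g] when [s] is removed: [s] becomes a fixed point, [t] is
   sent to [g s] and the predecessor of [s] to [g t]. *)
Definition splice s t g : {perm S} := (tperm s t * g * tperm s (g t))%g.

Lemma spliceE s t g x : splice s t g x = tperm s (g t) (g (tperm s t x)).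
Proof. by rewrite !permM. Qed.

Lemma splice_id s t g : splice s t g s = s.
Proof. by rewrite spliceE tpermL tpermR. Qed.

Lemma splice_on A s t g : perm_on A g -> s \in A -> t \in A ->
  perm_on (A :\ s) (splice s t g).
Proof.
move=> gA sA tA; apply/fintype.subsetP => x; rewrite !inE.
apply: contraR; rewrite negb_and negbK => /orP[/eqP->|xA].
  by rewrite splice_id.
have ne y : y \in A -> (y == x) = false.
  by move=> yA; apply: contraNF xA => /eqP <-.
rewrite spliceE; apply/eqP; rewrite (@tpermD _ s t x) ?ne //.
  by rewrite (out_perm gA xA) tpermD ?ne ?(perm_closed _ gA).
Qed.

(** Multiplication by a transposition changes the number of cycles by one. After conjugation the
    second factor of [splice] is a transposition of [s] with its predecessor, so it can only cut [s]
    off; the first one splits or merges according to whether [s] and [t] share a cycle. *)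
Lemma splice_porbits s t g :
  (#|porbits (splice s t g)| + (s \notin porbit g t).*2 =
   #|porbits g| + (s != t) + (g t != s))%N.
Proof.
set h := (tperm s t * g)%g.
have -> : splice s t g = (tperm (h^-1 s) s * h)%g.
  rewrite /splice -/h; have -> : tperm s (g t) = tperm (h ((h^-1)%g s)) (h s).
    by rewrite permKV permM tpermL.
  by rewrite -tpermJ /conjg !mulgA mulgV mul1g.
have := porbits_mul_tperm h ((h^-1)%g s) s; rewrite /=.
have -> : (h^-1)%g s \in porbit h s.
  by rewrite -porbitV; have := mem_porbit (h^-1)%g 1 s; rewrite expg1.
rewrite addn0 => ->; have := porbits_mul_tperm g s t; rewrite /= -/h => e.
rewrite addnAC e; congr (_ + _)%N; congr nat_of_bool; congr negb.
by rewrite -(inj_eq (@perm_inj _ h)) permKV eq_sym permM tpermL.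
Qed.

Lemma splice_head_inv t g : splice t t (g^-1)%g = ((splice t t g)^-1)%g.
Proof.
rewrite /splice tperm1 !mul1g invMg tpermV.
have -> : tperm t (g t) = (tperm t (g^-1 t)%g ^ g)%g.
  by rewrite tpermJ permKV tpermC.
by rewrite conjgE -!mulgA mulgV mulg1.
Qed.

(** A single removal of [s] attaches [t] to different arcs for [g] and for its inverse. Once [t] is
    removed as well, both sides consist of the same arcs, run through in opposite directions. *)
Lemma splice_splice_inv s t g : s != t -> g s != s -> g t != t ->
  splice t t (splice s t (g^-1)%g) = ((splice t t (splice s t g))^-1)%g.
Proof.
move=> st gs gt.
have sp (h : {perm S}) : h s != s -> splice t t (splice s t h) =
    (tperm s t * h * tperm s (h t) * tperm t (h s))%g.
  move=> hs; rewrite {1}/splice tperm1 mul1g spliceE tpermR.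
  by rewrite (@tpermD _ _ _ (h s)) ?(inj_eq perm_inj) 1?eq_sym // eq_sym.
have gVs : (g^-1)%g s != s by rewrite -(inj_eq (@perm_inj _ g)) permKV eq_sym.
have gVt : (g^-1)%g t != t by rewrite -(inj_eq (@perm_inj _ g)) permKV eq_sym.
rewrite !sp // !invMg !tpermV.
set u := (g^-1)%g t in gVt *; set w := (g^-1)%g s in gVs *.
have uw : u != w by rewrite (inj_eq perm_inj) eq_sym.
rewrite (conjgC (tperm s t)) tpermJ -/u -/w.
rewrite !mulgA -(mulgA _ (tperm s (g t))) (conjgC (tperm s (g t))) tpermJ.
rewrite !mulgA (conjgC (tperm t (g s))) tpermJ !permK -/u -/w -!mulgA.
congr (_ * _)%g; apply/permP => x; rewrite !permM.
rewrite !permE /=; clearbody u w; clear sp gs gt.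
move: st gVs gVt uw => /eqP st /eqP ws /eqP ut /eqP uw.
by repeat match goal with |- context [?a == ?b] =>
  is_var a; is_var b; case: (a =P b) => ? /=; try congruence end.
Qed.

Lemma splice_far s t g x : x != s -> x != t -> g x != s ->
  splice s t g x = g x.
Proof.
move=> xs xt gxs; rewrite spliceE (@tpermD _ s t) 1?eq_sym // tpermD //.
  by rewrite eq_sym.
by rewrite (inj_eq perm_inj) eq_sym.
Qed.

Lemma splice_last s t g x : x != s -> x != t -> g x = s ->
  splice s t g x = g t.
Proof. by move=> xs xt gxs; rewrite spliceE (@tpermD _ s t) 1?eq_sym // gxs tpermL. Qed.

Lemma splice_anchor s t g : s != t -> g s != s -> splice s t g t = g s.
Proof.
move=> st gs; rewrite spliceE tpermR tpermD // 1?eq_sym //.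
by rewrite (inj_eq perm_inj).
Qed.

Lemma fcycle_porbit g t r : fcycle g (t :: r) -> porbit g t =i t :: r.
Proof.
move=> gq x; apply/porbitP/idP => [[i ->]|].
  rewrite permX; elim: i => [|i IH] /=; first exact: mem_head.
  exact: mem_fcycle gq _ IH.
by rewrite (fcycle_consE gq) => /trajectP[i _ ->]; exists i; rewrite permX.
Qed.

Lemma path_splice s t g y l : fpath g y l -> s \notin y :: l ->
  t \notin belast y l -> fpath (splice s t g) y l.
Proof.
elim: l y => [//|z l IH] y /= /andP[/eqP gy gp].
rewrite !inE !negb_or => /and3P[sy sz sl] /andP[ty tl].
rewrite splice_far ?gy ?eqxx 1?eq_sym //; apply: IH => //.
by rewrite inE negb_or sz.
Qed.

(* The arc of the cycle that runs from [g t] to the predecessor of [s]. *)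
Lemma fcycle_arc s t g y l : g t = y -> fpath g y l -> g (last y l) = s ->
  s \notin y :: l -> t \notin y :: l -> fcycle (splice s t g) (y :: l).
Proof.
move=> gt gp gl sq tq; rewrite /= rcons_path path_splice //=; last first.
  by apply: contra tq => /mem_belast.
rewrite splice_last ?gt //.
- by apply: contraNneq sq => <-; exact: mem_last.
- by apply: contraNneq tq => <-; exact: mem_last.
Qed.

Lemma porbit_neq g x y : x \in porbit g y -> y != x -> g x != x.
Proof.
rewrite porbit_sym => /porbitP[i ->]; apply: contra_neq => gx.
by rewrite permX; elim: i => //= i ->.
Qed.

Lemma fcycle_inv g q : fcycle g q -> fcycle (g^-1)%g (rev q).
Proof.
rewrite rev_cycle; congr is_true; apply: eq_cycle => x y /=.
by apply/eqP/eqP => [<-|<-]; rewrite ?permK ?permKV.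
Qed.

(** The cycle is cut at [s] and just after [t]: the anchor [t] stays with the arc that follows [s],
    and the arc between [t] and [s] closes up in [fcycle_splice_front]. *)
Lemma fcycle_splice_tail s t g r1 r2 : uniq (t :: r1 ++ s :: r2) ->
  fcycle g (t :: r1 ++ s :: r2) -> fcycle (splice s t g) (t :: r2).
Proof.
move=> uq; rewrite /= rcons_cat cat_path rcons_cons [path _ _ (s :: _)]/=.
move=> /andP[_ /andP[_]]; move: uq; rewrite /= mem_cat inE !negb_or cat_uniq /=.
case/andP => /and3P[_ ts tr2] /and4P[_ _ sr2 ur2].
have st : s != t by rewrite eq_sym.
case: r2 tr2 sr2 ur2 => [|y l] /=; first by move=> _ _ _; rewrite !andbT => /eqP gs;
  rewrite splice_anchor // gs // eq_sym.
rewrite !inE !negb_or => /andP[ty tl] /andP[sy sl] _ /andP[/eqP gs gp].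
rewrite splice_anchor // gs 1?eq_sym // eqxx.
apply: path_splice => //; last by rewrite belast_rcons inE negb_or ty.
by rewrite inE mem_rcons inE !negb_or sy st.
Qed.

Lemma fcycle_splice_front s t g r1 r2 : uniq (t :: r1 ++ s :: r2) ->
  fcycle g (t :: r1 ++ s :: r2) -> fcycle (splice s t g) r1.
Proof.
case: r1 => [//|y l] uq.
rewrite /= rcons_cat cat_path /= => /and3P[/eqP gt gp /andP[/eqP gl _]].
apply: fcycle_arc => //; move: uq; rewrite cons_uniq mem_cat negb_or cat_uniq.
  by case/and3P => _ _ /andP[/hasPn/(_ s) sq _]; apply: sq; rewrite mem_head.
by case/andP => /andP[].
Qed.

Lemma fcycle_behead t g r : uniq (t :: r) ->
  fcycle g (t :: r) -> fcycle (splice t t g) r.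
Proof.
case: r => [//|y l] /= /andP[tr _]; rewrite rcons_path.
by move=> /and3P[/eqP gt gp /eqP gl]; exact: fcycle_arc.
Qed.

Lemma fcycle_splice_out s t g q : fcycle g q -> s \notin q -> t \notin q ->
  fcycle (splice s t g) q.
Proof.
move=> gq sq tq; have eqc : {in q &, frel g =2 frel (splice s t g)}.
  move=> x y xq yq /=; rewrite splice_far //.
  - by apply: contraNneq sq => <-.
  - by apply: contraNneq tq => <-.
  - by apply: contraNneq sq => <-; rewrite (mem_fcycle gq).
by rewrite -(eq_in_cycle eqc) //; apply/allP.
Qed.

Lemma all_fcycle_splice s t g qs : s \notin flatten qs -> t \notin flatten qs ->
  all (fcycle g) qs -> all (fcycle (splice s t g)) qs.
Proof.
move=> sq tq /allP gq; apply/allP => q qqs.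
apply: fcycle_splice_out (gq q qqs) _ _.
  by apply: contra sq => sq; apply/flattenP; exists q.
by apply: contra tq => tq; apply/flattenP; exists q.
Qed.

(** * Product solutions of the limiting recursion *)

Section cycle_product.
Variables (K : comNzRingType) (v : K) (c : nat -> K).
Variable L : {set S} -> {perm S} -> {perm S} -> K.
Hypothesis c0 : c 0 = 1%R.
Hypothesis cS : forall k,
  (c k.+1 = c k + v * \sum_(m < k) c m * c (k - m.+1)%N)%R.
Hypothesis L0 : L finset.set0 1%g 1%g = 1%R.
Hypothesis LS : forall A g h t, perm_on A g -> perm_on A h -> t \in A ->
  (L A g h = L (A :\ t) (splice t t g) (splice t t h) +
     v * \sum_(s in A | [&& s != t, s \in porbit g t & s \in porbit h t])
            L (A :\ s) (splice s t g) (splice s t h))%R.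

Lemma L_single A g h t : perm_on A g -> perm_on A h -> t \in A ->
  (forall s, s \in porbit g t -> s \in porbit h t -> s = t) ->
  L A g h = L (A :\ t) (splice t t g) (splice t t h).
Proof.
move=> gA hA tA one; rewrite (LS gA hA tA) big_pred0 ?mulr0 ?addr0 // => s.
by apply/and4P => -[_ /eqP st sg sh]; case: st; exact: one.
Qed.

Lemma sum_split (F : nat -> nat -> K) t r : uniq (t :: r) ->
  (\sum_(s in r) F (index s r) (size r - (index s r).+1)%N =
   \sum_(m < size r) F m (size r - m.+1)%N)%R.
Proof.
move=> /= /andP[_ ur].
rewrite -big_uniq //= (big_nth t) big_mkord; apply: eq_bigr => m _.
by rewrite index_uniq.
Qed.

Lemma cycle_product (qs : seq (seq S)) g :
  uniq (flatten qs) -> all (fcycle g) qs ->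
  perm_on [set x in flatten qs] g ->
  L [set x in flatten qs] g (g^-1)%g = (\prod_(q <- qs) c (size q))%R.
Proof.
(* Empty cycles are allowed in [qs], and dropping one does not shrink [flatten qs]; hence the second
   summand of the measure. *)
have [n] := ubnP (size (flatten qs) + size qs); elim: n qs g => // n IH.
case=> [|[|t r] qs] g /=; rewrite ?ltnS.
- move=> _ _ _ gA; rewrite big_nil.
  have -> : g = 1%g.
    by apply/permP => x; rewrite perm1 (out_perm gA) // !inE.
  by rewrite invg1 -L0; congr L; apply/setP => x; rewrite !inE.
- move=> sz uq /= qg gA; rewrite big_cons c0 mul1r; apply: IH => //.
  by rewrite -addnS.
move=> sz uq /andP[gq gqs] gA; rewrite big_cons [size (t :: r)]/= cS mulrDl.
have /andP[tr uqf] := uq; have ur : uniq (t :: r).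
  by rewrite /= (subseq_uniq (prefix_subseq _ _) uqf) andbT; apply: contra tr; rewrite mem_cat => ->.
have tf : t \notin flatten qs.
  by apply: contra tr; rewrite mem_cat => ->; rewrite orbT.
have tA : t \in [set x in t :: r ++ flatten qs] by rewrite !inE eqxx.
rewrite (LS gA (perm_onV gA) tA) splice_head_inv; congr (_ + _)%R.
  have -> : [set x in t :: r ++ flatten qs] :\ t = [set x in flatten (r :: qs)].
    apply/setP => x; rewrite !inE /=; case: eqVneq => [->|_] //=.
    exact/esym/negbTE.
  rewrite IH ?big_cons //=.
  - by rewrite fcycle_behead //= all_fcycle_splice.
  - move: (splice_on gA tA tA); congr (is_true (perm_on _ _)).
    apply/setP => x; rewrite !inE /=; case: eqVneq => [->|_] //=.
    exact/esym/negbTE.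
rewrite -mulrA; congr (_ * _)%R.
rewrite -(sum_split (fun a b => c a * c b)%R ur) big_distrl /=.
have pr : porbit g t =i t :: r by exact: fcycle_porbit.
(* A permutation and its inverse have the same orbits, so both conditions on [s] select the rest [r]
   of the cycle of [t]. *)
rewrite (eq_bigl (fun s => s \in r)) => [|s]; last first.
  rewrite porbitV pr !inE mem_cat /=.
  case: eqVneq => [->|_] /=; last by case: (s \in r); rewrite ?andbF ?andbT ?orbT.
  by apply/esym; apply: contraNF tr; rewrite mem_cat => ->.
apply: eq_bigr => s sr.
have st : s != t by apply: contraTneq sr => ->; case/andP: ur.
have stg : s \in porbit g t by rewrite pr inE sr orbT.
have gs : g s != s by apply: (porbit_neq stg); rewrite eq_sym.
have gt : g t != t by move: stg; rewrite porbit_sym => /porbit_neq; exact.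
have sf : s \notin flatten qs.
  by move: uqf; rewrite cat_uniq => /and3P[_ /hasPn + _] => /(_ s)/contraL; exact.
have sA : s \in [set x in t :: r ++ flatten qs].
  by rewrite !inE mem_cat sr orbT.
case/splitPr: r / sr => r1 r2 in sz uq gq gA tr uqf ur tA pr sA *.
have [tr1 tr2 sr1 sr2] : [/\ t \notin r1, t \notin r2, s \notin r1 & s \notin r2].
  move: ur; rewrite cons_uniq mem_cat inE !negb_or => /andP[/and3P[-> _ ->]].
  by rewrite cat_uniq /= negb_or => /and4P[_ /andP[-> _] -> _].
have gc : fcycle g (t :: r1 ++ s :: r2) by exact: gq.
set A := [set x in _].
have gV : fcycle (g^-1)%g (t :: rev r2 ++ s :: rev r1).
  have := fcycle_inv gc; rewrite rev_cons -(rotr_cycle 1) rotr1_rcons.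
  by rewrite rev_cat rev_cons cat_rcons.
have uV : uniq (t :: rev r2 ++ s :: rev r1).
  have := ur; rewrite -rev_uniq rev_cons -(rotr_uniq 1) rotr1_rcons.
  by rewrite rev_cat rev_cons cat_rcons.
(* Now [t] lies on [t :: r2] for the spliced [g] and on [t :: rev r1] for the spliced inverse, which
   meet only in [t]: no further splitting at [t] is possible. *)
rewrite (@L_single (A :\ s) _ _ t) ?splice_on ?perm_onV //; last 2 first.
- by rewrite !inE eq_sym st eqxx.
- move=> x; rewrite (fcycle_porbit (fcycle_splice_tail ur gc)) inE.
  case/predU1P => // xr2; rewrite (fcycle_porbit (fcycle_splice_tail uV gV)) inE.
  case/predU1P => //; rewrite mem_rev => xr1; move: uqf.
  rewrite -catA cat_uniq => /and3P[_ /hasPn/(_ x) + _].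
  by rewrite mem_cat inE xr2 orbT xr1 => /(_ isT).
rewrite splice_splice_inv //.
have tAs : t \in A :\ s by rewrite !inE eq_sym st eqxx.
have := splice_on (splice_on gA sA tA) tAs tAs.
have -> : A :\ s :\ t = [set x in flatten [:: r1, r2 & qs]].
  apply/setP => x; rewrite !inE /= !mem_cat !inE /=.
  case: (eqVneq x t) => [->|_] /=.
    by rewrite (negbTE tr1) (negbTE tr2) (negbTE tf).
  case: (eqVneq x s) => [->|_] //=.
    by rewrite (negbTE sr1) (negbTE sr2) (negbTE sf).
  by rewrite orbA.
(* Two points have gone and one cycle has become two, so the measure has dropped by one. The
   position of [s] in the cycle gives the sizes m and k-1-m of the two arcs. *)
move=> gA2; rewrite IH //=.
- rewrite !big_cons index_cat (negbTE sr1) /= eqxx addn0 mulrA.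
  by rewrite size_cat /= addnS subSS addKn.
- move: sz; rewrite !size_cat /= !addnS !addSn; apply: leq_trans.
  by rewrite !ltnS !addnA.
- apply: subseq_uniq uqf; rewrite -catA; apply: cat_subseq => //=.
  exact: subseq_cons.
- rewrite !all_fcycle_splice // fcycle_splice_out ?(fcycle_splice_front ur gc) //.
  rewrite fcycle_behead ?(fcycle_splice_tail ur gc) //=.
  by rewrite tr2; move: ur; rewrite /= cat_uniq /= => /and5P[].
Qed.

End cycle_product.
End splice.

Local Open Scope classical_set_scope.
Local Open Scope ring_scope.
Local Open Scope sesquilinear_scope.

(** * Complex random variables on the unit sphere *)

Section complex_parts.
Context {R : realType}.
Local Notation C := (Cplx R).
Implicit Types z w : C.

Definition rpart z : R := complex.Re (z : complex R).
Definition ipart z : R := complex.Im (z : complex R).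
Definition cpair (a b : R) : C := Complex a b.

Lemma cpairP z w : rpart z = rpart w -> ipart z = ipart w -> z = w.
Proof. by case: z w => a b [c d] /= -> ->. Qed.

Lemma rpartD z w : rpart (z + w) = rpart z + rpart w.
Proof. by case: z w => a b [c d]. Qed.
Lemma ipartD z w : ipart (z + w) = ipart z + ipart w.
Proof. by case: z w => a b [c d]. Qed.
Lemma rpartM z w : rpart (z * w) = rpart z * rpart w - ipart z * ipart w.
Proof. by case: z w => a b [c d]. Qed.
Lemma ipartM z w : ipart (z * w) = rpart z * ipart w + ipart z * rpart w.
Proof. by case: z w => a b [c d]. Qed.
Lemma rpartJ z : rpart z^* = rpart z.
Proof. by case: z. Qed.
Lemma ipartJ z : ipart z^* = - ipart z.
Proof. by case: z. Qed.
Lemma rpart_nat n : rpart n%:R = n%:R.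
Proof. by elim: n => [//|n IH]; rewrite -!natr1 rpartD IH. Qed.
Lemma ipart_nat n : ipart n%:R = 0.
Proof. by elim: n => [//|n IH]; rewrite -natr1 ipartD IH addr0. Qed.
Lemma creal_nat n : n%:R = cpair n%:R 0 :> C.
Proof. by apply: cpairP; rewrite ?rpart_nat ?ipart_nat. Qed.
Lemma crealM (a b : R) : cpair (a * b) 0 = cpair a 0 * cpair b 0.
Proof. exact: (rmorphM (real_complex R)). Qed.
Lemma crealV (a : R) : cpair a^-1 0 = (cpair a 0)^-1.
Proof. exact: (fmorphV (real_complex R)). Qed.
Lemma crealX (a : R) n : cpair (a ^+ n) 0 = cpair a 0 ^+ n.
Proof. exact: (rmorphXn (real_complex R)). Qed.
Lemma crealD (a b : R) : cpair (a + b) 0 = cpair a 0 + cpair b 0.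
Proof. exact: (rmorphD (real_complex R)). Qed.
Lemma normrpart z : `|z| = cpair (Num.sqrt (rpart z ^+ 2 + ipart z ^+ 2)) 0.
Proof. by case: z. Qed.
Lemma cpair_lt (a b : R) : (cpair a 0 < cpair b 0) = (a < b).
Proof. by rewrite /cpair (ltcR a b). Qed.
Lemma sqr_normC_part z : `|z| ^+ 2 = cpair (rpart z ^+ 2 + ipart z ^+ 2) 0.
Proof. by rewrite normrpart expr2; apply: cpairP; rewrite ?rpartM ?ipartM /= ?mulr0 ?mul0r ?subr0 ?addr0 -?expr2 ?sqr_sqrtr // addr_ge0 // sqr_ge0. Qed.

Lemma norm_rpart_lt z (e : R) : `|z| < cpair e 0 -> `|rpart z| < e.
Proof.
rewrite normrpart cpair_lt; apply: le_lt_trans.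
by rewrite -sqrtr_sqr ler_wsqrtr // lerDl sqr_ge0.
Qed.
Lemma norm_ipart_lt z (e : R) : `|z| < cpair e 0 -> `|ipart z| < e.
Proof.
rewrite normrpart cpair_lt; apply: le_lt_trans.
by rewrite -sqrtr_sqr ler_wsqrtr // lerDr sqr_ge0.
Qed.

Lemma norm_rpart_le z w : `|z| <= w -> `|rpart z| <= rpart w.
Proof.
rewrite normrpart lecE => /andP[_]; apply: le_trans.
by rewrite /= -sqrtr_sqr ler_wsqrtr // lerDl sqr_ge0.
Qed.
Lemma norm_ipart_le z w : `|z| <= w -> `|ipart z| <= rpart w.
Proof.
rewrite normrpart lecE => /andP[_]; apply: le_trans.
by rewrite /= -sqrtr_sqr ler_wsqrtr // lerDr sqr_ge0.
Qed.

Lemma rpart_continuous : continuous rpart.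
Proof.
move=> z; apply/(cvgrPdist_lt (FF := nbhs_filter z)) => e e0; exists (cpair e 0) => /=.
  by rewrite -[0]/(cpair 0 0) cpair_lt.
move=> w /norm_rpart_lt; congr (`|_| < _).
by case: (z) (w) => a b [c d].
Qed.

Lemma ipart_continuous : continuous ipart.
Proof.
move=> z; apply/(cvgrPdist_lt (FF := nbhs_filter z)) => e e0; exists (cpair e 0) => /=.
  by rewrite -[0]/(cpair 0 0) cpair_lt.
move=> w /norm_ipart_lt; congr (`|_| < _).
by case: (z) (w) => a b [c d].
Qed.

Lemma conj_continuous : continuous (fun z : C => z^*).
Proof.
move=> z; apply/(cvgrPdist_lt (FF := nbhs_filter z)) => e e0; exists e => //= w.
by rewrite -rmorphB norm_conjC.
Qed.

End complex_parts.

Section borel_matrices.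
Context {R : realType}.
Local Notation C := (Cplx R).

Lemma open_borelM m n (A : set 'M[C]_(m, n)) : open A ->
  measurable (A : set (borelM R m n)).
Proof. by move=> oA; exact: sub_sigma_algebra. Qed.

Lemma continuous_borelM_real m n (f : 'M[C]_(m, n) -> R) : continuous f ->
  measurable_fun setT (f : borelM R m n -> R).
Proof.
move=> /continuousP cf.
apply: (measurability _ (RGenOInfty.measurableE R)) => _ [_ [x ->] <-].
by rewrite setTI; apply: open_borelM; apply: cf; exact: interval_open.
Qed.

Lemma continuous_borelM m n m' n' (f : 'M[C]_(m, n) -> 'M[C]_(m', n')) :
  continuous f -> measurable_fun setT (f : borelM R m n -> borelM R m' n').
Proof.
move=> /continuousP cf.
apply: (measurability (rT := borelM R m' n') open) => // _ [B oB <-].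
by rewrite setTI; apply: open_borelM; exact: cf.
Qed.

Lemma mx_continuous (T : topologicalType) m n (f : T -> 'M[C]_(m, n)) :
  (forall i j, continuous (fun x => f x i j)) -> continuous f.
Proof.
move=> cf x A [B nB sBA]; apply: filterS sBA _ => /=.
apply: filter_forall => i; apply: filter_forall => j.
exact: cf (nB i j).
Qed.

Lemma continuous_csum (T : topologicalType) (I : Type) (r : seq I) (P : pred I)
    (F : I -> T -> C) :
  (forall i, continuous (F i)) -> continuous (fun x => \sum_(i <- r | P i) F i x).
Proof.
move=> cF; elim: r => [|i r IH].
  by under eq_fun do rewrite big_nil; move=> x; exact: cvg_cst.
case Pi : (P i); under eq_fun do rewrite big_cons Pi; last by [].
by move=> x; apply: cvgD; [exact: cF|exact: IH].
Qed.

Lemma continuousM_C (T : topologicalType) (f g : T -> C) :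
  continuous f -> continuous g -> continuous (fun x => f x * g x).
Proof. by move=> cf cg x; apply: cvgM; [exact: cf|exact: cg]. Qed.

End borel_matrices.

Section complex_measurability.
Context {R : realType} {disp : measure_display} {T : measurableType disp}.
Local Notation C := (Cplx R).
Implicit Types f g : T -> C.

Definition cmeasurable f := measurable_fun setT (rpart \o f) /\
                            measurable_fun setT (ipart \o f).

Lemma cmeasurable_cst c : cmeasurable (fun=> c).
Proof. by split; exact: measurable_cst. Qed.

Lemma cmeasurableD f g : cmeasurable f -> cmeasurable g ->
  cmeasurable (fun x => f x + g x).
Proof.
move=> [f1 f2] [g1 g2]; split.
  rewrite (_ : _ \o _ = (rpart \o f) \+ (rpart \o g)).
    exact: measurable_funD.
  by apply/funext => x; rewrite /= rpartD.
rewrite (_ : _ \o _ = (ipart \o f) \+ (ipart \o g)).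
  exact: measurable_funD.
by apply/funext => x; rewrite /= ipartD.
Qed.

Lemma cmeasurableM f g : cmeasurable f -> cmeasurable g ->
  cmeasurable (fun x => f x * g x).
Proof.
move=> [f1 f2] [g1 g2]; split.
  rewrite (_ : _ \o _ = ((rpart \o f) \* (rpart \o g)) \-
                        ((ipart \o f) \* (ipart \o g))).
    by apply: measurable_funB; exact: measurable_funM.
  by apply/funext => x; rewrite /= rpartM.
rewrite (_ : _ \o _ = ((rpart \o f) \* (ipart \o g)) \+
                      ((ipart \o f) \* (rpart \o g))).
  by apply: measurable_funD; exact: measurable_funM.
by apply/funext => x; rewrite /= ipartM.
Qed.

Lemma cmeasurable_conj f : cmeasurable f -> cmeasurable (fun x => (f x)^*).
Proof.
move=> [f1 f2]; split.
  by rewrite (_ : _ \o _ = rpart \o f) //; apply/funext => x; rewrite /= rpartJ.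
rewrite (_ : _ \o _ = \- (ipart \o f)); first exact: measurable_funN.
by apply/funext => x; rewrite /= ipartJ.
Qed.

Lemma cmeasurable_sum (I : Type) (r : seq I) (P : pred I) (F : I -> T -> C) :
  (forall i, P i -> cmeasurable (F i)) ->
  cmeasurable (fun x => \sum_(i <- r | P i) F i x).
Proof.
move=> mF; elim: r => [|i r IH].
  under eq_fun do rewrite big_nil; exact: cmeasurable_cst.
case Pi : (P i); last by under eq_fun do rewrite big_cons Pi.
by under eq_fun do rewrite big_cons Pi; apply: cmeasurableD => //; exact: mF.
Qed.

End complex_measurability.

Lemma cmeasurable_coord (R : realType) m n i j :
  cmeasurable (fun x : borelM R m n => (x : 'M[Cplx R]_(m, n)) i j).
Proof.
split; apply: continuous_borelM_real => x; apply: continuous_comp.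
- exact: coord_continuous.
- exact: rpart_continuous.
- exact: coord_continuous.
- exact: ipart_continuous.
Qed.

Section sphere_expectation.
Context {R : realType} (N : nat) (nu : probability (borelM R N 1) R).
Local Notation C := (Cplx R).
Local Notation D := (@unit_sphere R N : set (borelM R N 1)).
Hypothesis nuS : uniform_on_sphere nu.
Implicit Types f g : 'cV[C]_N -> C.

(** The bound is asked on the sphere only: coordinates are unbounded on the whole space, but [nu] is
    carried by the sphere and [expect] integrates over it. *)
Definition sphere_bounded f :=
  cmeasurable (f : borelM R N 1 -> C) /\
  exists K : C, forall x, @unit_sphere R N x -> `|f x| <= K.

Definition expect f : C :=
  cpair (\int[nu]_(x in D) rpart (f x)) (\int[nu]_(x in D) ipart (f x)).

(** The sum of the squared moduli is real, so comparing its real part with 1 is enough. *)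
Lemma measurable_sphere : measurable D.
Proof.
rewrite (_ : D = (fun x : borelM R N 1 =>
  rpart (\sum_(i < N) `|(x : 'cV[C]_N) i 0| ^+ 2)) @^-1` [set 1]).
  rewrite -[X in measurable X]setTI.
  have [+ _] : cmeasurable (fun x : borelM R N 1 =>
      \sum_(i < N) `|(x : 'cV[C]_N) i 0| ^+ 2).
    apply: cmeasurable_sum => i _; under eq_fun do rewrite normCK.
    apply: cmeasurableM; first exact: cmeasurable_coord.
    by apply: cmeasurable_conj; exact: cmeasurable_coord.
  by apply.
apply/seteqP; split => x; rewrite /unit_sphere /=; first by move=> ->.
move=> sx; apply: cpairP => //; rewrite (_ : ipart 1 = 0) //.
apply: (big_ind (fun z : C => ipart z = 0)) => // [z w|i _].
  by rewrite ipartD => -> ->; rewrite addr0.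
by rewrite sqr_normC_part.
Qed.

Lemma sphere_bounded_cst c : sphere_bounded (fun=> c).
Proof. by split; [exact: cmeasurable_cst|exists `|c|]. Qed.

Lemma sphere_boundedD f g : sphere_bounded f -> sphere_bounded g ->
  sphere_bounded (fun x => f x + g x).
Proof.
move=> [mf [K fK]] [mg [L gL]]; split; first exact: cmeasurableD.
exists (K + L) => x Sx; apply: le_trans (ler_normD _ _) _.
by apply: lerD; [exact: fK|exact: gL].
Qed.

Lemma sphere_boundedM f g : sphere_bounded f -> sphere_bounded g ->
  sphere_bounded (fun x => f x * g x).
Proof.
move=> [mf [K fK]] [mg [L gL]]; split; first exact: cmeasurableM.
by exists (K * L) => x Sx; rewrite normrM ler_pM // ?fK ?gL.
Qed.

Lemma sphere_bounded_conj f : sphere_bounded f ->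
  sphere_bounded (fun x => (f x)^*).
Proof.
move=> [mf [K fK]]; split; first exact: cmeasurable_conj.
by exists K => x Sx; rewrite norm_conjC fK.
Qed.

Lemma sphere_bounded_sum (I : Type) (r : seq I) (P : pred I) F :
  (forall i, P i -> sphere_bounded (F i)) ->
  sphere_bounded (fun x => \sum_(i <- r | P i) F i x).
Proof.
move=> mF; elim: r => [|i r IH].
  under eq_fun do rewrite big_nil; exact: sphere_bounded_cst.
case Pi : (P i); last by under eq_fun do rewrite big_cons Pi.
by under eq_fun do rewrite big_cons Pi; apply: sphere_boundedD => //; exact: mF.
Qed.

Lemma sphere_bounded_prod (I : Type) (r : seq I) (P : pred I) F :
  (forall i, P i -> sphere_bounded (F i)) ->
  sphere_bounded (fun x => \prod_(i <- r | P i) F i x).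
Proof.
move=> mF; elim: r => [|i r IH].
  under eq_fun do rewrite big_nil; exact: sphere_bounded_cst.
case Pi : (P i); last by under eq_fun do rewrite big_cons Pi.
by under eq_fun do rewrite big_cons Pi; apply: sphere_boundedM => //; exact: mF.
Qed.

Lemma sphere_bounded_coord i : sphere_bounded (fun x => x i 0).
Proof.
split; first exact: cmeasurable_coord.
exists 1 => x Sx; rewrite -(@ler_pXn2r _ 2) ?nnegrE //.
by rewrite expr1n -[leRHS]Sx (bigD1 i) //= lerDl sumr_ge0 // => j _; exact: exprn_ge0.
Qed.

Lemma expect_integrable f : sphere_bounded f ->
  nu.-integrable D (EFin \o (fun x => rpart (f x))) /\
  nu.-integrable D (EFin \o (fun x => ipart (f x))).
Proof.
move=> [[mr mi] [K fK]].
split; apply: measurable_bounded_integrable => //.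
all: try exact: measurable_sphere.
all: try by rewrite (le_lt_trans (probability_le1 _ measurable_sphere)) ?ltry.
all: try by apply: measurable_funS; [| |exact: mr]; rewrite ?measurableT.
all: try by apply: measurable_funS; [| |exact: mi]; rewrite ?measurableT.
all: exists (rpart K); split; first exact: num_real.
- by move=> M KM x /fK/norm_rpart_le /le_trans; apply; exact: ltW.
- by move=> M KM x /fK/norm_ipart_le /le_trans; apply; exact: ltW.
Qed.

Lemma eq_expect f g : (forall x, @unit_sphere R N x -> f x = g x) ->
  expect f = expect g.
Proof.
by move=> fg; congr cpair; apply: eq_Rintegral => x; rewrite inE => /fg ->.
Qed.

Lemma expectD f g : sphere_bounded f -> sphere_bounded g ->
  expect (fun x => f x + g x) = expect f + expect g.
Proof.
move=> /expect_integrable[fr fi] /expect_integrable[gr gi].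
have mD := measurable_sphere.
rewrite /expect; apply: cpairP; rewrite ?rpartD ?ipartD /=.
  by rewrite -RintegralD //; apply: eq_Rintegral => x _; rewrite rpartD.
by rewrite -RintegralD //; apply: eq_Rintegral => x _; rewrite ipartD.
Qed.

Lemma expectZ c f : sphere_bounded f -> expect (fun x => c * f x) = c * expect f.
Proof.
move=> /expect_integrable[fr fi]; have mD := measurable_sphere.
have iZ (h : borelM R N 1 -> R) (a : R) : nu.-integrable D (EFin \o h) ->
    nu.-integrable D (EFin \o (fun x => a * h x)).
  by move=> ih; apply: (integrableZl mD a ih).
rewrite /expect; apply: cpairP; rewrite ?rpartM ?ipartM /=.
  rewrite -!RintegralZl // -RintegralB ?iZ //.
  by apply: eq_Rintegral => x _; rewrite rpartM.
rewrite -!RintegralZl // -RintegralD ?iZ //.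
by apply: eq_Rintegral => x _; rewrite ipartM.
Qed.

Lemma expect_cst c : expect (fun=> c) = c.
Proof.
rewrite /expect !Rintegral_cst; try exact: measurable_sphere.
have e : fine (nu D) = 1 by rewrite -[RHS]/(fine (1%E : \bar R)); congr fine; exact: nuS.1.
by rewrite !(mulrC _ (fine _)) e !mul1r; apply: cpairP.
Qed.

Lemma expect_sum (I : Type) (r : seq I) (P : pred I) F :
  (forall i, P i -> sphere_bounded (F i)) ->
  expect (fun x => \sum_(i <- r | P i) F i x) = \sum_(i <- r | P i) expect (F i).
Proof.
move=> mF; elim: r => [|i r IH].
  by rewrite big_nil -[RHS](expect_cst 0); apply: eq_expect => x _; rewrite big_nil.
rewrite big_cons; case Pi : (P i); last first.
  by rewrite -IH; apply: eq_expect => x _; rewrite big_cons Pi.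
rewrite -IH -expectD; [|exact: mF|exact: sphere_bounded_sum].
by apply: eq_expect => x _; rewrite big_cons Pi.
Qed.

Lemma unitary_sphere (U : 'M[C]_N) (x : 'cV[C]_N) : U \is unitarymx ->
  @unit_sphere R N (U *m x) <-> @unit_sphere R N x.
Proof.
move=> /unitarymxP UU; have {}UU : U^t* *m U = 1%:M by exact: mulmx1C.
have E (y : 'cV[C]_N) : \sum_(i < N) `|y i 0| ^+ 2 = (y^t* *m y) 0 0.
  by rewrite mxE; apply: eq_bigr => i _; rewrite !mxE normCK mulrC.
by rewrite /unit_sphere /= !E trmx_mul map_mxM mulmxA -(mulmxA _ _ U) UU mulmx1.
Qed.

Lemma mulmx_continuous (U : 'M[C]_N) : continuous (fun x : 'cV[C]_N => U *m x).
Proof.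
apply: mx_continuous => i j; under eq_fun do rewrite mxE.
apply: continuous_csum => k; apply: continuousM_C; first exact: cst_continuous.
exact: (coord_continuous (K := C)).
Qed.

Lemma sphere_bounded_unitary (U : 'M[C]_N) f : U \is unitarymx ->
  sphere_bounded f -> sphere_bounded (fun x => f (U *m x)).
Proof.
move=> Uu [[mr mi] [K fK]]; have mU := continuous_borelM (mulmx_continuous (U := U)).
split; last by exists K => x Sx; apply: fK; apply/unitary_sphere.
by split; [apply: (measurableT_comp mr)|apply: (measurableT_comp mi)].
Qed.

Lemma expect_unitary (U : 'M[C]_N) f : U \is unitarymx -> sphere_bounded f ->
  expect (fun x => f (U *m x)) = expect f.
Proof.
move=> Uu fb; have mU := continuous_borelM (mulmx_continuous (U := U)).
have fUb := sphere_bounded_unitary Uu fb.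
have DU : D = (fun x : 'cV[C]_N => U *m x) @^-1` D.
  by apply/seteqP; split => x /(unitary_sphere x Uu).
have inv (h : borelM R N 1 -> R) : measurable_fun setT h ->
    nu.-integrable D (EFin \o (fun x => h (U *m x))) ->
    \int[nu]_(x in D) h (U *m x) = \int[nu]_(x in D) h x.
  move=> mh ih; congr fine.
  have := @integral_pushforward _ _ _ _ R _ mU nu D (EFin \o h).
  rewrite -DU => <- //; last 2 first.
  - exact/measurable_EFinP.
  - exact: measurable_sphere.
  apply: eq_measure_integral => A mA _; exact: nuS.2.
have [ir ii] := expect_integrable fUb; case: fb => -[mr mi] _.
by rewrite /expect (inv (rpart \o f)) // (inv (ipart \o f)).
Qed.

End sphere_expectation.

(** * Schwinger-Dyson equations *)

(** This lets invariance under unitaries indexed by natural numbers be differentiated formally, by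
    comparing coefficients. *)
Lemma poly_nat_roots_eq0 (K : numDomainType) (q : {poly K}) :
  (forall n : nat, q.[n%:R] = 0) -> q = 0.
Proof.
move=> q0; apply: (@roots_geq_poly_eq0 _ q [seq n%:R | n <- iota 0 (size q)]).
- by apply/allP => _ /mapP[n _ ->]; apply/rootP.
- by rewrite map_inj_uniq ?iota_uniq // => m n /eqP; rewrite eqr_nat => /eqP.
- by rewrite size_map size_iota.
Qed.

Lemma coef1_one_plus_sqr (K : comNzRingType) k : ((1 + 'X^2 : {poly K}) ^+ k)`_1 = 0.
Proof.
have -> : ((1 + 'X^2 : {poly K}) ^+ k)`_1 = ((1 + 'X^2 : {poly K}) ^+ k)^`()`_0.
  by rewrite coef_deriv mulr1n.
rewrite -horner_coef0 deriv_exp derivD derivXn derivC add0r hornerMn hornerM.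
by rewrite hornerMn hornerX mul0rn mul0r mul0rn.
Qed.

Section schwinger_dyson.
Context {R : realType} (N : nat) (nu : probability (borelM R N 1) R).
Local Notation C := (Cplx R).
Hypothesis nuS : uniform_on_sphere nu.
Local Notation E := (expect nu).
Local Notation bounded := (@sphere_bounded R N).

(** Both sides of the hypothesis are polynomials in [n], so their linear coefficients agree; the
    power of 1 + n^2 has none. *)
Lemma expect_linear_term (S : finType) (al be : S -> 'cV[C]_N -> C) k :
  (forall s, bounded (al s)) -> (forall s, bounded (be s)) ->
  (forall n : nat, E (fun x => \prod_s (al s x + n%:R * be s x)) =
                   (1 + n%:R ^+ 2) ^+ k * E (fun x => \prod_s al s x)) ->
  \sum_s E (fun x => be s x * \prod_(t | t != s) al t x) = 0.
Proof.
move=> bal bbe h.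
pose eJ (J : {set S}) := E (fun x => \prod_s (if s \in J then be s x else al s x)).
(* Expansion of the product by distributivity: [J] is the set of factors from which the [be] term is
   taken. *)
pose q : {poly C} := \sum_(J : {set S}) eJ J *: 'X^#|J|.
have bJ (J : {set S}) :
    bounded (fun x => \prod_s (if s \in J then be s x else al s x)).
  by apply: sphere_bounded_prod => s _; case: (s \in J).
have qE : q = E (fun x => \prod_s al s x) *: (1 + 'X^2) ^+ k.
  apply/eqP; rewrite -subr_eq0; apply/eqP; apply: poly_nat_roots_eq0 => n.
  rewrite hornerD hornerN hornerZ horner_exp hornerD hornerC hornerXn [X in _ - X]mulrC -h.
  apply/eqP; rewrite subr_eq0; apply/eqP; rewrite /q horner_sum.
  transitivity (E (fun x => \sum_(J : {set S})
      n%:R ^+ #|J| * \prod_s (if s \in J then be s x else al s x))).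
    rewrite expect_sum // => [|J _]; last first.
      by apply: sphere_boundedM => //; exact: sphere_bounded_cst.
    by apply: eq_bigr => J _; rewrite (expectZ nu _ (bJ J)) hornerZ hornerXn mulrC.
  apply: eq_expect => x _; rewrite (eq_bigr (fun s => n%:R * be s x + al s x)) => [|s _]; last by rewrite addrC.
  rewrite bigA_distr; apply: eq_bigr => J _.
  rewrite -prodr_const [X in X * _]big_mkcond -big_split /=.
  by apply: eq_bigr => s _; case: ifP; rewrite ?mul1r.
have := congr1 (fun p : {poly C} => p`_1) qE.
rewrite coefZ coef1_one_plus_sqr mulr0 => q1; rewrite -[RHS]q1 coef_sum.
(* Only the singletons contribute in degree one. *)
rewrite (bigID (fun J : {set S} => J \in imset (@finset.set1 S) (mem S))) /=.
rewrite [X in _ + X]big1 ?addr0 => [|J /imsetP Jn]; last first.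
  rewrite coefZ coefXn; case: eqP => [/esym/eqP/cards1P[s Js]|_]; rewrite ?mulr0 //.
  by case: Jn; exists s.
rewrite big_imset /=; last by move=> s t _ _; exact: finset.set1_inj.
apply: eq_bigr => s _; rewrite coefZ coefXn cards1 eqxx mulr1; apply: eq_expect => x _.
rewrite [RHS](bigD1 s) //= inE eqxx; congr (_ * _).
by apply: eq_bigr => t ts; rewrite inE (negbTE ts).
Qed.

Definition mono (S : finType) (e f : S -> 'I_N) (A B : {set S}) (x : 'cV[C]_N) : C :=
  \prod_(s in A) x (e s) 0 * \prod_(s in B) (x (f s) 0)^*.

Lemma mono_bounded S e f A B : bounded (@mono S e f A B).
Proof.
apply: sphere_boundedM; apply: sphere_bounded_prod => s _.
  exact: sphere_bounded_coord.
by apply: sphere_bounded_conj; exact: sphere_bounded_coord.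
Qed.

Section fixed_monomial.
Variables (S : finType) (e f : S -> 'I_N) (A B : {set S}).
Hypothesis cAB : #|A| = #|B|.

Definition holo s b := E (fun x => x b 0 * mono e f (A :\ s) B x).
Definition anti s b := E (fun x => (x b 0)^* * mono e f A (B :\ s) x).

(** For Hermitian [G] this is the expected derivative of the monomial along the vector field x -> i
    G x, divided by i. Writing the conjugate of G_(f s, b) as G_(b, f s) makes it complex linear in
    [G], so that it makes sense for every matrix. *)
Definition derivation (G : 'M[C]_N) : C :=
  \sum_(s in A) \sum_b G (e s) b * holo s b -
  \sum_(s in B) \sum_b G b (f s) * anti s b.

(* Invariance under the unitaries [1 + (2 i n / (1 - i n)) P] is, after clearing
   denominators, a polynomial identity in [n]; this is its linear coefficient. *)
Lemma derivation_proj (P : 'M[C]_N) : P^t* = P -> P *m P = P -> derivation P = 0.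
Proof.
(* Chosen so that (1 - i n) U x = x + n y, where U is the unitary with parameter [n]. *)
move=> Ph Pi; pose y (i : 'I_N) (x : 'cV[C]_N) : C := 2 * 'i * (P *m x) i 0 - 'i * x i 0.
(* The left copy of [S] carries the holomorphic factors and the right copy the conjugated ones;
   factors outside [A] and [B] are padded to 1 + n * 0. *)
pose al (u : S + S) (x : 'cV[C]_N) : C := match u with
  | inl s => if s \in A then x (e s) 0 else 1
  | inr s => if s \in B then (x (f s) 0)^* else 1 end.
pose be (u : S + S) (x : 'cV[C]_N) : C := match u with
  | inl s => if s \in A then y (e s) x else 0
  | inr s => if s \in B then (y (f s) x)^* else 0 end.
have bc i : bounded (fun x => x i 0) by exact: sphere_bounded_coord.
have bP i : bounded (fun x => (P *m x) i 0).
  under eq_fun do rewrite mxE; apply: sphere_bounded_sum => j _.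
  by apply: sphere_boundedM => //; exact: sphere_bounded_cst.
have by_ i : bounded (y i).
  rewrite /y; apply: sphere_boundedD.
    by apply: sphere_boundedM => //; exact: sphere_bounded_cst.
  under eq_fun do rewrite -mulNr.
  by apply: sphere_boundedM => //; exact: sphere_bounded_cst.
have bal u : bounded (al u).
  case: u => s; rewrite ?/al ?/be /=; [case: (s \in A)|case: (s \in B)] => //=;
    try exact: sphere_bounded_cst.
  exact: sphere_bounded_conj.
have bbe u : bounded (be u).
  case: u => s; rewrite ?/al ?/be /=; [case: (s \in A)|case: (s \in B)] => //=;
    try exact: sphere_bounded_cst.
  exact: sphere_bounded_conj.
have alE x : \prod_u al u x = mono e f A B x.
  by rewrite big_sumType /= -!big_mkcond.
have Pconj i j : (P i j)^* = P j i by rewrite -[in RHS]Ph !mxE.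
have key n : E (fun x => \prod_u (al u x + n%:R * be u x)) =
    (1 + n%:R ^+ 2) ^+ #|A| * E (fun x => \prod_u al u x).
  set t : C := n%:R; pose c : C := 1 - 'i * t.
  have tJ : t^* = t by rewrite conjC_nat.
  have cJ : c^* = 1 + 'i * t.
    by rewrite rmorphB rmorphM rmorph1 /= conjCi tJ mulNr opprK.
  have ccJ : c * c^* = 1 + t ^+ 2.
    by rewrite cJ /c -subr_sqr expr1n exprMn sqrCi mulN1r opprK.
  have c0 : c != 0.
    have : c * c^* != 0 by rewrite ccJ gt_eqF // ltr_wpDr // ?exprn_ge0 ?ler0n.
    by rewrite mulf_eq0 negb_or => /andP[].
  pose z := 2 * 'i * t / c; pose U := 1%:M + z *: P.
  have zJ : z^* = - (2 * 'i * t) / c^*.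
    by rewrite rmorphM fmorphV !rmorphM /= conjCi tJ conjC_nat mulrN !mulNr.
  (* As [P] is a Hermitian idempotent, this scalar is the coefficient of [P] in U U^* - 1. *)
  have zz : z + z^* + z * z^* = 0.
    have cJ0 : c^* != 0 by rewrite conjC_eq0.
    apply/(mulIf (mulf_neq0 c0 cJ0)); rewrite mul0r.
    have -> : (z + z^* + z * z^*) * (c * c^*) =
        2 * 'i * t * c^* - 2 * 'i * t * c - (2 * 'i * t) ^+ 2.
      by rewrite zJ /z; field; rewrite c0 cJ0.
    rewrite cJ /c; ring: (@sqrCi C).
  have Uu : U \is unitarymx.
    apply/unitarymxP; have -> : U^t* = 1%:M + z^* *: P.
      rewrite /U linearD /= map_mxD trmx1 map_mx1 linearZ /= map_mxZ.
      by congr (_ + _ *: _).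
    rewrite /U mulmxDl !mulmxDr mul1mx mulmx1 mul1mx -scalemxAl -scalemxAr Pi.
    rewrite scalerA -addrA [X in _ + X](_ : _ = 0) ?addr0 //.
    by rewrite -!scalerDl addrA (addrC z^*) zz scale0r.
  have UE (x : 'cV[C]_N) i : x i 0 + t * y i x = c * (U *m x) i 0.
    have -> : (U *m x) i 0 = x i 0 + z * (P *m x) i 0.
      by rewrite mulmxDl mul1mx -scalemxAl mxE; congr (_ + _); rewrite mxE.
    have zc : z * c = 2 * 'i * t by rewrite /z divfK.
    transitivity (c * x i 0 + (z * c) * (P *m x) i 0); last by ring.
    by rewrite zc /y /c; ring.
  (* Each holomorphic factor brings [c] and each conjugated one its conjugate; as [A] and [B] have
     the same size, they pair up into powers of 1 + n^2. *)
  transitivity (E (fun x => (1 + t ^+ 2) ^+ #|A| * mono e f A B (U *m x))).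
    apply: eq_expect => x _; rewrite big_sumType /= -ccJ exprMn {2}cAB /mono.
    rewrite mulrACA; congr (_ * _).
      rewrite -prodr_const -big_split [RHS]big_mkcond /=; apply: eq_bigr => s _.
      by case: ifP => _; rewrite ?UE // mulr0 addr0.
    rewrite -prodr_const -big_split [RHS]big_mkcond /=; apply: eq_bigr => s _.
    case: ifP => _; rewrite ?mulr0 ?addr0 // -rmorphM -UE [RHS]rmorphD [X in _ = _ + X]rmorphM /= tJ //.
  have bU : bounded (fun x => mono e f A B (U *m x)).
    by apply: sphere_bounded_unitary => //; exact: mono_bounded.
  etransitivity; first exact: (expectZ nu _ bU).
  rewrite (expect_unitary nuS Uu (mono_bounded e f A B)).
  by congr (_ * _); apply: eq_expect => x _; rewrite alE.
have := @expect_linear_term _ al be #|A| bal bbe key.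
rewrite big_sumType /= [X in X + _](_ : _ = \sum_(s in A)
    (2 * 'i * (\sum_b P (e s) b * holo s b) - 'i * E (mono e f A B))); last first.
  rewrite [RHS]big_mkcond; apply: eq_bigr => s _; case: ifP => sA; last first.
    rewrite -[RHS](expect_cst nuS 0); apply: eq_expect => x _.
    by rewrite mul0r.
  have pE x : \prod_(t | t != inl s) al t x = mono e f (A :\ s) B x.
    rewrite big_sumType /= -[X in _ * X]big_mkcond; congr (_ * _).
    rewrite -big_mkcondr; apply: eq_bigl => t; rewrite !inE.
    by congr (_ && _).
  under eq_fun do rewrite pE.
  transitivity (E (fun x => 2 * 'i * (\sum_b P (e s) b * (x b 0 * mono e f (A :\ s) B x)) +
     - 'i * mono e f A B x)).
    apply: eq_expect => x _; rewrite /y.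
    have -> : mono e f A B x = x (e s) 0 * mono e f (A :\ s) B x.
      by rewrite /mono (big_setD1 s sA) /= mulrA.
    have -> : \sum_b P (e s) b * (x b 0 * mono e f (A :\ s) B x) =
        (P *m x) (e s) 0 * mono e f (A :\ s) B x.
      by rewrite mxE mulr_suml; apply: eq_bigr => b _; rewrite mulrA.
    by ring.
  have bh b : bounded (fun x => x b 0 * mono e f (A :\ s) B x).
    by apply: sphere_boundedM => //; exact: mono_bounded.
  have bPh b : bounded (fun x => P (e s) b * (x b 0 * mono e f (A :\ s) B x)).
    by apply: sphere_boundedM => //; exact: sphere_bounded_cst.
  have bs : bounded (fun x => \sum_b P (e s) b * (x b 0 * mono e f (A :\ s) B x)).
    exact: sphere_bounded_sum.
  have bm := mono_bounded e f A B.
  etransitivity; first apply: expectD.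
  - by apply: sphere_boundedM => //; exact: sphere_bounded_cst.
  - by apply: sphere_boundedM => //; exact: sphere_bounded_cst.
  rewrite -[- ('i * _)]mulNr; congr (_ + _); last exact: (expectZ nu _ bm).
  etransitivity; first exact: (expectZ nu _ bs); congr (_ * _).
  rewrite expect_sum //; apply: eq_bigr => b _; exact: (expectZ nu _ (bh b)).
rewrite [X in _ + X](_ : _ = \sum_(s in B)
    (- (2 * 'i) * (\sum_b P b (f s) * anti s b) + 'i * E (mono e f A B))); last first.
  rewrite [RHS]big_mkcond; apply: eq_bigr => s _; case: ifP => sB; last first.
    rewrite -[RHS](expect_cst nuS 0); apply: eq_expect => x _.
    by rewrite mul0r.
  have pE x : \prod_(t | t != inr s) al t x = mono e f A (B :\ s) x.
    rewrite big_sumType /= -[X in X * _]big_mkcond; congr (_ * _).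
    rewrite -big_mkcondr; apply: eq_bigl => t; rewrite !inE.
    by congr (_ && _).
  under eq_fun do rewrite pE.
  have bh b : bounded (fun x => (x b 0)^* * mono e f A (B :\ s) x).
    by apply: sphere_boundedM; [exact: sphere_bounded_conj|exact: mono_bounded].
  have bPh b : bounded (fun x => P b (f s) * ((x b 0)^* * mono e f A (B :\ s) x)).
    by apply: sphere_boundedM => //; exact: sphere_bounded_cst.
  have bs : bounded (fun x => \sum_b P b (f s) * ((x b 0)^* * mono e f A (B :\ s) x)).
    exact: sphere_bounded_sum.
  have bm := mono_bounded e f A B.
  transitivity (E (fun x => - (2 * 'i) *
      (\sum_b P b (f s) * ((x b 0)^* * mono e f A (B :\ s) x)) + 'i * mono e f A B x)).
    apply: eq_expect => x _; rewrite /y.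
    have -> : mono e f A B x = (x (f s) 0)^* * mono e f A (B :\ s) x.
      by rewrite /mono (big_setD1 s sB) /= mulrCA.
    have -> : \sum_b P b (f s) * ((x b 0)^* * mono e f A (B :\ s) x) =
        ((P *m x) (f s) 0)^* * mono e f A (B :\ s) x.
      rewrite mxE rmorph_sum mulr_suml; apply: eq_bigr => b _.
      by rewrite rmorphM /= Pconj mulrA.
    rewrite rmorphB !rmorphM /= conjCi conjC_nat; by ring.
  etransitivity; first apply: expectD.
  - by apply: sphere_boundedM => //; exact: sphere_bounded_cst.
  - by apply: sphere_boundedM => //; exact: sphere_bounded_cst.
  congr (_ + _); last exact: (expectZ nu _ bm).
  etransitivity; first exact: (expectZ nu _ bs); congr (_ * _).
  rewrite expect_sum //; apply: eq_bigr => b _; exact: (expectZ nu _ (bh b)).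
(* The terms in - i x cancel between the two sums because [A] and [B] have the same size; what is
   left is 2 i times the derivation. *)
rewrite !big_split /= -!mulr_sumr !sumr_const cAB => d0.
apply/eqP; rewrite -(mulrI_eq0 _ (lregP (_ : 2 * 'i != 0 :> C))); last first.
  by rewrite mulf_neq0 ?neq0Ci // pnatr_eq0.
rewrite -[X in _ == X]d0; apply/eqP; rewrite /derivation.
set a := \sum_(s in A) _; set b := \sum_(s in B) _; set m := E _.
by ring.
Qed.

Lemma derivation_linear c (G H : 'M[C]_N) :
  derivation (c *: G + H) = c * derivation G + derivation H.
Proof.
rewrite /derivation mulrBr !mulr_sumr addrACA -opprD -!big_split /=.
congr (_ - _); apply: eq_bigr => s _; rewrite mulr_sumr -big_split /=;
  by apply: eq_bigr => b _; rewrite !mxE mulrDl mulrA.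
Qed.

(** For |w| = 1, the orthogonal projection onto the line spanned by e_a + w e_b. *)
Definition pair_proj a b (w : C) : 'M[C]_N :=
  2^-1 *: (delta_mx a a + w^* *: delta_mx a b + w *: delta_mx b a + delta_mx b b).

Lemma pair_proj_herm a b w : (pair_proj a b w)^t* = pair_proj a b w.
Proof.
apply/matrixP => i j; rewrite !mxE !rmorphM !rmorphD !rmorphM /= conjCK fmorphV.
rewrite !conjC_nat; congr (_ * _); first by rewrite /= conjC_nat.
by rewrite ![(j == _) && _]andbC; ring.
Qed.

Lemma pair_proj_idem a b w : a != b -> w * w^* = 1 ->
  pair_proj a b w *m pair_proj a b w = pair_proj a b w.
Proof.
move=> ab ww; rewrite /pair_proj -scalemxAl -scalemxAr scalerA.
rewrite !mulmxDl !mulmxDr -!scalemxAl -!scalemxAr !mul_delta_mx_cond.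
have ba : (b == a) = false by rewrite eq_sym (negbTE ab).
rewrite !eqxx ba (negbTE ab) !mulr0n !mulr1n !scaler0 !scalerA (mulrC w^*) ww.
rewrite !addr0 !add0r !scale1r; apply/matrixP => i j; rewrite !mxE.
by field.
Qed.

(** Polarisation: the projections [pair_proj] with w = 1 and w = i, together with the diagonal
    matrix units, span all matrix units over the complex numbers. *)
Lemma derivation_delta a b : derivation (delta_mx a b) = 0.
Proof.
have d0 : derivation 0 = 0.
  have /esym/eqP := derivation_linear 1 0 0.
  by rewrite scale1r addr0 mul1r -subr_eq0 addrK => /eqP.
have dZ c G : derivation (c *: G) = c * derivation G.
  by have := derivation_linear c G 0; rewrite !addr0 d0 addr0.
have dD G H : derivation (G + H) = derivation G + derivation H.
  by have := derivation_linear 1 G H; rewrite scale1r mul1r.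
have daa i : derivation (delta_mx i i) = 0.
  apply: derivation_proj; last by rewrite mul_delta_mx.
  by rewrite trmx_delta; apply/matrixP => k l; rewrite !mxE conjC_nat.
have [->|ab] := eqVneq a b; first exact: daa.
have dp w : w * w^* = 1 -> w^* * derivation (delta_mx a b) +
    w * derivation (delta_mx b a) = 0.
  move=> ww; have := derivation_proj (pair_proj_herm a b w) (pair_proj_idem ab ww).
  rewrite dZ => /eqP; rewrite mulf_eq0 invr_eq0 pnatr_eq0 /= => /eqP.
  by rewrite !dD !dZ !daa add0r addr0.
have := dp 1; rewrite rmorph1 mulr1 !mul1r => /(_ erefl) e1.
have := dp 'i; rewrite conjCi mulrN -expr2 sqrCi opprK => /(_ erefl) /eqP.
rewrite mulNr addrC subr_eq0 => /eqP /(mulfI (neq0Ci C)) e2.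
move/eqP: e1; rewrite e2 -mulr2n -mulr_natl mulf_eq0 pnatr_eq0 /= => /eqP //.
Qed.

End fixed_monomial.

(** Replace the index of the conjugated factor at [t] by a free [b], apply the derivation along the
    matrix unit (f t, b), and sum over [b]. On the holomorphic side the sum of |x_b|^2 is 1 on the
    sphere, which removes a pair of factors. *)
Lemma schwinger_dyson (S : finType) (e f : S -> 'I_N) (A B : {set S}) t :
  #|A| = #|B| -> t \in B ->
  (N + #|B|.-1)%:R * E (mono e f A B) =
  \sum_(s in A | e s == f t) E (mono e f (A :\ s) (B :\ t)).
Proof.
move=> cAB tB; pose f' b s := if s == t then b else f s.
have f'E b (B' : {set S}) x : t \notin B' ->
    \prod_(s in B') (x (f' b s) 0)^* = \prod_(s in B') (x (f s) 0)^* :> C.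
  move=> tB'; apply: eq_bigr => s sB'; rewrite /f' ifN //.
  by apply: contraNneq tB' => <-.
have tt (B' : {set S}) : t \notin B' :\ t by rewrite !inE eqxx.
have main b : \sum_(s in A | e s == f t) holo e (f' b) A B s b =
    \sum_(s in B | f' b s == b) anti e (f' b) A B s (f t).
  have /eqP := derivation_delta e (f' b) cAB (f t) b; rewrite subr_eq0 => /eqP.
  rewrite !big_mkcondr /= => d0.
  transitivity (\sum_(s in A) \sum_c delta_mx (f t) b (e s) c * holo e (f' b) A B s c).
    apply: eq_bigr => s _; rewrite (bigD1 b) //= big1 ?addr0 => [|c cb].
      by rewrite mxE eqxx andbT; case: ifP => _; rewrite ?mul1r ?mul0r.
    by rewrite mxE (negbTE cb) andbF mul0r.
  rewrite d0; apply: eq_bigr => s _; rewrite (bigD1 (f t)) //= big1 ?addr0 => [|c cb].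
    by rewrite mxE eqxx /=; case: ifP => _; rewrite ?mul1r ?mul0r.
  by rewrite mxE (negbTE cb) mul0r.
have bm A' B' : bounded (mono e f A' B') by exact: mono_bounded.
have bc i : bounded (fun x => x i 0) by exact: sphere_bounded_coord.
have holoE s : \sum_b holo e (f' b) A B s b = E (mono e f (A :\ s) (B :\ t)).
  transitivity (E (fun x => \sum_b (x b 0 * (x b 0)^*) * mono e f (A :\ s) (B :\ t) x)).
    rewrite (expect_sum nuS) => [|b _]; last first.
      by do 2!apply: sphere_boundedM => //; exact: sphere_bounded_conj.
    apply: eq_bigr => b _; apply: eq_expect => x _.
    rewrite /mono (big_setD1 t tB) /= f'E // {1}/f' eqxx; by ring.
  apply: eq_expect => x Sx; rewrite -mulr_suml.
  by under eq_bigr do rewrite -normCK; rewrite Sx mul1r.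
(* The factor at [t] returns to its original index for each of the N values of [b]. Any other
   conjugated factor qualifies for exactly one [b], its own index; it then trades indices with the
   factor at [t], which leaves the monomial unchanged. *)
have antiE : \sum_b \sum_(s in B | f' b s == b) anti e (f' b) A B s (f t) =
    (N + #|B|.-1)%:R * E (mono e f A B).
  rewrite natrD mulrDl mulr_natl mulr_natl.
  transitivity (\sum_b (E (mono e f A B) +
      \sum_(s in B :\ t | f s == b) E (mono e f A B))).
    apply: eq_bigr => b _; rewrite (bigD1 t) /=; last by rewrite tB /f' eqxx eqxx.
    congr (_ + _).
      apply: eq_expect => x _; rewrite /mono f'E // (big_setD1 t tB) /=; by ring.
    apply: eq_big => s.
      rewrite !inE /f'; case: (s =P t) => _ /=; by rewrite ?andbF ?andbT.
    case/andP => /andP[sB sb] st; apply: eq_expect => x _.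
    have tBs : t \in B :\ s by rewrite !inE eq_sym st.
    have fsb : f s = b by move: sb; rewrite /f' (negbTE st) => /eqP.
    have stB : s \in B :\ t by rewrite !inE st.
    rewrite /mono (big_setD1 t tBs) /= f'E // {1}/f' eqxx (big_setD1 t tB) /=.
    rewrite (big_setD1 s stB) /= fsb.
    have -> : B :\ s :\ t = B :\ t :\ s.
      by apply/setP => u; rewrite !inE andbCA.
    by ring.
  rewrite big_split /= sumr_const card_ord; congr (_ + _).
  under eq_bigr do rewrite big_mkcondr /=.
  rewrite exchange_big /= -[#|B|.-1]/((1 + #|B|.-1).-1).
  have -> : #|B|.-1 = #|B :\ t| by rewrite (cardsD1 t B) tB.
  rewrite /= -sumr_const; apply: eq_bigr => s _.
  by rewrite -big_mkcond (big_pred1 (f s)) // => b; rewrite eq_sym.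
rewrite -antiE; under eq_bigr do rewrite -main.
by rewrite exchange_big /=; apply: eq_bigr => s _; exact: holoE.
Qed.

End schwinger_dyson.

(** * Networks of a pair of permutations *)

Lemma card_porbits1 (S : finType) : #|porbits (1%g : {perm S})| = #|S|.
Proof.
rewrite /porbits card_imset // => x y /setP/(_ x).
rewrite porbit_id => /esym/porbitP[i ->].
by rewrite expg1n perm1.
Qed.

Section constrained_sum.
Variables (S X : finType) (K : numFieldType).

Definition setval (s : S) (x : X) (i : {ffun S -> X}) : {ffun S -> X} :=
  [ffun u => if u == s then x else i u].

(** As [F] ignores the coordinate at [s], every value of that coordinate takes the same share of the
    full sum, unless r = s and the constraint is void. *)
Lemma sum_constraint (s r : S) (F : {ffun S -> X} -> K) : (0 < #|X|)%N ->
  (forall i x, F (setval s x i) = F i) ->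
  \sum_(i : {ffun S -> X} | i s == i r) F i =
  #|X|%:R ^- (r != s) * \sum_(i : {ffun S -> X}) F i.
Proof.
move=> X0 Fs; have [->|rs] := eqVneq r s.
  by rewrite expr0 invr1 mul1r; apply: eq_bigl => i; rewrite eqxx.
rewrite expr1; have nX : #|X|%:R != 0 :> K by rewrite pnatr_eq0 -lt0n.
apply: (mulfI nX); rewrite mulVKf // mulr_natl -sumr_const.
rewrite [RHS](partition_big (fun i : {ffun S -> X} => i s) predT) //=.
apply: eq_bigr => x _.
rewrite [RHS](reindex_onto (setval s x) (fun i => setval s (i r) i)); last first.
  by move=> i /eqP ix; apply/ffunP => u; rewrite !ffunE; case: eqP => // ->.
apply: eq_big => [i|i _]; last by rewrite Fs.
rewrite !ffunE eqxx eqxx (negbTE rs) /=; apply/eqP/eqP => [irs|/ffunP/(_ s)].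
  by apply/ffunP => u; rewrite !ffunE; case: eqP => // ->.
by rewrite !ffunE eqxx => ->.
Qed.

End constrained_sum.

Section network.
Context {R : realType} (d p : nat).
Local Notation N := (d * d * p)%N.
Variable nu : probability (borelM R N 1) R.
Hypothesis nuS : uniform_on_sphere nu.
Hypotheses (d0 : (0 < d)%N) (p0 : (0 < p)%N).
Local Notation C := (Cplx R).
Local Notation E := (expect nu).

Definition cell (i j : 'I_d) (a : 'I_p) : 'I_N :=
  mxtens_index (mxtens_index (i, j), a).

Lemma cell_eq i j a i' j' a' :
  (cell i j a == cell i' j' a') = [&& i == i', j == j' & a == a'].
Proof.
apply/eqP/and3P => [e|[/eqP-> /eqP-> /eqP->] //].
have e1 := congr1 (fun k => mxtens_unindex (@mxtens_unindex (d * d) p k).1) e.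
have e2 := congr1 (fun k => (@mxtens_unindex (d * d) p k).2) e.
by move: e1 e2; rewrite !mxtens_indexK /= => -[-> ->] ->.
Qed.

Variable S : finType.
Implicit Types (A : {set S}) (g h : {perm S}) (s t : S).
Local Notation idx := {ffun S -> 'I_d}.
Local Notation anc := {ffun S -> 'I_p}.

(* Both factors of a term share the ancilla index [a u], which is the partial
   trace over C^p. *)
Definition net_mono A g h (i j : idx) (a : anc) : 'cV[C]_N -> C :=
  mono (fun u => cell (i u) (j u) (a u))
       (fun u => cell (i (g u)) (j (h u)) (a u)) A A.

(** The sums range over indices on all of [S], so that the index type does not change when points
    are removed; a point outside [A] only contributes a free factor, which [nnet] divides out. Real
    parts are compatible with the recursion because its coefficients are real. *)
Definition net A g h : R :=
  \sum_(i : idx) \sum_(j : idx) \sum_(a : anc) rpart (E (net_mono A g h i j a)).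

Lemma splice_neq s t g u : u != s -> splice s t g u != s.
Proof. by move=> us; rewrite -[X in _ != X](splice_id s t g) (inj_eq perm_inj). Qed.

(** A spliced permutation fixes [s], hence never sends another point to [s]: the indices at [s] no
    longer occur. *)
Lemma net_mono_indep A g h s t (i j : idx) (a : anc) :
  let F := net_mono (A :\ s) (splice s t g) (splice s t h) in
  (forall x, F (setval s x i) j a = F i j a) /\
  (forall x, F i (setval s x j) a = F i j a) /\
  (forall x, F i j (setval s x a) = F i j a).
Proof.
have off (X : finType) (x : X) (k : {ffun S -> X}) u :
  u != s -> setval s x k u = k u by move=> us; rewrite ffunE (negbTE us).
rewrite /net_mono /mono; split; [|split] => x; apply/funext => y;
  congr (_ * _); apply: eq_bigr => u /setD1P[us _]; rewrite ?off //;
  by rewrite splice_neq.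
Qed.

(** The origin of [splice]: exchanging [s] and [t] among the conjugated factors produces its first
    transposition, and the second one is invisible because the index takes equal values at [s] and
    at the image of [t]. *)
Lemma net_contract A g h s t (i j : idx) (a : anc) :
  t \in A -> s \in A ->
  i s = i (g t) -> j s = j (h t) -> a s = a t ->
  mono (fun u => cell (i u) (j u) (a u))
       (fun u => cell (i (g u)) (j (h u)) (a u)) (A :\ s) (A :\ t) =
  net_mono (A :\ s) (splice s t g) (splice s t h) i j a :> ('cV[C]_N -> C).
Proof.
move=> tA sA ig jh at_; apply/funext => x; rewrite /net_mono /mono; congr (_ * _).
have swap (X : finType) (k : {ffun S -> X}) (q r v : S) :
    k q = k r -> k (tperm q r v) = k v.
  by move=> kqr; case: tpermP => [->|->|//].
rewrite (reindex_inj (@perm_inj _ (tperm s t))) /=; apply: eq_big => u.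
  rewrite !inE; case: tpermP => [->|->|/eqP us /eqP ut].
  - by rewrite eqxx eqxx.
  - by rewrite sA tA eq_sym.
  - by rewrite us ut.
by move=> _; rewrite !spliceE !swap.
Qed.

(** Each term of the Schwinger-Dyson equation at [t] forces three equalities of indices. Each costs
    a factor 1/d or 1/p when the free sum at [s] is restored, unless it is void. *)
Lemma net_rec A g h t : t \in A ->
  (N + #|A|.-1)%:R * net A g h = \sum_(s in A)
    d%:R ^- (g t != s) * (d%:R ^- (h t != s) * (p%:R ^- (t != s) *
    net (A :\ s) (splice s t g) (splice s t h))).
Proof.
move=> tA; rewrite /net mulr_sumr.
transitivity (\sum_(s in A) \sum_(i : idx | i s == i (g t))
    \sum_(j : idx | j s == j (h t)) \sum_(a : anc | a s == a t)
    rpart (E (net_mono (A :\ s) (splice s t g) (splice s t h) i j a))).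
  transitivity (\sum_(s in A) \sum_(i : idx) \sum_(j : idx) \sum_(a : anc)
      if [&& i s == i (g t), j s == j (h t) & a s == a t] then
      rpart (E (net_mono (A :\ s) (splice s t g) (splice s t h) i j a)) else 0).
    rewrite [RHS]exchange_big /=; apply: eq_bigr => i _; rewrite mulr_sumr.
    rewrite [RHS]exchange_big /=; apply: eq_bigr => j _; rewrite mulr_sumr.
    rewrite [RHS]exchange_big /=; apply: eq_bigr => a _ /=.
    pose e u := cell (i u) (j u) (a u).
    pose f u := cell (i (g u)) (j (h u)) (a u).
    have := @schwinger_dyson _ _ _ nuS S e f A A t erefl tA.
    move/(congr1 rpart); rewrite rpartM rpart_nat ipart_nat mul0r subr0.
    move=> ->; rewrite (big_morph rpart rpartD erefl) big_mkcondr /=.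
    apply: eq_bigr => s sA; rewrite cell_eq.
    by case: and3P => // -[/eqP ig /eqP jh /eqP at_]; rewrite net_contract.
  apply: eq_bigr => s _; rewrite [RHS]big_mkcond; apply: eq_bigr => i _.
  case: (i s == _) => /=; last by rewrite big1 // => j _; rewrite big1.
  rewrite [RHS]big_mkcond; apply: eq_bigr => j _.
  by case: (j s == _) => /=; [rewrite -big_mkcond|rewrite big1].
apply: eq_bigr => s sA.
have sd (F : idx -> R) r : (forall i x, F (setval s x i) = F i) ->
    \sum_(i : idx | i s == i r) F i = d%:R ^- (r != s) * \sum_i F i.
  by move=> Fs; have := @sum_constraint S 'I_d R s r F; rewrite card_ord; exact.
have sp (F : anc -> R) r : (forall i x, F (setval s x i) = F i) ->
    \sum_(i : anc | i s == i r) F i = p%:R ^- (r != s) * \sum_i F i.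
  by move=> Fs; have := @sum_constraint S 'I_p R s r F; rewrite card_ord; exact.
have ind i j a := net_mono_indep A g h s t i j a.
rewrite sd; last first.
  move=> i x; apply: eq_bigr => j _; apply: eq_bigr => a _.
  by have [-> _] := ind i j a.
congr (_ * _); rewrite !mulr_sumr; apply: eq_bigr => i _.
rewrite sd; last first.
  by move=> j x; apply: eq_bigr => a _; have [_ [-> _]] := ind i j a.
congr (_ * _); rewrite mulr_sumr; apply: eq_bigr => j _.
by rewrite sp // => a x; have [_ [_ ->]] := ind i j a.
Qed.

End network.

(** * Normalised networks and the weights of their recursion *)

Section weights.
Context {R : realType} {S : finType}.
Implicit Types (g h : {perm S}) (s t : S).

(** By [splice_porbits], [d] to the number of cycles gained, divided by the factor [d] that the
    index constraint in [net_rec] costs when it is not void. *)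
Definition orbit_weight (d : nat) g s t : R :=
  if s \in porbit g t then d%:R ^+ (s != t) else d%:R^-1.

(** The square of [d] comes from the factor d^(2 #|A|) of [nnet]. The removed point raises the power
    of [p] in the denominator of [nnet] by one, which cancels 1/p for s != t and leaves [p] for s =
    t. *)
Definition splice_weight (d p k : nat) g h s t : R :=
  d%:R ^+ 2 * p%:R ^+ (s == t) * orbit_weight d g s t * orbit_weight d h s t /
  (d * d * p + k.-1)%:R.

Lemma porbits_splice_weight d g s t : (0 < d)%N ->
  d%:R ^+ #|porbits (splice s t g)| =
  d%:R ^+ #|porbits g| * orbit_weight d g s t * d%:R ^+ (g t != s) :> R.
Proof.
move=> d0; have nd : d%:R != 0 :> R by rewrite pnatr_eq0 -lt0n.
have := splice_porbits s t g; rewrite /orbit_weight.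
case: ifP => [_|sg] /= => [|e]; first by rewrite addn0 -!exprD => ->.
have st : s != t by apply: contraFneq sg => ->; exact: porbit_id.
apply: (mulIf (expf_neq0 2 nd)); rewrite -exprD e st !exprD expr1.
by rewrite -!mulrA; congr (_ * _); rewrite [RHS]mulrCA expr2 mulKf // mulrC.
Qed.

End weights.

Section normalized_network.
Context {R : realType} (d p : nat).
Variable nu : probability (borelM R (d * d * p) 1) R.
Hypothesis nuS : uniform_on_sphere nu.
Hypotheses (d0 : (0 < d)%N) (p0 : (0 < p)%N).
Variable S : finType.
Implicit Types (A : {set S}) (g h : {perm S}) (s t : S).

(* The normalisation for which the limit as [d] grows is finite and nonzero on
   the networks of traces. *)
Definition nnet A g h : R := d%:R ^+ (2 * #|A|) * net nu A g h /
  (d%:R ^+ #|porbits g| * d%:R ^+ #|porbits h| * p%:R ^+ (#|S| - #|A|)).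

Lemma nnet0 : nnet finset.set0 1%g 1%g = 1.
Proof.
have nd : d%:R != 0 :> R by rewrite pnatr_eq0 -lt0n.
have np : p%:R != 0 :> R by rewrite pnatr_eq0 -lt0n.
rewrite /nnet; have -> : net nu finset.set0 1%g (1%g : {perm S}) =
    d%:R ^+ #|S| * d%:R ^+ #|S| * p%:R ^+ #|S|.
  rewrite /net.
  transitivity (\sum_(i : {ffun S -> 'I_d}) \sum_(j : {ffun S -> 'I_d})
      \sum_(a : {ffun S -> 'I_p}) (1 : R)).
    apply: eq_bigr => i _; apply: eq_bigr => j _; apply: eq_bigr => a _.
    rewrite -[RHS]/(rpart (1 : Cplx R)) -(expect_cst nuS 1); congr rpart.
    by apply: eq_expect => x _; rewrite /net_mono /mono !big_set0 mulr1.
  rewrite !sumr_const !card_ffun !card_ord -!mulrnA -!natrX -!natrM.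
  by congr (_%:R); rewrite mulnC.
rewrite cards0 muln0 expr0 mul1r subn0 card_porbits1 divff //.
by rewrite !mulf_neq0 ?expf_neq0.
Qed.

Lemma nnet_rec A g h t : t \in A ->
  nnet A g h = \sum_(s in A) splice_weight d p #|A| g h s t *
                 nnet (A :\ s) (splice s t g) (splice s t h).
Proof.
move=> tA; have nd : d%:R != 0 :> R by rewrite pnatr_eq0 -lt0n.
have np : p%:R != 0 :> R by rewrite pnatr_eq0 -lt0n.
set D : R := (d * d * p + #|A|.-1)%:R.
have nD : D != 0.
  by rewrite pnatr_eq0 -lt0n ltn_addr // !muln_gt0 d0 p0.
have := net_rec nuS d0 p0 g h tA; rewrite -/D => e.
rewrite /nnet (_ : net nu A g h = D^-1 * (D * net nu A g h)); last by rewrite mulKf.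
rewrite e !mulr_sumr mulr_suml; apply: eq_bigr => s sA.
have cA : #|A| = #|A :\ s|.+1 by rewrite (cardsD1 s A) sA.
have cS : (#|A| <= #|S|)%N by rewrite max_card.
have -> : (#|S| - #|A :\ s| = (#|S| - #|A|).+1)%N by rewrite cA subnSK // -cA.
rewrite /splice_weight -/D !porbits_splice_weight // [in (2 * #|A|)%N]cA mulnS exprD (exprS p%:R).
have ow k : orbit_weight d k s t != 0 :> R.
  by rewrite /orbit_weight; case: ifP => _; rewrite ?invr_eq0 ?expf_neq0.
have -> : p%:R ^- (t != s) = p%:R ^+ (s == t) / p%:R :> R.
  by rewrite eq_sym; case: eqP => _; rewrite ?invr1 ?divff //= expr0 mul1r.
move: (orbit_weight d g s t) (orbit_weight d h s t) (ow g) (ow h) => wg wh wg0 wh0.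
have ng := expf_neq0 #|porbits g| nd; have nh := expf_neq0 #|porbits h| nd.
have n1 := expf_neq0 (g t != s) nd; have n2 := expf_neq0 (h t != s) nd.
have n3 := expf_neq0 (#|S| - #|A|) np.
move: ng nh n1 n2 n3; move: (_ ^+ #|porbits g|) (_ ^+ #|porbits h|) (_ ^+ (g t != s))
  (_ ^+ (h t != s)) (_ ^+ (#|S| - #|A|)) => x1 x2 x3 x4 x5 ng nh n1 n2 n3.
move: (_ ^+ (2 * #|A :\ s|)) (_ ^+ (s == t)) (net _ _ _ _) => y1 y2 y3.
clearbody D; by field; rewrite ?ng ?nh ?n1 ?n2 ?n3 ?nD ?np ?wg0 ?wh0.
Qed.

End normalized_network.

Lemma cvg_sum_seq (R : realType) (I : Type) (r : seq I) (P : pred I)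
    (f : I -> nat -> R) (l : I -> R) :
  (forall i, P i -> f i n @[n --> \oo] --> l i) ->
  \sum_(i <- r | P i) f i n @[n --> \oo] --> \sum_(i <- r | P i) l i.
Proof.
move=> fl; elim: r => [|i r IH].
  by rewrite big_nil; under eq_fun do rewrite big_nil; exact: cvg_cst.
rewrite big_cons; case Pi : (P i); under eq_fun do rewrite big_cons Pi; last by [].
by apply: cvgD => //; exact: fl.
Qed.

(** * Limits of normalised networks in large dimension *)

Section network_limit.
Context {R : realType} {S : finType} (al : R) (p : nat -> nat).
Implicit Types (A : {set S}) (g h : {perm S}) (s t : S).
Hypothesis p_inv : (p n)%:R^-1 @[n --> \oo] --> (0 : R).
Hypothesis p_ratio : n%:R ^+ 2 / (p n)%:R @[n --> \oo] --> al^-1.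
Variable v : nat -> {set S} -> {perm S} -> {perm S} -> R.
Hypothesis p_pos : \forall n \near \oo, (0 < p n)%N.
Hypothesis v0 : \forall n \near \oo, v n finset.set0 1%g 1%g = 1.
Hypothesis vrec : \forall n \near \oo, forall A g h t, t \in A ->
  v n A g h = \sum_(s in A) splice_weight n (p n) #|A| g h s t *
                v n (A :\ s) (splice s t g) (splice s t h).

(** With p of order al n^2, the weight is asymptotic to 1 for s = t, to n^2/p if [s] is split off in
    both permutations, to 1/p if in exactly one, and to 1/(n^2 p) if in none. *)
Lemma weight_limit (k : nat) g h s t :
  splice_weight n (p n) k g h s t @[n --> \oo] -->
  (if s == t then 1 else
   if (s \in porbit g t) && (s \in porbit h t) then al^-1 else 0 : R).
Proof.
pose c : R := k.-1%:R.
have n_inv : (n%:R^-1 : R) @[n --> \oo] --> (0 : R).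
  apply/gtr0_cvgV0; first by near=> n; rewrite ltr0n; near: n; exact: nbhs_infty_gt.
  exact: cvgr_idn.
(* The ratio of n^2 p to the true denominator n^2 p + k - 1; it tends to 1, so the weights may be
   computed without the shift. *)
pose u n : R := (1 + c * (n%:R^-1 * n%:R^-1 * (p n)%:R^-1))^-1.
have ul : u n @[n --> \oo] --> (1 : R).
  rewrite -[X in _ --> X]invr1; apply: cvgV; first exact: oner_neq0.
  rewrite -[X in _ --> X]addr0; apply: cvgD; first exact: cvg_cst.
  rewrite -(mulr0 c); apply: cvgMl_tmp; rewrite -(mul0r (0 : R)); apply: cvgM => //.
  by rewrite -(mul0r (0 : R)); exact: cvgM.
have uE : \forall n \near \oo, [/\ n%:R != 0 :> R, (p n)%:R != 0 :> R &
    (n * n * p n + k.-1)%:R^-1 = u n * (n%:R^-1 * n%:R^-1 * (p n)%:R^-1)].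
  near=> n; have n0 : n%:R != 0 :> R.
    by rewrite pnatr_eq0 -lt0n; near: n; exact: nbhs_infty_gt.
  have pn0 : (p n)%:R != 0 :> R by rewrite pnatr_eq0 -lt0n; near: n.
  split => //; rewrite /u natrD !natrM -/c -!invfM; congr (_^-1).
  by field; rewrite n0 pn0.
have lim_of (w : nat -> R) (l : R) : w n @[n --> \oo] --> l ->
    (forall n, n%:R != 0 :> R -> (p n)%:R != 0 :> R ->
      n%:R ^+ 2 * (p n)%:R ^+ (s == t) * orbit_weight n g s t * orbit_weight n h s t *
      (n%:R^-1 * n%:R^-1 * (p n)%:R^-1) = w n) ->
    splice_weight n (p n) k g h s t @[n --> \oo] --> l.
  move=> wl wE; rewrite -(mul1r l).
  apply: cvg_trans (cvgM ul wl); apply: near_eq_cvg; near=> n.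
  have [n0 pn0 e] : [/\ n%:R != 0 :> R, (p n)%:R != 0 :> R &
    (n * n * p n + k.-1)%:R^-1 = u n * (n%:R^-1 * n%:R^-1 * (p n)%:R^-1)] by near: n.
  by rewrite /splice_weight e mulrCA wE.
case: (eqVneq s t) lim_of => [->|st] lim_of.
  apply: (lim_of (fun=> 1)); first exact: cvg_cst.
  move=> n n0 pn0; rewrite /orbit_weight !porbit_id eqxx expr1 expr0.
  by field; rewrite n0 pn0.
case: ifP => [/andP[sg sh]|sgh].
  apply: lim_of p_ratio _ => n n0 pn0; rewrite /orbit_weight sg sh st expr1 expr0.
  by field; rewrite n0 pn0.
have [sg|sg] := boolP (s \in porbit g t).
  rewrite sg /= in sgh; apply: lim_of p_inv _ => n n0 pn0.
  rewrite /orbit_weight sg sgh st expr1 expr0.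
  by field; rewrite n0 pn0.
have [sh|sh] := boolP (s \in porbit h t).
  apply: lim_of p_inv _ => n n0 pn0; rewrite /orbit_weight (negbTE sg) sh st expr1 expr0.
  by field; rewrite n0 pn0.
apply: (lim_of (fun n => n%:R^-1 * n%:R^-1 * (p n)%:R^-1)).
  rewrite -(mulr0 (0 * 0 : R)); apply: cvgM => //.
  exact: cvgM.
move=> n n0 pn0; rewrite /orbit_weight (negbTE sg) (negbTE sh) expr0.
by field; rewrite n0 pn0.
Unshelve. all: by end_near. Qed.

Definition net_lim A g h : R := lim (v n A g h @[n --> \oo]).

Lemma vrec_lim A g h t (l : S -> R) : t \in A ->
  (forall s, s \in A ->
     v n (A :\ s) (splice s t g) (splice s t h) @[n --> \oo] --> l s) ->
  v n A g h @[n --> \oo] --> \sum_(s in A) (if s == t then 1 else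
    if (s \in porbit g t) && (s \in porbit h t) then al^-1 else 0) * l s.
Proof.
move=> tA ls.
have e : \forall n \near \oo, \sum_(s in A) splice_weight n (p n) #|A| g h s t *
    v n (A :\ s) (splice s t g) (splice s t h) = v n A g h.
  near=> n; apply/esym; move: (t) tA; near: n.
  by apply: filterS vrec => n vn; move=> u uA; rewrite (vn A g h u uA).
apply: cvg_trans (near_eq_cvg e) _.
apply: cvg_sum_seq => s sA; apply: cvgM; last exact: ls.
exact: weight_limit.
Unshelve. all: by end_near. Qed.

Lemma v0_cvg : v n finset.set0 1%g 1%g @[n --> \oo] --> (1 : R).
Proof.
have e : \forall n \near \oo, (1 : R) = v n finset.set0 1%g 1%g.
  by apply: filterS v0 => n ->.
by apply: cvg_trans (near_eq_cvg e) _; exact: cvg_cst.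
Qed.

Lemma net_cvg A g h : perm_on A g -> perm_on A h ->
  v n A g h @[n --> \oo] --> net_lim A g h.
Proof.
have [k] := ubnP #|A|; elim: k A g h => // k IH A g h; rewrite ltnS => Ak gA hA.
suff : cvg (v n A g h @[n --> \oo]) by [].
have [A0|[t tA]] := set_0Vmem A; last first.
  pose l s := net_lim (A :\ s) (splice s t g) (splice s t h).
  apply/cvg_ex; eexists; apply: (@vrec_lim A g h t l tA) => s sA.
  apply: IH; rewrite ?splice_on // (leq_trans _ Ak) //.
  by rewrite [X in (_ < X)%N](cardsD1 s) sA.
have one (f : {perm S}) : perm_on A f -> f = 1%g.
  by move=> fA; apply/permP => x; rewrite perm1 (out_perm fA) // A0 inE.
rewrite (one g gA) (one h hA) A0; by apply/cvg_ex; exists 1; exact: v0_cvg.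
Qed.

Lemma net_lim0 : net_lim finset.set0 1%g 1%g = 1.
Proof.
by apply: cvg_lim => //; exact: v0_cvg.
Qed.

Lemma net_lim_rec A g h t : perm_on A g -> perm_on A h -> t \in A ->
  net_lim A g h = net_lim (A :\ t) (splice t t g) (splice t t h) +
    al^-1 * \sum_(s in A | [&& s != t, s \in porbit g t & s \in porbit h t])
       net_lim (A :\ s) (splice s t g) (splice s t h).
Proof.
move=> gA hA tA; apply: cvg_lim => //.
have := @vrec_lim A g h t (fun s => net_lim (A :\ s) (splice s t g) (splice s t h)) tA.
move=> /(_ (fun s sA => net_cvg (splice_on gA sA tA) (splice_on hA sA tA))).
congr (_ --> _); rewrite (bigD1 t) //= eqxx mul1r; congr (_ + _).
rewrite mulr_sumr big_mkcondr [RHS]big_mkcondr; apply: eq_bigr => s sA.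
by case: eqP => //= _; case: ifP => _; rewrite ?mul0r.
Qed.

Lemma net_cycles_cvg (c : nat -> R) (qs : seq (seq S)) g :
  c 0 = 1 ->
  (forall k, c k.+1 = c k + al^-1 * \sum_(m < k) c m * c (k - m.+1)%N) ->
  uniq (flatten qs) -> all (fcycle g) qs ->
  perm_on (finset (fun x => x \in flatten qs)) g ->
  v n (finset (fun x => x \in flatten qs)) g (g^-1)%g @[n --> \oo] -->
    \prod_(q <- qs) c (size q).
Proof.
move=> c0 cS uq gq gA; rewrite -(cycle_product c0 cS net_lim0 net_lim_rec uq gq gA).
exact: net_cvg gA (perm_onV gA).
Qed.

End network_limit.

(** * Traces of powers as networks *)

Section sums_over_functions.
Variables (V : nmodType) (X : finType).

Definition fcons k (x : X) (u : {ffun 'I_k -> X}) : {ffun 'I_k.+1 -> X} :=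
  [ffun t => if unlift ord0 t is Some t' then u t' else x].

Lemma fcons0 k x (u : {ffun 'I_k -> X}) : fcons x u ord0 = x.
Proof. by rewrite ffunE unlift_none. Qed.

Lemma fconsS k x (u : {ffun 'I_k -> X}) t : fcons x u (lift ord0 t) = u t.
Proof. by rewrite ffunE liftK. Qed.

Lemma big_fcons k (F : {ffun 'I_k.+1 -> X} -> V) :
  \sum_(u : {ffun 'I_k.+1 -> X}) F u = \sum_x \sum_(u : {ffun 'I_k -> X}) F (fcons x u).
Proof.
rewrite pair_bigA /= (reindex (fun xu : X * {ffun 'I_k -> X} => fcons xu.1 xu.2)) //.
exists (fun u : {ffun 'I_k.+1 -> X} => (u ord0, [ffun t => u (lift ord0 t)])).
  move=> [x u] _ /=; rewrite fcons0; congr pair.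
  by apply/ffunP => t; rewrite ffunE fconsS.
move=> u _; apply/ffunP => t; case: (unliftP ord0 t) => [t' ->|->].
  by rewrite fconsS ffunE.
by rewrite fcons0.
Qed.

Definition fsum (S1 S2 : finType) (u1 : {ffun S1 -> X}) (u2 : {ffun S2 -> X}) :
    {ffun S1 + S2 -> X} :=
  [ffun t => match t with inl t1 => u1 t1 | inr t2 => u2 t2 end].

Lemma big_fsum (S1 S2 : finType) (F : {ffun S1 + S2 -> X} -> V) :
  \sum_(u : {ffun S1 + S2 -> X}) F u =
  \sum_(u1 : {ffun S1 -> X}) \sum_(u2 : {ffun S2 -> X}) F (fsum u1 u2).
Proof.
rewrite pair_bigA /= (reindex (fun uu : {ffun S1 -> X} * {ffun S2 -> X} => fsum uu.1 uu.2)) //.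
exists (fun u : {ffun S1 + S2 -> X} => ([ffun t => u (inl t)], [ffun t => u (inr t)])).
  by move=> [u1 u2] _ /=; congr pair; apply/ffunP => t; rewrite !ffunE.
by move=> u _; apply/ffunP => -[t|t]; rewrite !ffunE.
Qed.

End sums_over_functions.

Section trace_power.
Variables (K : comPzRingType) (n : nat) (B : 'M[K]_n).

(** Step [t] leads from entry [t] of the list a, u, b to the next one; [unlift ord_max] fails
    exactly at the last step, which ends in [b]. *)
Definition walk k (a : 'I_n) (u : {ffun 'I_k -> 'I_n}) (b : 'I_n) : K :=
  \prod_(t < k.+1) B (fcons a u t) (if unlift ord_max t is Some t' then u t' else b).

Lemma mx_pow_walk k a b : (B ^+ k.+1) a b = \sum_(u : {ffun 'I_k -> 'I_n}) walk a u b.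
Proof.
elim: k a b => [|k IH] a b.
  rewrite expr1 (big_pred1 [ffun t : 'I_0 => a]) /walk => [|u]; last first.
    by apply/esym/eqP/ffunP => -[].
  by rewrite big_ord1 fcons0 (_ : ord0 = ord_max) ?unlift_none //; exact: val_inj.
rewrite exprS mxE big_fcons; apply: eq_bigr => c _.
rewrite IH mulr_sumr; apply: eq_bigr => u _; rewrite /walk [RHS]big_ord_recl.
congr (_ * _).
  rewrite fcons0 (_ : ord0 = lift ord_max ord0) ?liftK ?fcons0 //; exact: val_inj.
apply: eq_bigr => t _; rewrite fconsS; congr (B _ _).
case: (unliftP ord_max t) => [t' ->|->].
  rewrite (_ : lift ord0 (lift ord_max t') = lift ord_max (lift ord0 t')).
    by rewrite liftK fconsS.
  have tk : (k <= t')%N = false by rewrite leqNgt ltn_ord.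
  by apply: val_inj; rewrite /= /bump /= !add1n ltnS tk.
by rewrite (_ : lift ord0 ord_max = ord_max) ?unlift_none //; exact: val_inj.
Qed.

Definition cyc_sum k : K :=
  \sum_(u : {ffun 'I_k -> 'I_n}) \prod_(t < k) B (u t) (u (ordS t)).

(** The empty cycle gives 1, whereas the trace of the zeroth power is [n]. This is why [ntrE]
    divides only for positive exponents. *)
Lemma cyc_sum0 : cyc_sum 0 = 1.
Proof.
rewrite /cyc_sum.
under eq_bigr do rewrite big_ord0.
by rewrite sumr_const card_ffun !card_ord.
Qed.

Lemma trace_pow k : \tr (B ^+ k.+1) = cyc_sum k.+1.
Proof.
rewrite /cyc_sum big_fcons; apply: eq_bigr => a _; rewrite mx_pow_walk.
apply: eq_bigr => u _; apply: eq_bigr => t _; congr (B _ _).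
case: (unliftP ord_max t) => [t' ->|->].
  rewrite (_ : ordS (lift ord_max t') = lift ord0 t') ?fconsS //.
  apply: val_inj; rewrite /= /bump leqNgt ltn_ord add0n modn_small ?add1n //.
  by rewrite ltnS ltn_ord.
rewrite (_ : ordS ord_max = ord0) ?fcons0 //.
by apply: val_inj; rewrite /= modnn.
Qed.

Lemma cyc_sumM k l : cyc_sum k * cyc_sum l =
  \sum_(u : {ffun 'I_k + 'I_l -> 'I_n})
    \prod_t B (u t) (u (match t with inl s => inl (ordS s) | inr s => inr (ordS s) end)).
Proof.
rewrite big_fsum /cyc_sum mulr_suml; apply: eq_bigr => u1 _.
rewrite mulr_sumr; apply: eq_bigr => u2 _; rewrite big_sumType /=.
by congr (_ * _); apply: eq_bigr => t _; rewrite !ffunE.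
Qed.

End trace_power.

Section two_cycles.
Variables k l : nat.

Definition rotate2 (t : 'I_k + 'I_l) : 'I_k + 'I_l :=
  match t with inl s => inl (ordS s) | inr s => inr (ordS s) end.

Lemma rotate2_inj : injective rotate2.
Proof.
pose back (t : 'I_k + 'I_l) : 'I_k + 'I_l :=
  match t with inl s => inl (ord_pred s) | inr s => inr (ord_pred s) end.
by apply: (@can_inj _ _ _ back) => -[s|s] /=; rewrite ordSK.
Qed.

Definition rot2 : {perm 'I_k + 'I_l} := perm rotate2_inj.

Definition rot2_cycles := [:: map inl (enum 'I_k); map inr (enum 'I_l)] : seq (seq ('I_k + 'I_l)).

Lemma rot2_uniq : uniq (flatten rot2_cycles).
Proof.
have il : injective (@inl 'I_k 'I_l) by move=> ? ? [].
have ir : injective (@inr 'I_k 'I_l) by move=> ? ? [].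
rewrite /= cats0 cat_uniq (map_inj_uniq il) (map_inj_uniq ir) !enum_uniq andbT /=.
by apply/hasPn => _ /mapP[s _ ->]; apply/mapP => -[].
Qed.

Lemma rot2_full : [set x in flatten rot2_cycles]%SET = [set: 'I_k + 'I_l]%SET.
Proof.
apply/setP => t; rewrite !inE /= cats0 mem_cat; case: t => s.
  by rewrite map_f ?mem_enum.
by rewrite [X in _ || X]map_f ?mem_enum // orbT.
Qed.

Lemma fcycle_ordS m : fcycle (@ordS m) (enum 'I_m).
Proof.
case: m => [|m]; first by rewrite (size0nil (size_enum_ord 0)).
apply: cycle_from_next; first exact: enum_uniq.
move=> x _; rewrite next_nth mem_enum /=; apply/eqP/val_inj => /=.
case E: (enum _) => [|y q]; first by have := mem_enum 'I_m.+1 x; rewrite E.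
rewrite -[nth y q _]/(nth y (y :: q) (index x (y :: q)).+1) -E index_enum_ord.
have y0 : y = 0%N :> nat by have := @nth_enum_ord m.+1 x 0 isT; rewrite E.
have [xm|mx] := ltnP x.+1 m.+1; first by rewrite nth_enum_ord // modn_small.
have -> : x.+1 = m.+1 by apply/eqP; rewrite eqn_leq ltn_ord.
by rewrite nth_default ?size_enum_ord // modnn y0.
Qed.

Lemma rot2_fcycle : all (fcycle rot2) rot2_cycles.
Proof.
rewrite /= andbT; apply/andP; split; rewrite cycle_map.
  rewrite (@eq_cycle _ _ (frel (@ordS k))) ?fcycle_ordS // => s t /=.
  by rewrite permE.
rewrite (@eq_cycle _ _ (frel (@ordS l))) ?fcycle_ordS // => s t /=.
by rewrite permE.
Qed.

Definition side (t : 'I_k + 'I_l) : bool := if t is inl _ then true else false.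

Lemma rot2_porbit x y : (y \in porbit rot2 x) = (side y == side x).
Proof.
have /and3P[cl cr _] := rot2_fcycle.
have mem (q : seq ('I_k + 'I_l)) : fcycle rot2 q -> x \in q -> porbit rot2 x =i q.
  move=> cq /rot_to[i r e] z.
  have c : fcycle rot2 (x :: r) by rewrite -e rot_cycle.
  by rewrite (fcycle_porbit c) -e mem_rot.
case: x mem => s mem.
  rewrite (mem _ cl) ?map_f ?mem_enum //; case: y => t; first by rewrite map_f ?mem_enum.
  by apply/mapP => -[].
rewrite (mem _ cr) ?map_f ?mem_enum //; case: y => t; last by rewrite map_f ?mem_enum.
by apply/mapP => -[].
Qed.

Lemma card_rot2_porbits : #|porbits rot2| = ((0 < k) + (0 < l))%N.
Proof.
pose P (b : bool) : {set 'I_k + 'I_l} := finset (fun y => side y == b).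
have PE x : porbit rot2 x = P (side x) by apply/setP => y; rewrite rot2_porbit inE.
have -> : porbits rot2 = P @: (side @: finset.setTfor ('I_k + 'I_l)).
  by rewrite -imset_comp; apply/setP => X; apply/imsetP/imsetP => -[x _ ->]; exists x; rewrite ?inE ?PE.
rewrite card_in_imset => [|b c]; last first.
  move=> /imsetP[x _ ->] /imsetP[y _ ->] /setP/(_ x).
  by rewrite !inE eqxx => /esym/eqP.
set T := _ @: _; have cT : #|T| = ((true \in T) + (false \in T))%N.
  rewrite (cardsD1 true) (cardsD1 false) !inE /= (_ : _ :\ _ = finset.set0) ?cards0 ?addn0 //.
  by apply/setP => -[]; rewrite !inE.
rewrite cT; congr (_ + _)%N; congr nat_of_bool; apply/imsetP/idP.
- by move=> [[s|s] _ //] _; exact: leq_ltn_trans (ltn_ord s).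
- by move=> k0; exists (inl (Ordinal k0)).
- by move=> [[s|s] _ //] _; exact: leq_ltn_trans (ltn_ord s).
- by move=> l0; exists (inr (Ordinal l0)).
Qed.

End two_cycles.

Section traces.
Context {R : realType} (d p : nat).
Local Notation C := (Cplx R).
Implicit Types x : 'cV[C]_(d * d * p).

Definition pt_state x : 'M[C]_(d * d) := (d ^ 2)%:R *: ptranspose (reduced_state x).

Lemma pt_stateE x i j i' j' :
  pt_state x (mxtens_index (i, j)) (mxtens_index (i', j')) =
  (d ^ 2)%:R * \sum_(a < p) x (cell i j' a) 0 * (x (cell i' j a) 0)^*.
Proof.
rewrite 3!mxE !mxtens_indexK /=; congr (_ * _); apply: eq_bigr => a _.
by rewrite mxE big_ord1 !mxE.
Qed.

Lemma big_pairs (V : nmodType) (S : finType) (F : {ffun S -> 'I_(d * d)} -> V) :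
  \sum_(u : {ffun S -> 'I_(d * d)}) F u =
  \sum_(i : {ffun S -> 'I_d}) \sum_(j : {ffun S -> 'I_d})
    F [ffun t => mxtens_index (i t, j t)].
Proof.
rewrite pair_bigA /= (reindex (fun ij : {ffun S -> 'I_d} * {ffun S -> 'I_d} =>
  [ffun t => mxtens_index (ij.1 t, ij.2 t)] : {ffun S -> 'I_(d * d)})) //.
exists (fun u : {ffun S -> 'I_(d * d)} =>
  ([ffun t => (mxtens_unindex (u t)).1], [ffun t => (mxtens_unindex (u t)).2])).
  by move=> [i j] _; congr pair; apply/ffunP => t; rewrite !ffunE mxtens_indexK.
move=> u _; apply/ffunP => t; rewrite !ffunE -[RHS]mxtens_unindexK.
by case: (mxtens_unindex (u t)).
Qed.

Lemma cyc_sum_net k l x : cyc_sum (pt_state x) k * cyc_sum (pt_state x) l =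
  (d ^ 2)%:R ^+ (k + l) * \sum_(i : {ffun 'I_k + 'I_l -> 'I_d})
    \sum_(j : {ffun 'I_k + 'I_l -> 'I_d}) \sum_(a : {ffun 'I_k + 'I_l -> 'I_p})
    net_mono (finset.setTfor ('I_k + 'I_l)) (rot2 k l) ((rot2 k l)^-1)%g i j a x.
Proof.
rewrite cyc_sumM big_pairs mulr_sumr; apply: eq_bigr => i _.
pose g := rot2 k l.
have reK : cancel (fun j : {ffun 'I_k + 'I_l -> 'I_d} => [ffun t => j (g t)] : {ffun 'I_k + 'I_l -> 'I_d})
    (fun j => [ffun t => j ((g^-1)%g t)]).
  by move=> j; apply/ffunP => t; rewrite !ffunE permKV.
have reK' : cancel (fun j : {ffun 'I_k + 'I_l -> 'I_d} => [ffun t => j ((g^-1)%g t)] : {ffun 'I_k + 'I_l -> 'I_d})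
    (fun j => [ffun t => j (g t)]).
  by move=> j; apply/ffunP => t; rewrite !ffunE permK.
(* Partial transposition puts the second index of the next point on the holomorphic factor and the
   current one on the conjugated factor. Shifting [j] along the cycle realigns the holomorphic
   factors with their points and leaves the inverse rotation on the conjugated ones: hence h =
   g^-1. *)
rewrite (reindex_inj (can_inj reK')) /= mulr_sumr; apply: eq_bigr => j _.
transitivity (\prod_(t : 'I_k + 'I_l) ((d ^ 2)%:R * \sum_(a < p)
    x (cell (i t) (j t) a) 0 * (x (cell (i (g t)) (j ((g^-1)%g t)) a) 0)^*)).
  apply: eq_bigr => t _; rewrite !ffunE -/(rotate2 t) -[rotate2 t](permE (@rotate2_inj k l)).
  by rewrite pt_stateE permK.
rewrite big_split /= prodr_const card_sum !card_ord bigA_distr_bigA /=.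
congr (_ * _); apply: eq_bigr => a _; rewrite big_split /= /net_mono /mono.
by congr (_ * _); apply: eq_bigl => t; rewrite inE.
Qed.

Definition ntr k x : C := (d ^ 2)%:R^-1 * \tr (pt_state x ^+ k).

Hypotheses (d0 : (0 < d)%N) (p0 : (0 < p)%N).

Lemma ntrE k x : ntr k x = (d ^ 2)%:R ^- (0 < k)%N * cyc_sum (pt_state x) k.
Proof.
have nd : (d ^ 2)%:R != 0 :> C by rewrite pnatr_eq0 -lt0n expn_gt0 d0.
case: k => [|k]; last by rewrite /ntr trace_pow.
by rewrite /ntr cyc_sum0 expr0 mxtrace1 mulnn mulVf // expr0 invr1 mul1r.
Qed.

Variable nu : probability (borelM R (d * d * p) 1) R.
Hypothesis nuS : uniform_on_sphere nu.

Lemma net_mono_bounded (S : finType) A (g h : {perm S}) i j a :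
  sphere_bounded (@net_mono R d p S A g h i j a).
Proof. exact: mono_bounded. Qed.

Lemma pt_state_bounded r c : sphere_bounded (fun x => pt_state x r c).
Proof.
rewrite -[r]mxtens_unindexK -[c]mxtens_unindexK.
case: (mxtens_unindex r) => i j; case: (mxtens_unindex c) => i' j'.
under eq_fun do rewrite pt_stateE.
apply: sphere_boundedM; first exact: sphere_bounded_cst.
apply: sphere_bounded_sum => a _; apply: sphere_boundedM.
  exact: sphere_bounded_coord.
by apply: sphere_bounded_conj; exact: sphere_bounded_coord.
Qed.

Lemma ntr_bounded k : sphere_bounded (ntr k).
Proof.
apply: sphere_boundedM; first exact: sphere_bounded_cst.
apply: sphere_bounded_sum => r _; move: {2}r => c.
elim: k r c => [|k IH] r c; first by under eq_fun do rewrite expr0; exact: sphere_bounded_cst.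
under eq_fun do rewrite exprS mxE; apply: sphere_bounded_sum => j _.
by apply: sphere_boundedM; [exact: pt_state_bounded|exact: IH].
Qed.

Lemma expect_ntr k l : rpart (expect nu (fun x => ntr k x * ntr l x)) =
  nnet nu (finset.setTfor ('I_k + 'I_l)) (rot2 k l) ((rot2 k l)^-1)%g.
Proof.
pose c : C := (d ^ 2)%:R ^- (0 < k)%N * (d ^ 2)%:R ^- (0 < l)%N * (d ^ 2)%:R ^+ (k + l).
pose m i j a := @net_mono R d p _ (finset.setTfor ('I_k + 'I_l)) (rot2 k l) ((rot2 k l)^-1)%g i j a.
pose T := {ffun 'I_k + 'I_l -> 'I_d}; pose T' := {ffun 'I_k + 'I_l -> 'I_p}.
have bm (i j : T) (a : T') : sphere_bounded (m i j a) by exact: net_mono_bounded.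
have bm1 (i j : T) : sphere_bounded (fun x => \sum_(a : T') m i j a x).
  exact: sphere_bounded_sum.
have bm2 (i : T) : sphere_bounded (fun x => \sum_(j : T) \sum_(a : T') m i j a x).
  exact: sphere_bounded_sum.
have bm3 : sphere_bounded (fun x => \sum_(i : T) \sum_(j : T) \sum_(a : T') m i j a x).
  exact: sphere_bounded_sum.
have -> : expect nu (fun x => ntr k x * ntr l x) =
    c * \sum_(i : T) \sum_(j : T) \sum_(a : T') expect nu (m i j a).
  transitivity (expect nu (fun x => c * (\sum_(i : T) \sum_(j : T) \sum_(a : T') m i j a x))).
    by apply: eq_expect => x _; rewrite !ntrE mulrACA cyc_sum_net mulrA.
  etransitivity; first exact: (expectZ nu _ bm3); congr (_ * _).
  rewrite (expect_sum nuS) //; apply: eq_bigr => i _.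
  rewrite (expect_sum nuS) //; apply: eq_bigr => j _.
  by rewrite (expect_sum nuS).
have rsum (I : finType) (F : I -> C) : rpart (\sum_i F i) = \sum_i rpart (F i).
  exact: (big_morph rpart rpartD).
pose cr : R := (d ^ 2)%:R ^- (0 < k)%N * (d ^ 2)%:R ^- (0 < l)%N * (d ^ 2)%:R ^+ (k + l).
have cE : c = cpair cr 0.
  by rewrite /c /cr !creal_nat -!crealX -!crealV -!crealM.
rewrite cE rpartM /= mul0r subr0 rsum; under eq_bigr do rewrite rsum.
under eq_bigr do under eq_bigr do rewrite rsum.
(* All points are present, so no power of [p] remains. A rotation and its inverse have equally many
   cycles, so each nonempty cycle accounts for d^2, the normalisation of one trace. *)
rewrite /nnet cardsT subnn expr0 mulr1 porbitsV card_rot2_porbits card_sum !card_ord.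
rewrite /net /m /cr; move: (\sum_(i : T) _) => y.
have nd : d%:R != 0 :> R by rewrite pnatr_eq0 -lt0n.
rewrite !natrX -!exprM !(mulnC 2) !exprM !exprD.
have n1 := expf_neq0 (0 < k)%N nd; have n2 := expf_neq0 (0 < l)%N nd.
move: n1 n2; move: (_ ^+ (0 < k)%N) (_ ^+ (0 < l)%N) (_ ^+ k) (_ ^+ l) => x1 x2 x3 x4 n1 n2.
by field; rewrite n1 n2.
Qed.

End traces.

(** * Moments of the semicircle law *)

Section moment_functional.
Variables (K : fieldType) (v : K).

Definition lin_form (f : {poly K} -> K) := forall (a : K) (p q : {poly K}), f (a *: p + q) = a * f p + f q.

Lemma lin_formD f : lin_form f -> forall p q, f (p + q) = f p + f q.
Proof. by move=> lf p q; have := lf 1 p q; rewrite scale1r mul1r. Qed.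

Lemma lin_form0 f : lin_form f -> f 0 = 0.
Proof.
move=> lf; have /eqP := lin_formD lf 0 0.
by rewrite addr0 -subr_eq0 opprD addrA subrr sub0r oppr_eq0 => /eqP.
Qed.

Lemma lin_formZ f : lin_form f -> forall a p, f (a *: p) = a * f p.
Proof. by move=> lf a p; have := lf a p 0; rewrite !addr0 (lin_form0 lf) addr0. Qed.

Lemma lin_formB f : lin_form f -> forall p q, f (p - q) = f p - f q.
Proof.
by move=> lf p q; rewrite -scaleN1r (lin_formD lf) (lin_formZ lf) mulN1r.
Qed.

Lemma lin_form_sum f (I : Type) (r : seq I) (P : pred I) (F : I -> {poly K}) :
  lin_form f -> f (\sum_(i <- r | P i) F i) = \sum_(i <- r | P i) f (F i).
Proof. by move=> lf; apply: big_morph; [exact: lin_formD|exact: lin_form0]. Qed.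

Lemma lin_form_ext f g : lin_form f -> lin_form g ->
  (forall k, f 'X^k = g 'X^k) -> f =1 g.
Proof.
move=> lf lg fg p; rewrite -[p]coefK poly_def !lin_form_sum //.
by apply: eq_bigr => i _; rewrite !lin_formZ // fg.
Qed.

Definition coef_form (a : nat -> K) (p : {poly K}) : K := \sum_(i < size p) p`_i * a i.

Lemma coef_form_widen a (p : {poly K}) n : (size p <= n)%N ->
  coef_form a p = \sum_(i < n) p`_i * a i.
Proof.
move=> pn; rewrite /coef_form (big_ord_widen n (fun i => p`_i * a i)) // big_mkcond.
by apply: eq_bigr => i _; case: ltnP => // pi; rewrite nth_default // mul0r.
Qed.

Lemma coef_form_lin a : lin_form (coef_form a).
Proof.
move=> c p q; set n := maxn (size p) (size q).
have sn : (size (c *: p + q)%R <= n)%N.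
  apply: leq_trans (size_polyD _ _) _; rewrite geq_max leq_maxr andbT.
  by apply: leq_trans (size_scale_leq _ _) (leq_maxl _ _).
rewrite (coef_form_widen a sn) (coef_form_widen a (leq_maxl _ _ : (size p <= n)%N)).
rewrite (coef_form_widen a (leq_maxr _ _ : (size q <= n)%N)) mulr_sumr -big_split /=.
by apply: eq_bigr => i _; rewrite coefD coefZ mulrDl mulrA.
Qed.

Lemma coef_formXn a k : coef_form a 'X^k = a k.
Proof.
rewrite /coef_form size_polyXn (bigD1 ord_max) //= coefXn eqxx mul1r big1 ?addr0 //.
by move=> i ik; rewrite coefXn (negbTE (ik : (i : nat) != k)) mul0r.
Qed.

(* The orthogonal polynomials of SC(1, v): rescaled Chebyshev polynomials of the
   second kind. *)
Fixpoint cheb n : {poly K} :=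
  match n with
  | 0 => 1
  | n'.+1 => ('X - 1) * cheb n' - (if n' is n''.+1 then v *: cheb n'' else 0)
  end.

Lemma chebS n : cheb n.+2 = ('X - 1) * cheb n.+1 - v *: cheb n.
Proof. by []. Qed.

Lemma cheb0 : cheb 0 = 1.
Proof. by []. Qed.

Lemma cheb1 : cheb 1 = 'X - 1.
Proof. by rewrite /= mulr1 subr0. Qed.

Variable phi : {poly K} -> K.
Hypothesis phi_lin : lin_form phi.
Hypothesis phi_cheb : forall n, phi (cheb n) = (n == 0)%:R.

(* [(phi (x) phi) ((1 (x) q) (p(x) - p(y)) / (x - y))] *)
Definition diff_quot (q p : {poly K}) : K :=
  coef_form (fun k => \sum_(m < k) phi 'X^m * phi ('X^(k - m.+1) * q)) p.

(** The identity (x p(x) - y p(y))/(x - y) = p(x) + y (p(x) - p(y))/(x - y). *)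
Lemma diff_quotX q p : diff_quot q ('X * p) = phi p * phi q + diff_quot ('X * q) p.
Proof.
pose g p := phi p * phi q + diff_quot ('X * q) p.
rewrite -/(g p); apply: (@lin_form_ext (fun p => diff_quot q ('X * p))) => [a r s|a r s|k].
- by rewrite mulrDr -scalerAr /diff_quot coef_form_lin.
- by rewrite /g /diff_quot coef_form_lin phi_lin; ring.
rewrite /g /diff_quot -exprS !coef_formXn big_ord_recr /= subnn mul1r addrC.
congr (_ + _); apply: eq_bigr => m _; congr (_ * phi _).
by rewrite mulrA -exprSr subSn.
Qed.

Lemma diff_quot_lin q : lin_form (diff_quot q).
Proof. exact: coef_form_lin. Qed.

Lemma diff_quotD q r p : diff_quot (q + r) p = diff_quot q p + diff_quot r p.
Proof.
rewrite /diff_quot /coef_form -big_split; apply: eq_bigr => i _ /=.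
rewrite -mulrDr -big_split; congr (_ * _); apply: eq_bigr => m _ /=.
by rewrite mulrDr (lin_formD phi_lin) mulrDr.
Qed.

Lemma diff_quotN q p : diff_quot (- q) p = - diff_quot q p.
Proof.
by apply/eqP; rewrite -addr_eq0 -diff_quotD addNr /diff_quot /coef_form big1 //
  => i _; rewrite big1 ?mulr0 // => m _; rewrite mulr0 (lin_form0 phi_lin) mulr0.
Qed.

(** Induction along the three-term recurrence. The product term of [diff_quotX] disappears beyond
    the first step because [phi] kills every [cheb] of positive degree. *)
Lemma diff_quot_cheb n q : diff_quot q (cheb n.+1) = phi (cheb n * q).
Proof.
have dq1 r : diff_quot r 1 = 0.
  by rewrite /diff_quot -(expr0 'X) coef_formXn big_ord0.
have step r p : diff_quot r (('X - 1) * p) = phi p * phi r + diff_quot (('X - 1) * r) p.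
  rewrite !mulrBl !mul1r (lin_formB (diff_quot_lin r)) diff_quotX diff_quotD.
  by rewrite diff_quotN addrA.
have [m] := ubnP n; elim: m n q => // m IH [|n] q nm.
  by rewrite cheb1 -[_ - 1]mulr1 step dq1 addr0 [phi 1](phi_cheb 0) !mul1r.
rewrite chebS (lin_formB (diff_quot_lin q)) (lin_formZ (diff_quot_lin q)) step.
rewrite phi_cheb mul0r add0r IH //.
case: n nm => [|n] nm; first by rewrite dq1 mulr0 subr0 cheb1 mul1r.
rewrite IH 1?ltnW // -(lin_formZ phi_lin) -(lin_formB phi_lin) chebS; congr phi.
by move: (cheb n.+2) (cheb n.+1) => c2 c1; rewrite -!mul_polyC; ring.
Qed.

(** The relation [main] is the Schwinger-Dyson equation of the semicircle law. Applied to 'X^k,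
    whose difference quotient is the sum of the x^m y^(k-1-m), it is the recursion. *)
Lemma phi_moment k : phi 'X^(k.+1) =
  phi 'X^k + v * \sum_(m < k) phi 'X^m * phi 'X^(k - m.+1).
Proof.
have main p : phi (('X - 1) * p) = v * diff_quot 1 p.
  have lin1 : lin_form (fun p => phi (('X - 1) * p)).
    by move=> a r s; rewrite mulrDr -scalerAr phi_lin.
  have lin2 : lin_form (fun p => v * diff_quot 1 p).
    by move=> a r s; rewrite diff_quot_lin; ring.
  have onc n : phi (('X - 1) * cheb n) = v * diff_quot 1 (cheb n).
    case: n => [|n].
      by rewrite mulr1 -cheb1 phi_cheb /diff_quot [cheb 0]/= -(expr0 'X) coef_formXn big_ord0 mulr0.
    have -> : ('X - 1) * cheb n.+1 = cheb n.+2 + v *: cheb n by rewrite chebS subrK.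
    rewrite (lin_formD phi_lin) (lin_formZ phi_lin) !phi_cheb add0r.
    by rewrite diff_quot_cheb mulr1 phi_cheb.
  (* Multiplication by 'X stays within combinations of the [cheb], so the case j = 0 propagates to
     all [j]; then n = 0 gives every monomial, with no need for a basis argument. *)
  have onXc j n : phi (('X - 1) * ('X^j * cheb n)) = v * diff_quot 1 ('X^j * cheb n).
    elim: j n => [|j IH] n; first by rewrite expr0 mul1r.
    have -> : 'X^(j.+1) * cheb n =
        'X^j * cheb n.+1 + ('X^j * cheb n + (if n is n'.+1 then v *: ('X^j * cheb n') else 0)).
      case: n => [|n]; first by rewrite cheb1 exprSr /=; ring.
      by rewrite chebS exprSr -mul_polyC -[in RHS]mul_polyC; ring.
    rewrite (lin_formD lin1) (lin_formD lin1) (lin_formD lin2) (lin_formD lin2) !IH.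
    congr (_ + (_ + _)); case: n => [|n]; first by rewrite (lin_form0 lin1) (lin_form0 lin2).
    by rewrite (lin_formZ lin1) (lin_formZ lin2) IH.
  apply: (lin_form_ext lin1 lin2) => j; have := onXc j 0; by rewrite mulr1.
have := main 'X^k; rewrite mulrBl mul1r (lin_formB phi_lin) -exprS.
rewrite /diff_quot coef_formXn => /eqP; rewrite subr_eq addrC => /eqP ->.
by congr (_ + _ * _); apply: eq_bigr => m _; rewrite mulr1.
Qed.

End moment_functional.

#[global] Opaque cheb.

(** * Integrals against the semicircle density *)

Section semicircle_moments.
Context {R : realType}.
Variable v : R.
Hypothesis v0 : 0 < v.
Local Notation mu := (@lebesgue_measure R).
Local Notation s := (Num.sqrt v).
Local Notation lo := (1 - 2 * s).
Local Notation hi := (1 + 2 * s).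

Definition sc_poly : {poly R} := (4 * v)%:P - ('X - 1) ^+ 2.
Definition sc_root (x : R) := Num.sqrt sc_poly.[x].

Lemma sc_polyE x : sc_poly.[x] = 4 * v - (x - 1) ^+ 2.
Proof. by rewrite /sc_poly !hornerE. Qed.

Lemma lo_lt_hi : lo < hi.
Proof.
have s0 : 0 < s by rewrite sqrtr_gt0.
lra.
Qed.

Lemma sc_poly_gt0 x : x \in `]lo, hi[ -> 0 < sc_poly.[x].
Proof.
rewrite in_itv /= sc_polyE => /andP[l h]; have := sqr_sqrtr (ltW v0).
have s0 : 0 < s by rewrite sqrtr_gt0.
by move=> vE; rewrite -vE; nra.
Qed.

Lemma sc_poly_lo : sc_poly.[lo] = 0.
Proof. by rewrite sc_polyE; have := sqr_sqrtr (ltW v0) => vE; rewrite -[v in 4 * v]vE; ring. Qed.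

Lemma sc_poly_hi : sc_poly.[hi] = 0.
Proof. by rewrite sc_polyE; have := sqr_sqrtr (ltW v0) => vE; rewrite -[v in 4 * v]vE; ring. Qed.

Lemma sc_root_continuous : continuous sc_root.
Proof.
move=> x; apply: (@continuous_comp _ _ _ (horner sc_poly)).
  exact: continuous_horner.
exact: sqrt_continuous.
Qed.

Lemma integral_derive (a b : R) (f F : R -> R) : a < b -> continuous f ->
  {within `[a, b], continuous F} ->
  (forall x, x \in `]a, b[ -> is_derive x 1 F (f x)) ->
  \int[mu]_(x in `[a, b]) f x = F b - F a.
Proof.
move=> ab cf /(continuous_within_itvP _ ab)[_ Fa Fb] dF.
rewrite /Rintegral (@continuous_FTC2 _ f F a b ab) //.
- exact: continuous_subspaceT.
- by split => // x /dF df; exact: ex_derive.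
- by move=> x /dF df; rewrite derive1E; exact: derive_val.
Qed.

Lemma continuous_integrable (a b : R) (f : R -> R) : continuous f ->
  mu.-integrable `[a, b] (EFin \o f).
Proof.
move=> cf; apply: continuous_compact_integrable; first exact: segment_compact.
exact: continuous_subspaceT.
Qed.

Lemma horner_is_derive (p : {poly R}) (x : R) : is_derive x 1 (horner p) p^`().[x].
Proof.
by apply: DeriveDef; [exact: derivable_horner|rewrite derivE derive1E].
Qed.

Lemma sc_root_is_derive (x : R) : x \in `]lo, hi[ ->
  is_derive x 1 sc_root (- (x - 1) / sc_root x).
Proof.
move=> xI; have W0 := sc_poly_gt0 xI.
have dW := horner_is_derive sc_poly x; have dS := is_derive1_sqrt W0.
apply: (@is_derive_eq _ _ _ _ _ _ _ _ (is_derive1_comp dS dW)).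
have -> : sc_poly^`().[x] = - 2 * (x - 1).
  rewrite /sc_poly derivB derivC deriv_exp derivB derivX derivC !hornerE /=.
  by ring.
have := sqrtr_gt0 sc_poly.[x]; rewrite W0 /sc_root => w0.
by field; rewrite gt_eqF.
Qed.

(** With w = [sc_root] one has w' = -(x - 1)/w, so the hypothesis says that (w q)' = w p; and w
    vanishes at both ends. *)
Lemma integral_sc_exact (p q : {poly R}) :
  sc_poly * q^`() - ('X - 1) * q = sc_poly * p ->
  \int[mu]_(x in `[lo, hi]) (p.[x] * sc_root x) = 0.
Proof.
move=> pq.
transitivity (sc_root hi * q.[hi] - sc_root lo * q.[lo]); last first.
  by rewrite /sc_root sc_poly_lo sc_poly_hi sqrtr0 !mul0r subrr.
apply: (@integral_derive _ _ _ (fun x => sc_root x * q.[x]) lo_lt_hi).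
- move=> x; apply: cvgM; [exact: continuous_horner|exact: sc_root_continuous].
- apply: continuous_subspaceT => x.
  by apply: cvgM; [exact: sc_root_continuous|exact: continuous_horner].
move=> x xI; have dr := sc_root_is_derive xI; have dq := horner_is_derive q x.
apply: (@is_derive_eq _ _ _ _ _ _ _ _ (is_deriveM dr dq)); have W0 := sc_poly_gt0 xI.
have w0 : 0 < sc_root x by rewrite sqrtr_gt0.
have w2 : sc_root x ^+ 2 = sc_poly.[x] by rewrite sqr_sqrtr // ltW.
have := congr1 (horner^~ x) pq; rewrite /= hornerD hornerN !hornerM -w2.
rewrite hornerD hornerN hornerX hornerC => e.
rewrite -![_ *: _]/(_ * _).
apply: (mulfI (lt0r_neq0 w0)).
transitivity (sc_root x ^+ 2 * p.[x]); last by ring.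
by rewrite -e; field; rewrite gt_eqF.
Qed.

(** The rescaled form of the classical relation (1 - x^2) U_n' = - n x U_n + (n+1) U_(n-1). *)
Lemma cheb_deriv n : sc_poly * (cheb v n)^`() =
  - (n%:R *: (('X - 1) * cheb v n)) +
  (if n is n'.+1 then (2 * n.+1%:R * v) *: cheb v n' else 0).
Proof.
have [m] := ubnP n; elim: m n => // m IH [|[|n]] nm.
- by rewrite cheb0 derivC mulr0 scale0r oppr0 addr0.
- rewrite cheb1 cheb0 derivB derivX derivC subr0 mulr1 scale1r /sc_poly /=.
  by rewrite -[_ *: 1]mul_polyC mulr1 (_ : 2 * 2 * v = 4 * v); ring.
have e1 := IH n.+1 nm; have := IH n (ltnW nm).
rewrite chebS derivB derivM derivB derivX derivC subr0 mul1r derivZ.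
rewrite mulrBr mulrDr mulrCA e1 -scalerAr.
case: n nm e1 => [|n] nm e1 => [_|->].
  rewrite cheb1 cheb0 derivC mulr0 scaler0 subr0 /sc_poly.
  by rewrite -!mul_polyC !polyCM !polyC_natr /=; ring.
have -> : cheb v n.+2 = ('X - 1) * cheb v n.+1 - v *: cheb v n by rewrite chebS.
move: (cheb v n.+1) (cheb v n) => c1 c0.
by rewrite /sc_poly -!mul_polyC !polyCM !polyC_natr; ring.
Qed.

Lemma integral_cheb n : \int[mu]_(x in `[lo, hi]) ((cheb v n.+1).[x] * sc_root x) = 0.
Proof.
(* Under x = 1 + 2 sqrt(v) cos(theta), w times [cheb v k] is proportional to sin((k+1) theta), so
   this is the primitive of sin((n+2) theta) sin(theta) written in the variable x. *)
apply: (@integral_sc_exact _ ((n.+3%:R)^-1 *: cheb v n.+2 - (v / n.+1%:R) *: cheb v n)).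
have e2 := cheb_deriv n.+2; have e0 := cheb_deriv n.
rewrite derivB !derivZ mulrBr -!scalerAr e2 e0.
have n1 : n.+1%:R != 0 :> R by rewrite pnatr_eq0.
have n3 : n.+3%:R != 0 :> R by rewrite pnatr_eq0.
have collect (c k e : R) (Y Z : {poly R}) : c * k + c = e ->
    c *: (- (k *: Y) + Z) - c *: Y = c *: Z - e *: Y.
  by move=> <-; rewrite -!mul_polyC polyCD polyCM; ring.
have eP2 : cheb v n.+2 = ('X - 1) * cheb v n.+1 - v *: cheb v n by rewrite chebS.
have -> : (if n is n'.+1 then (2 * n.+1%:R * v) *: cheb v n' else 0) =
    (2 * n.+1%:R) *: (('X - 1) * cheb v n - cheb v n.+1).
  case: (n) => [|m].
    rewrite cheb1 cheb0 (_ : ('X - 1) * 1 - ('X - 1) = 0) ?scaler0 //; by ring.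
  by rewrite chebS opprB addrC subrK scalerA.
move: (cheb v n.+2) (cheb v n.+1) (cheb v n) eP2 {e2 e0} => P2 P1 P0 eP2.
set Y2 := ('X - 1) * P2; set Y0 := ('X - 1) * P0; set Z2 := _ *: P1; set Z0 := _ *: (Y0 - P1).
transitivity ((n.+3%:R^-1 *: (- (n.+2%:R *: Y2) + Z2) - n.+3%:R^-1 *: Y2) -
  ((v / n.+1%:R) *: (- (n%:R *: Y0) + Z0) - (v / n.+1%:R) *: Y0)).
  by rewrite /Y2 /Y0 -!mul_polyC; ring.
rewrite (collect _ _ 1); last by field.
rewrite (collect _ _ v); last by field.
rewrite /Z2 /Z0 !scalerA (_ : n.+3%:R^-1 * _ = 2 * v); last by field.
rewrite (_ : v / n.+1%:R * _ = 2 * v); last by field.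
rewrite /Y2 /Y0 eP2 /sc_poly -!mul_polyC !polyCM !polyC_natr; ring.
Qed.

(** At -1 and 1 [asin] is not differentiable, and [integral_derive] needs continuity there; it holds
    because [asin] inverts a continuous function on a segment. *)
Lemma asin_within : {within `[-1, 1], continuous (@asin R)}.
Proof.
have pi0 := pi_gt0 R.
have := @segment_can_le_continuous R (- (pi / 2)) (pi / 2) sin asin.
rewrite sinN sin_pihalf; apply; first by lra.
  by apply: continuous_subspaceT => x; exact: continuous_sin.
exact: sinK.
Qed.

Lemma scaled_asin_within :
  {within `[lo, hi], continuous (fun x : R => asin ((x - 1) / (2 * s)))}.
Proof.
have s0 : 0 < s by rewrite sqrtr_gt0.
apply/subspace_continuousP => x xK P nP.
have aff : continuous (fun y : R => (y - 1) / (2 * s)).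
  move=> y; apply: cvgMr_tmp; apply: cvgB; [exact: cvg_id|exact: cvg_cst].
have affK y : `[lo, hi]%classic y -> `[-1, 1]%classic ((y - 1) / (2 * s)).
  rewrite /= !in_itv /= => /andP[l h].
  rewrite ler_pdivlMr ?ler_pdivrMr ?mulr_gt0 //; apply/andP; split; lra.
have /subspace_continuousP/(_ _ (affK x xK)) := asin_within.
move=> /(_ P nP) h; have nh := aff x _ h.
change (nbhs x (fun y : R => `[lo, hi]%classic y -> P (asin ((y - 1) / (2 * s))))).
apply: (@filterS _ (nbhs x) (nbhs_filter x) _ _ _ nh) => y hy /affK; exact: hy.
Qed.

Lemma integral_sc_root : \int[mu]_(x in `[lo, hi]) sc_root x = 2 * pi * v.
Proof.
have s0 : 0 < s by rewrite sqrtr_gt0.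
have vE := sqr_sqrtr (ltW v0).
(* The usual primitive for the area under a half circle of radius 2 sqrt(v); only the [asin] term
   survives at the ends. *)
pose F x := (x - 1) * sc_root x / 2 + 2 * v * asin ((x - 1) / (2 * s)).
transitivity (F hi - F lo); last first.
  rewrite /F /sc_root sc_poly_lo sc_poly_hi sqrtr0 !mulr0 !mul0r !add0r.
  have -> : (hi - 1) / (2 * s) = 1 by field; rewrite gt_eqF.
  have -> : (lo - 1) / (2 * s) = -1 by field; rewrite gt_eqF.
  have pi0 := pi_gt0 R.
  have a1 : asin 1 = pi / 2 :> R.
    have := @sinK R (pi / 2); rewrite sin_pihalf; apply.
    by rewrite in_itv /=; apply/andP; split; lra.
  have am1 : asin (-1) = - (pi / 2) :> R.
    have := @sinK R (- (pi / 2)); rewrite sinN sin_pihalf; apply.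
    by rewrite in_itv /=; apply/andP; split; lra.
  by rewrite a1 am1; field.
apply: integral_derive lo_lt_hi sc_root_continuous _ _.
  apply/subspace_continuousP => x xK; apply: cvgD; last first.
    apply: cvgMl_tmp; move/subspace_continuousP : scaled_asin_within; exact.
  apply: cvg_within_filter; apply: cvgMr_tmp; apply: cvgM.
    by apply: cvgB; [exact: cvg_id|exact: cvg_cst].
  exact: sc_root_continuous.
move=> x xI; have W0 := sc_poly_gt0 xI.
have w0 : 0 < sc_root x by rewrite sqrtr_gt0.
have w2 : sc_root x ^+ 2 = sc_poly.[x] by rewrite sqr_sqrtr // ltW.
have dr := sc_root_is_derive xI.
have wE : sc_root x ^+ 2 = 4 * v - (x - 1) ^+ 2 by rewrite w2 sc_polyE.
have da : is_derive x 1 (fun y : R => asin ((y - 1) / (2 * s))) (sc_root x)^-1.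
  have dl : is_derive x 1 (fun y : R => (y - 1) / (2 * s)) ((2 * s)^-1).
    have d1 := horner_is_derive ((2 * s)^-1 *: ('X - 1)) x.
    rewrite (_ : (fun y => _) = horner ((2 * s)^-1 *: ('X - 1))); last first.
      by apply/funext => y; rewrite !hornerE mulrC.
    by apply: (@is_derive_eq _ _ _ _ _ _ _ _ d1); rewrite derivZ derivB derivX derivC subr0 hornerZ hornerC mulr1.
  have zI : -1 < (x - 1) / (2 * s) < 1.
    move: xI; rewrite in_itv /= => /andP[l h].
    by rewrite ltr_pdivlMr ?ltr_pdivrMr ?mulr_gt0 //; apply/andP; split; lra.
  have das := is_derive1_asin zI.
  have dc := @is_derive1_comp R asin (fun y : R => (y - 1) / (2 * s)) x _ _ das dl.
  suff e : (Num.sqrt (1 - ((x - 1) / (2 * s)) ^+ 2))^-1 * (2 * s)^-1 = (sc_root x)^-1.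
    by rewrite e in dc.
  have -> : 1 - ((x - 1) / (2 * s)) ^+ 2 = sc_root x ^+ 2 / (2 * s) ^+ 2.
    by rewrite wE -[v in 4 * v]vE; field; rewrite gt_eqF.
  rewrite -expr_div_n sqrtr_sqr ger0_norm ?divr_ge0 ?ltW ?mulr_gt0 //.
  by field; rewrite !gt_eqF.
have dx : is_derive x 1 (fun y : R => y - 1) 1.
  have d1 := horner_is_derive ('X - 1) x.
  rewrite (_ : (fun y => _) = horner ('X - 1)); last first.
    by apply/funext => y; rewrite !hornerE.
  by apply: (@is_derive_eq _ _ _ _ _ _ _ _ d1); rewrite derivB derivX derivC subr0 hornerC.
have dF : is_derive x 1 (((fun y : R => y - 1) * sc_root) * cst 2^-1 +
    cst (2 * v) * (fun y : R => asin ((y - 1) / (2 * s)))) (sc_root x).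
  apply: is_derive_eq; rewrite /= -![_ *: _]/(_ * _) !mulr0 ?addr0.
  have -> : 2 * v = (sc_root x ^+ 2 + (x - 1) ^+ 2) / 2 by rewrite wE; field.
  by field; rewrite gt_eqF.
exact: dF.
Qed.

Definition sc_moment (p : {poly R}) : R :=
  \int[mu]_(x in `[lo, hi]) (p.[x] * semicircle_pdf 1 v x).

Lemma semicircle_pdfE x : semicircle_pdf 1 v x = (2 * pi * v)^-1 * sc_root x.
Proof. by rewrite /semicircle_pdf /sc_root sc_polyE. Qed.

Lemma sc_pdf_continuous : continuous (semicircle_pdf 1 v).
Proof.
rewrite (_ : semicircle_pdf 1 v = fun x => (2 * pi * v)^-1 * sc_root x).
  by move=> x; apply: cvgMl_tmp; exact: sc_root_continuous.
by apply/funext => x; rewrite semicircle_pdfE.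
Qed.

Lemma sc_pdf_ge0 x : 0 <= semicircle_pdf 1 v x.
Proof.
by rewrite /semicircle_pdf mulr_ge0 ?sqrtr_ge0 // invr_ge0 !mulr_ge0 ?pi_ge0 // ltW.
Qed.

Lemma sc_moment_continuous (p : {poly R}) :
  continuous (fun x => p.[x] * semicircle_pdf 1 v x).
Proof.
by move=> x; apply: cvgM; [exact: continuous_horner|exact: sc_pdf_continuous].
Qed.

Lemma sc_moment_integrable (p : {poly R}) :
  mu.-integrable `[lo, hi] (EFin \o (fun x => p.[x] * semicircle_pdf 1 v x)).
Proof. by apply: continuous_integrable; exact: sc_moment_continuous. Qed.

Lemma sc_moment_lin : lin_form sc_moment.
Proof.
move=> a p q; rewrite /sc_moment.
rewrite -RintegralZl //; last exact: sc_moment_integrable.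
rewrite -RintegralD //.
- by apply: eq_Rintegral => x _; rewrite hornerD hornerZ; ring.
- rewrite (_ : (fun x => a * _) = (fun x => (a *: p).[x] * semicircle_pdf 1 v x)).
    exact: sc_moment_integrable.
  by apply/funext => x; rewrite hornerZ mulrA.
- exact: sc_moment_integrable.
Qed.

Lemma sc_moment_cheb n : sc_moment (cheb v n) = (n == 0)%:R.
Proof.
have nz : 2 * pi * v != 0 by rewrite !mulf_neq0 ?gt_eqF ?pi_gt0.
have -> : sc_moment (cheb v n) =
    (2 * pi * v)^-1 * \int[mu]_(x in `[lo, hi]) ((cheb v n).[x] * sc_root x).
  rewrite -RintegralZl //.
    by apply: eq_Rintegral => x _; rewrite semicircle_pdfE mulrCA.
  apply: continuous_integrable => x.
  by apply: cvgM; [exact: continuous_horner|exact: sc_root_continuous].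
case: n => [|n]; last by rewrite integral_cheb mulr0.
have -> : \int[mu]_(x in `[lo, hi]) ((cheb v 0).[x] * sc_root x) =
    \int[mu]_(x in `[lo, hi]) sc_root x.
  by apply: eq_Rintegral => x _; rewrite cheb0 hornerC mul1r.
by rewrite integral_sc_root mulVf.
Qed.

Lemma sc_moment0 : sc_moment 'X^0 = 1.
Proof. by rewrite expr0 -(cheb0 v) sc_moment_cheb. Qed.

Lemma sc_momentS k : sc_moment 'X^(k.+1) =
  sc_moment 'X^k + v * \sum_(m < k) sc_moment 'X^m * sc_moment 'X^(k - m.+1).
Proof. exact: phi_moment sc_moment_lin sc_moment_cheb k. Qed.

End semicircle_moments.

(** * Polynomial majorants and minorants of intervals *)

Section polynomial_approximation.
Context {R : realType}.

(* [y := y + (x^2 - y^2) / 2] increases to [|x|] on [[-1, 1]]. *)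
Fixpoint visser n : {poly R} :=
  if n is n'.+1 then visser n' + 2^-1 *: ('X^2 - visser n' ^+ 2) else 0.

Lemma visser_bound n (x : R) : `|x| <= 1 ->
  0 <= `|x| - (visser n).[x] <= Num.min `|x| (2 / n.+2%:R).
Proof.
move=> x1; have x0 := normr_ge0 x; have xx : x ^+ 2 = `|x| ^+ 2 by rewrite real_normK ?num_real.
elim: n => [|n]; first by rewrite hornerC subr0 x0 /= le_min lexx /= divff.
set y := (visser n).[x] => /andP[e0]; rewrite le_min => /andP[e1 e2].
rewrite /= !hornerE -/y xx le_min; set t := `|x| in x1 x0 e0 e1 e2 *.
have -> : t - (y + 2^-1 * (t ^+ 2 - y ^+ 2)) = (t - y) * (1 - (t + y) / 2) by field.
set z := t - y in e0 e1 e2 *.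
have -> : (t + y) / 2 = t - z / 2 by rewrite /z; field.
have n2 : 0 < n.+2%:R :> R by rewrite ltr0n.
have n3 : 0 < n.+3%:R :> R by rewrite ltr0n.
apply/and3P; split; [nra|nra|].
(* Here z <= t is used, which is why the bound of the error by |x| is carried through the
   induction. *)
apply: (@le_trans _ _ (z * (1 - z / 2))); first nra.
set u := 2 / n.+2%:R in e2 *.
have u1 : u <= 1 by rewrite ler_pdivrMr // mul1r ler_nat.
(* The map u -> u (1 - u/2) is increasing on [0, 1]. *)
apply: (@le_trans _ _ (u * (1 - u / 2))); first nra.
rewrite /u ler_pdivlMr // -(natr1 n.+2).
have -> : 2 / n.+2%:R * (1 - 2 / n.+2%:R / 2) * (n.+2%:R + 1) =
   2 - 2 / n.+2%:R ^+ 2 :> R by field; rewrite gt_eqF.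
by rewrite lerBlDr lerDl divr_ge0 // exprn_ge0 // ltW.
Qed.

Lemma abs_approx (B e : R) : 0 < B -> 0 < e ->
  exists p : {poly R}, forall x, `|x| <= B -> `|p.[x] - `|x| | <= e.
Proof.
move=> B0 e0; have [n ne] : exists n : nat, B * (2 / n.+2%:R) <= e.
  exists (Num.truncn (2 * B / e)); rewrite mulrA ler_pdivrMr ?ltr0n // mulrC -ler_pdivrMl //.
  rewrite mulrC (mulrC B); apply: ltW; apply: lt_le_trans (truncnS_gt _) _.
  by rewrite (mulrC e^-1) ler_nat.
exists (B *: (visser n \Po (B^-1 *: 'X))) => x xB.
have zx : `|B^-1 * x| <= 1.
  by rewrite normrM normfV (gtr0_norm B0) mulrC ler_pdivrMr // mul1r.
have := visser_bound n zx; rewrite le_min hornerZ horner_comp hornerZ hornerX.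
set z := B^-1 * x in zx *; have xE : `|x| = B * `|z|.
  by rewrite /z normrM normfV (gtr0_norm B0) mulVKf // gt_eqF.
move=> /and3P[z0 _ z2]; rewrite xE -mulrBr normrM (gtr0_norm B0) distrC ger0_norm //.
by apply: le_trans ne; rewrite ler_pM2l.
Qed.

(** A trapezoidal function of height 2 del, written with absolute values only, so that approximating
    |x| by polynomials suffices. *)
Lemma trapezoid (a b del x : R) : a <= b -> 0 < del ->
  (a <= x <= b)%R%:R * (2 * del) <=
    `|x - (a - del)| - `|x - a| - `|x - b| + `|x - (b + del)| <=
  (a - del <= x <= b + del)%R%:R * (2 * del).
Proof.
move=> ab d0.
have P (y : R) : 0 <= y -> `|y| = y by exact: ger0_norm.
have N (y : R) : y <= 0 -> `|y| = - y by exact: ler0_norm.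
have [h1|h1] := ltP x (a - del).
  rewrite (N (x - (a - del))) ?(N (x - a)) ?(N (x - b)) ?(N (x - (b + del))); try lra.
  by rewrite (_ : (a <= x) = false) /=; [rewrite mul0r; apply/andP; split; lra|apply/negbTE; rewrite -ltNge; lra].
have [h2|h2] := ltP x a.
  rewrite (P (x - (a - del))) ?(N (x - a)) ?(N (x - b)) ?(N (x - (b + del))); try lra.
  by rewrite (_ : x <= b + del) /=; [rewrite mul0r mul1r; apply/andP; split; lra|lra].
have [h3|h3] := leP x b.
  rewrite (P (x - (a - del))) ?(P (x - a)) ?(N (x - b)) ?(N (x - (b + del))); try lra.
  by rewrite (_ : x <= b + del) /=; [rewrite mul1r; apply/andP; split; lra|lra].
have [h4|h4] := leP x (b + del).
  rewrite (P (x - (a - del))) ?(P (x - a)) ?(P (x - b)) ?(N (x - (b + del))); try lra.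
  by rewrite /= mul0r mul1r; apply/andP; split; lra.
rewrite (P (x - (a - del))) ?(P (x - a)) ?(P (x - b)) ?(P (x - (b + del))); try lra.
by rewrite /= mul0r; apply/andP; split; lra.
Qed.

Lemma itv_approx (a b B del eta : R) : a <= b -> 0 < B -> 0 < del -> 0 < eta ->
  exists p : {poly R}, forall x, `|x| <= B ->
    (a <= x <= b)%R%:R - eta <= p.[x] <= (a - del <= x <= b + del)%R%:R + eta.
Proof.
move=> ab B0 d0 h0.
pose B' := B + (`|a| + `|b| + del).
have B'0 : 0 < B' by rewrite /B' ltr_wpDr // !addr_ge0 // ltW.
(* Four such errors add up to 2 eta del, and the trapezoid is then divided by 2 del. *)
have e0 : 0 < eta * del / 2 by rewrite divr_gt0 ?mulr_gt0.
have [p pP] := abs_approx B'0 e0.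
pose sh c := p \Po ('X - c%:P).
have shP c x : `|c| <= `|a| + `|b| + del -> `|x| <= B ->
    `|(sh c).[x] - `|x - c| | <= eta * del / 2.
  move=> cB xB; rewrite horner_comp !hornerE; apply: pP.
  by apply: le_trans (ler_normB _ _) _; exact: lerD.
exists ((2 * del)^-1 *: (sh (a - del) - sh a - sh b + sh (b + del))) => x xB.
have na := normr_ge0 a; have nb := normr_ge0 b.
have /ler_normlP[u1 l1] : `|(sh (a - del)).[x] - `|x - (a - del)| | <= eta * del / 2.
  by apply: shP => //; apply: le_trans (ler_normB _ _) _; rewrite (gtr0_norm d0); lra.
have /ler_normlP[u2 l2] : `|(sh a).[x] - `|x - a| | <= eta * del / 2.
  by apply: shP => //; lra.
have /ler_normlP[u3 l3] : `|(sh b).[x] - `|x - b| | <= eta * del / 2.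
  by apply: shP => //; lra.
have /ler_normlP[u4 l4] : `|(sh (b + del)).[x] - `|x - (b + del)| | <= eta * del / 2.
  by apply: shP => //; apply: le_trans (ler_normD _ _) _; rewrite (gtr0_norm d0); lra.
rewrite hornerZ !hornerE mulrC; clearbody sh.
move: (sh (a - del)).[x] (sh a).[x] (sh b).[x] (sh (b + del)).[x] u1 l1 u2 l2 u3 l3 u4 l4
  => s1 s2 s3 s4 u1 l1 u2 l2 u3 l3 u4 l4.
have /andP[G1 G2] := trapezoid x ab d0.
have dd : 0 < 2 * del by lra.
rewrite ler_pdivlMr // ler_pdivrMr //; apply/andP; split; lra.
Qed.

End polynomial_approximation.

Section semicircle_approximation.
Context {R : realType}.
Variable v : R.
Hypothesis v0 : 0 < v.
Local Notation mu := (@lebesgue_measure R).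
Local Notation s := (Num.sqrt v).
Local Notation lo := (1 - 2 * s).
Local Notation hi := (1 + 2 * s).
Local Notation K := (`[lo, hi]%classic : set R).
Local Notation pdf := (semicircle_pdf 1 v).
Local Notation ind a b x := ((a <= x <= b)%R%:R : R).

(** The exponent is even so that the bound is a nonnegative polynomial, and [c] does not depend on
    it, so that [tail_poly] may raise it freely. *)
Lemma poly_growth (p : {poly R}) (B : R) : 0 < B ->
  exists2 c : R, 0 <= c & forall l x, (size p <= l.*2)%N -> B <= `|x| ->
    `|p.[x]| <= c * (B^-1 * x) ^+ l.*2.
Proof.
move=> B0; exists (\sum_(i < size p) `|p`_i| * B ^+ i).
  by apply: sumr_ge0 => i _; rewrite mulr_ge0 // exprn_ge0 // ltW.
move=> l x sl Bx; rewrite horner_coef; apply: le_trans (ler_norm_sum _ _ _) _.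
rewrite mulr_suml; apply: ler_sum => i _; rewrite normrM -mulrA ler_wpM2l //.
have z1 : 1 <= `|B^-1 * x|.
  by rewrite normrM normfV (gtr0_norm B0) mulrC ler_pdivlMr // mul1r.
have -> : (B^-1 * x) ^+ l.*2 = `|B^-1 * x| ^+ l.*2.
  by rewrite -normrX ger0_norm // -mul2n exprM exprn_ge0 // sqr_ge0.
have xE : `|x| = B * `|B^-1 * x|.
  by rewrite normrM normfV (gtr0_norm B0) mulVKf // gt_eqF.
rewrite normrX xE exprMn; apply: ler_wpM2l; first by rewrite exprn_ge0 // ltW.
by apply: ler_weXn2l => //; apply: leq_trans sl; exact: ltnW.
Qed.

Lemma ind_measurable (a b : R) (D : set R) : measurable_fun D (fun x => ind a b x).
Proof.
rewrite (_ : (fun x => _) = \1_`[a, b]).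
  by apply: measurable_indic; exact: measurable_itv.
by apply/funext => x; rewrite indicE mem_setE in_itv.
Qed.

Lemma measurable_support : measurable K.
Proof. exact: measurable_itv. Qed.

Lemma ind_integrable (a b : R) : mu.-integrable K (EFin \o (fun x => ind a b x * pdf x)).
Proof.
apply: (@le_integrable _ _ _ mu _ _ _ (EFin \o pdf)) => //.
- apply/measurable_EFinP; apply: measurable_funM; first exact: ind_measurable.
  by apply: measurable_funTS; apply: continuous_measurable_fun; exact: sc_pdf_continuous.
- move=> x _; rewrite /= lee_fin normrM ler_piMl // ger0_norm ?ler0n //.
  by case: (_ <= _ <= _); rewrite ?ler01.
by apply: continuous_integrable; exact: sc_pdf_continuous.
Qed.

Lemma semicircleE (a b : R) :
  semicircle 1 v `[a, b] = \int[mu]_(x in K) (ind a b x * pdf x).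
Proof.
rewrite /semicircle Rintegral_mkcondl; apply: eq_Rintegral => x _.
rewrite patchE mem_setE in_itv /=; case: (_ <= _ <= _); by rewrite ?mul1r ?mul0r.
Qed.

Lemma pdf_le x : pdf x <= (2 * pi * v)^-1 * (2 * s).
Proof.
rewrite /semicircle_pdf ler_wpM2l //.
  by rewrite invr_ge0 !mulr_ge0 ?pi_ge0 // ltW.
have -> : 2 * s = Num.sqrt (4 * v).
  rewrite sqrtrM // (_ : 4 = 2 ^+ 2 :> R); last by rewrite -natrX.
  by rewrite sqrtr_sqr ger0_norm.
by rewrite ler_wsqrtr // lerBlDr lerDl sqr_ge0.
Qed.

(** The density is at most [M], and the widening adds two intervals of length [del]. *)
Lemma semicircle_widen (a b del : R) : 0 <= del ->
  semicircle 1 v `[a - del, b + del] <=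
  semicircle 1 v `[a, b] + 2 * ((2 * pi * v)^-1 * (2 * s)) * del.
Proof.
move=> d0; set M := (2 * pi * v)^-1 * (2 * s).
have M0 : 0 <= M by apply: le_trans (pdf_le 0); exact: sc_pdf_ge0.
have small (c : R) : \int[mu]_(x in K) ind c (c + del) x <= del.
  have -> : \int[mu]_(x in K) ind c (c + del) x =
      \int[mu]_(x in (`[c, (c + del)%R]%classic : set R) `&` K) (1 : R).
    rewrite Rintegral_mkcondl; apply: eq_Rintegral => x _.
    by rewrite patchE mem_setE in_itv /=; case: (_ <= _ <= _).
  rewrite Rintegral_cst ?mul1r; last exact: measurableI.
  have h : (mu (`[c, (c + del)%R]%classic `&` K) <= del%:E)%E.
    apply: (@le_trans _ _ (mu `[c, (c + del)%R]%classic)).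
      apply: le_measure; rewrite ?inE //; exact: measurableI.
    rewrite lebesgue_measure_itv /= lte_fin; case: ifP => _; rewrite ?lee_fin //.
    by lra.
  by rewrite -lee_fin fineK // ge0_fin_numE // (le_lt_trans h) // ltry.
have iind (c : R) : mu.-integrable K (EFin \o (fun x => ind c (c + del) x)).
  have muK : (mu K < +oo)%E.
    by rewrite lebesgue_measure_itv /=; case: ifP => _; rewrite ?ltry // -EFinB ltry.
  apply: (measurable_bounded_integrable _ muK); first exact: measurable_itv.
    exact: ind_measurable.
  exists 1; split => // m m1 x _; rewrite /= ger0_norm ?ler0n // (le_trans _ (ltW m1)) //.
    by case: (_ <= _ <= _); rewrite ?ler01.
have iM (c : R) : mu.-integrable K (EFin \o (fun x => M * ind c (c + del) x)).
  have h := @integrableZl _ _ R mu _ measurable_support M _ (iind c); exact h.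
have iMM := @integrableD _ _ R mu _ measurable_support _ _ (iM (a - del)) (iM b).
have iall := @integrableD _ _ R mu _ measurable_support _ _ (ind_integrable a b) iMM.
rewrite !semicircleE.
apply: (@le_trans _ _ (\int[mu]_(x in K) (ind a b x * pdf x +
    (M * ind (a - del) (a - del + del) x + M * ind b (b + del) x)))).
  apply: le_Rintegral => //; first exact: ind_integrable.
  move=> x _; rewrite subrK; have p0 := sc_pdf_ge0 v0 x; have pM := pdf_le x.
  rewrite -/M in pM.
  case: (boolP (a - del <= x <= b + del)) => [/andP[xa xb]|_]; last first.
    by rewrite mul0r; apply: addr_ge0; [|apply: addr_ge0]; apply: mulr_ge0 => //; case: (_ <= _ <= _).
  case: (boolP (a <= x <= b)) => [_|]; first by rewrite lerDl addr_ge0 // mulr_ge0 // ?ler0n.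
  rewrite mul1r mul0r add0r negb_and -!ltNge => /orP[xa'|xb'].
    rewrite xa (ltW xa') mulr1; apply: le_trans pM _.
    by rewrite lerDl mulr_ge0 // ?ler0n.
  rewrite xb (ltW xb') mulr1; apply: le_trans pM _.
  by rewrite lerDr mulr_ge0 // ?ler0n.
rewrite RintegralD //; last exact: ind_integrable.
rewrite lerD2l RintegralD // !RintegralZl //.
have := small (a - del); have := small b; set x := Rintegral _ _ _; set y := Rintegral _ _ _.
move=> h1 h2; rewrite -mulrA mulrCA (_ : 2 * del = del + del); last by ring.
by rewrite -mulrDr ler_wpM2l // lerD.
Qed.

Lemma sc_momentC (c : R) : sc_moment v c%:P = c.
Proof.
have := sc_moment0 v0; rewrite expr0 => m1.
by rewrite -[c%:P]mulr1 mul_polyC (lin_formZ (sc_moment_lin v)) m1 mulr1.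
Qed.

Lemma sc_moment_le (p : {poly R}) (f : R -> R) :
  mu.-integrable K (EFin \o (fun x => f x * pdf x)) ->
  (forall x, K x -> p.[x] <= f x) ->
  sc_moment v p <= \int[mu]_(x in K) (f x * pdf x).
Proof.
move=> fi pf; apply: le_Rintegral => //; first exact: sc_moment_integrable.
by move=> x Kx; rewrite ler_wpM2r ?sc_pdf_ge0 // pf.
Qed.

Lemma sc_moment_ge (p : {poly R}) (f : R -> R) :
  mu.-integrable K (EFin \o (fun x => f x * pdf x)) ->
  (forall x, K x -> f x <= p.[x]) ->
  \int[mu]_(x in K) (f x * pdf x) <= sc_moment v p.
Proof.
move=> fi pf; apply: le_Rintegral => //; first exact: sc_moment_integrable.
by move=> x Kx; rewrite ler_wpM2r ?sc_pdf_ge0 // pf.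
Qed.

Lemma sc_norm_le x : K x -> `|x| <= 1 + 2 * s.
Proof.
have s0 : 0 <= s by exact: sqrtr_ge0.
by rewrite /= in_itv /= => /andP[l h]; apply/ler_normlP; split; lra.
Qed.

(* The tail correction: it dominates [1 + |p|] off [[-B, B]] and its integral
   against the semicircle law is negligible. *)
Lemma tail_poly (p : {poly R}) (eta : R) : 0 < eta ->
  let B := 2 * (1 + 2 * s) in
  exists t : {poly R}, [/\ forall x, 0 <= t.[x],
    forall x, B <= `|x| -> `|p.[x]| + 1 <= t.[x] & sc_moment v t <= eta].
Proof.
move=> h0 B; have s0 : 0 <= s by exact: sqrtr_ge0.
have B0 : 0 < B by rewrite /B; lra.
have [c c0 cP] := poly_growth p B0.
have [m mP] : exists m : nat, (c + 1) / eta < m%:R.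
  by exists (Num.truncn ((c + 1) / eta)).+1; exact: truncnS_gt.
(* [B] is twice the bound of the support, so the tail polynomial is at most (c + 1)/4^l there; the
   choice of [m] makes this at most [eta], as l <= 4^l. *)
pose l := maxn (size p) m.
have sl : (size p <= l.*2)%N by rewrite -addnn; apply: (leq_trans (leq_maxl _ m)); exact: leq_addr.
have ml : (m <= l)%N by exact: leq_maxr.
exists ((c + 1) *: (B^-1 *: 'X) ^+ l.*2); split.
- move=> x; rewrite hornerZ horner_exp mulr_ge0 ?addr_ge0 //.
  by rewrite -mul2n exprM exprn_ge0 // sqr_ge0.
- move=> x Bx; rewrite hornerZ horner_exp hornerZ hornerX mulrDl mul1r.
  apply: lerD; first exact: cP.
  have z1 : 1 <= `|B^-1 * x|.
    by rewrite normrM normfV (gtr0_norm B0) mulrC ler_pdivlMr // mul1r.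
  have -> : (B^-1 * x) ^+ l.*2 = `|B^-1 * x| ^+ l.*2.
    by rewrite -normrX ger0_norm // -mul2n exprM exprn_ge0 // sqr_ge0.
  exact: exprn_ege1.
have q0 : 0 <= (4^-1 : R) ^+ l by rewrite exprn_ge0 // invr_ge0.
apply: (@le_trans _ _ ((c + 1) * 4^-1 ^+ l)).
  rewrite -[leRHS]sc_momentC.
  apply: (@sc_moment_le _ (horner ((c + 1) * 4^-1 ^+ l)%:P)) => [|x /sc_norm_le xK].
    exact: sc_moment_integrable.
  rewrite hornerC hornerZ horner_exp hornerZ hornerX ler_wpM2l ?addr_ge0 //.
  rewrite -mul2n exprM lerXn2r ?nnegrE ?sqr_ge0 ?invr_ge0 //.
  have z2 : `|B^-1 * x| <= 2^-1.
    rewrite normrM normfV (gtr0_norm B0) mulrC ler_pdivrMr // /B mulrA mulVf //.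
    by rewrite mul1r.
  rewrite -real_normK ?num_real //; have := normr_ge0 (B^-1 * x) => n0.
  by apply: (@le_trans _ _ (2^-1 ^+ 2)); [rewrite lerXn2r ?nnegrE ?invr_ge0|rewrite exprVn -natrX].
have el : (l%:R : R) <= 4 ^+ l by rewrite -natrX ler_nat ltnW // ltn_expl.
rewrite exprVn ler_pdivrMr ?exprn_gt0 // mulrC -ler_pdivrMr // .
by apply: le_trans (ltW mP) (le_trans _ el); rewrite ler_nat.
Qed.

Lemma semicircle_majorant (a b eps : R) : a <= b -> 0 < eps ->
  exists2 q : {poly R}, forall x, ind a b x <= q.[x] &
    sc_moment v q <= semicircle 1 v `[a, b] + eps.
Proof.
move=> ab e0; pose M := 2 * ((2 * pi * v)^-1 * (2 * s)).
have M0 : 0 <= M by rewrite !mulr_ge0 ?invr_ge0 ?mulr_ge0 ?sqrtr_ge0 ?pi_ge0 // ltW.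
(* Four quarters of [eps]: the widening of the interval, the approximation error, the upward shift
   by [eta], and the tail. *)
pose eta := eps / 4; pose del := eps / (4 * (M + 1)).
have h0 : 0 < eta by rewrite divr_gt0.
have d0 : 0 < del by rewrite divr_gt0 // mulr_gt0 // ltr_wpDl.
have Md : M * del <= eta.
  rewrite /del /eta invfM mulrCA ler_wpM2l ?(ltW e0) // mulrCA -[leRHS]mulr1 ler_wpM2l //.
  by rewrite ler_pdivrMr ?mul1r ?lerDl // ltr_wpDl.
have B0 : 0 < 2 * (1 + 2 * s) by have := sqrtr_ge0 v; lra.
have [p pP] := itv_approx ab B0 d0 h0.
have [t [t0 tp tm]] := tail_poly p h0.
exists (p + eta%:P + t).
  move=> x; rewrite !hornerD hornerC.
  have := t0 x; have [/pP/andP[h _] tx|/ltW Bx _] := leP `|x| (2 * (1 + 2 * s)); first lra.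
  have := tp x Bx; have i1 : ind a b x <= 1 by case: (_ <= _ <= _); rewrite ?ler01.
  have := ler_norm (- p.[x]); rewrite normrN; lra.
have lin := sc_moment_lin v.
rewrite !(lin_formD lin) sc_momentC.
have mp : sc_moment v p <= semicircle 1 v `[a - del, b + del] + eta.
  have -> : semicircle 1 v `[a - del, b + del] + eta =
      \int[mu]_(x in K) ((ind (a - del) (b + del) x + eta) * pdf x).
    rewrite semicircleE -[in LHS](sc_momentC eta) /sc_moment -RintegralD //.
    - by apply: eq_Rintegral => x _; rewrite hornerC mulrDl.
    - exact: ind_integrable.
    - exact: sc_moment_integrable.
  apply: sc_moment_le => [|x Kx].
    have := @integrableD _ _ R mu _ measurable_support _ _ (ind_integrable (a - del) (b + del)) (sc_moment_integrable v eta%:P).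
    by apply: eq_integrable => //= x _; rewrite hornerC mulrDl EFinD.
  have xB : `|x| <= 2 * (1 + 2 * s) by have := sc_norm_le Kx; have := normr_ge0 x; lra.
  by have /andP[] := pP x xB.
have := semicircle_widen a b (ltW d0); rewrite -/M; move: Md h0 mp tm; rewrite /eta; lra.
Qed.

Lemma semicircle_minorant (a b eps : R) : 0 < eps ->
  exists2 q : {poly R}, forall x, q.[x] <= ind a b x &
    semicircle 1 v `[a, b] - eps <= sc_moment v q.
Proof.
move=> e0; pose M := 2 * ((2 * pi * v)^-1 * (2 * s)).
have M0 : 0 <= M by rewrite !mulr_ge0 ?invr_ge0 ?mulr_ge0 ?sqrtr_ge0 ?pi_ge0 // ltW.
pose eta := eps / 4; pose del := eps / (4 * (M + 1)).
have h0 : 0 < eta by rewrite divr_gt0.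
have d0 : 0 < del by rewrite divr_gt0 // mulr_gt0 // ltr_wpDl.
have Md : M * del <= eta.
  rewrite /del /eta invfM mulrCA ler_wpM2l ?(ltW e0) // mulrCA -[leRHS]mulr1 ler_wpM2l //.
  by rewrite ler_pdivrMr ?mul1r ?lerDl // ltr_wpDl.
have i0 x : 0 <= ind a b x by case: (_ <= _ <= _); rewrite ?ler01.
have wid := semicircle_widen (a + del) (b - del) (ltW d0).
rewrite addrK subrK -/M in wid.
have lin := sc_moment_lin v.
(* The minorant approximates a shrunken interval. If that interval is empty, [a, b] has semicircle
   measure at most [M * del] and the zero polynomial will do. *)
have [ab|ab] := leP (a + del) (b - del); last first.
  exists 0 => [x|]; first by rewrite hornerC.
  rewrite (lin_form0 lin); suff : semicircle 1 v `[a + del, b - del] = 0.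
    by move: wid => /[swap] ->; move: Md h0; rewrite /eta; lra.
  rewrite semicircleE; transitivity (\int[mu]_(x in K) (0 : R)); last first.
    by rewrite Rintegral_cst ?mul0r //; exact: measurable_support.
  apply: eq_Rintegral => x _; case: (boolP (_ <= _ <= _)); rewrite ?mul0r //.
  by move=> /andP[x1 x2]; move: (le_trans x1 x2); rewrite leNgt ab.
have B0 : 0 < 2 * (1 + 2 * s) by have := sqrtr_ge0 v; lra.
have [p pP] := itv_approx ab B0 d0 h0; rewrite addrK subrK in pP.
have [t [t0 tp tm]] := tail_poly p h0.
exists (p - eta%:P - t).
  move=> x; rewrite !hornerD !hornerN hornerC; have := i0 x.
  have := t0 x; have [/pP/andP[_ h] tx|/ltW Bx _] := leP `|x| (2 * (1 + 2 * s)); first lra.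
  have := tp x Bx; have := ler_norm p.[x]; lra.
rewrite !(lin_formB lin) sc_momentC.
have mp : semicircle 1 v `[a + del, b - del] - eta <= sc_moment v p.
  have -> : semicircle 1 v `[a + del, b - del] - eta =
      \int[mu]_(x in K) ((ind (a + del) (b - del) x - eta) * pdf x).
    rewrite semicircleE -[in LHS](sc_momentC eta) /sc_moment -RintegralB //.
    - by apply: eq_Rintegral => x _; rewrite hornerC mulrBl.
    - exact: ind_integrable.
    - exact: sc_moment_integrable.
  apply: sc_moment_ge => [|x Kx].
    have := @integrableB _ _ R mu _ measurable_support _ _ (ind_integrable (a + del) (b - del)) (sc_moment_integrable v eta%:P).
    by apply: eq_integrable => //= x _; rewrite hornerC mulrBl EFinB.
  have xB : `|x| <= 2 * (1 + 2 * s) by have := sc_norm_le Kx; have := normr_ge0 x; lra.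
  by have /andP[] := pP x xB.
move: Md h0 mp tm wid; rewrite /eta; lra.
Qed.

End semicircle_approximation.

(** * Spectral measures *)

Section spectral_traces.
Context {R : realType} (n : nat).
Local Notation C := (Cplx R).
Implicit Types A : 'M[C]_n.

(** [spectral_measure] reads the real parts of the eigenvalues; for a normal matrix these are the
    eigenvalues of the Hermitian part. *)
Definition herm_part A : 'M[C]_n := 2^-1 *: (A + A^t*).
Definition real_eig A (i : 'I_n) : R := rpart (spectral_diag A 0 i).

Lemma conj_pow (P D : 'M[C]_n) k : P \in unitmx ->
  (invmx P *m D *m P) ^+ k = invmx P *m D ^+ k *m P.
Proof.
move=> Pu; elim: k => [|k IH]; first by rewrite !expr0 mulmx1 mulVmx.
rewrite !exprS IH -!mulmxE !mulmxA; congr (_ *m _ *m _).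
by rewrite -(mulmxA _ P) mulmxV // mulmx1.
Qed.

Lemma diag_pow (r : 'rV[C]_n) k : diag_mx r ^+ k = diag_mx (\row_i r 0 i ^+ k).
Proof.
elim: k => [|k IH].
  by apply/matrixP => i j; rewrite expr0 !mxE expr0.
rewrite exprS IH -mulmxE mulmx_diag; congr diag_mx; apply/rowP => i.
by rewrite !mxE exprS.
Qed.

Lemma normal_trace A k : A \is normalmx ->
  \tr (herm_part A ^+ k) = \sum_i cpair (real_eig A i) 0 ^+ k.
Proof.
move=> /orthomx_spectralP AE; set P := spectralmx A in AE; set r := spectral_diag A in AE.
have Pu : P \in unitmx by exact: spectral_unit.
have PV : invmx P = P^t* by rewrite invmx_unitary // spectral_unitarymx.
have AJ : A^t* = invmx P *m diag_mx (\row_i (r 0 i)^*) *m P.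
  rewrite [in LHS]AE !trmx_mul !map_mxM PV trmxCK mulmxA; congr (_ *m _ *m _).
  rewrite tr_diag_mx; apply/matrixP => i j; rewrite !mxE.
  by case: eqP => [->|_]; rewrite ?mulr1n ?mulr0n ?rmorph0.
have HE : herm_part A = invmx P *m diag_mx (\row_i cpair (real_eig A i) 0) *m P.
  rewrite /herm_part AJ {1}AE -mulmxDl -mulmxDr scalemxAl scalemxAr.
  congr (_ *m _ *m _); apply/matrixP => i j; rewrite !mxE -/r.
  case: eqP => [->|_]; rewrite ?mulr1n ?mulr0n ?addr0 ?mulr0 //.
  apply: (mulfI (_ : 2 != 0 :> C)); first by rewrite pnatr_eq0.
  rewrite mulVKf ?pnatr_eq0 //; apply: cpairP.
    by rewrite rpartD rpartJ rpartM rpart_nat ipart_nat /= mul0r subr0 /real_eig -/r; ring.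
  by rewrite ipartD ipartJ ipartM rpart_nat ipart_nat /= mulr0 mul0r; ring.
rewrite HE conj_pow // mxtrace_mulC mulmxA mulmxV // mul1mx diag_pow mxtrace_diag.
by apply: eq_bigr => i _; rewrite !mxE.
Qed.

Definition poly_trace (q : {poly R}) A : R :=
  n%:R^-1 * \sum_(k < size q) q`_k * rpart (\tr (herm_part A ^+ k)).

Lemma poly_traceE q A : A \is normalmx ->
  poly_trace q A = n%:R^-1 * \sum_i q.[real_eig A i].
Proof.
move=> nA; congr (_ * _).
transitivity (\sum_(k < size q) \sum_i q`_k * real_eig A i ^+ k).
  apply: eq_bigr => k _; rewrite normal_trace // (big_morph rpart (@rpartD R) erefl) mulr_sumr.
  by apply: eq_bigr => i _; rewrite -crealX.
by rewrite exchange_big; apply: eq_bigr => i _; rewrite horner_coef.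
Qed.

Lemma spectral_measure_eig A (a b : R) :
  spectral_measure A `[a, b] = n%:R^-1 * \sum_i (a <= real_eig A i <= b)%R%:R.
Proof.
by congr (_ * _); apply: eq_bigr => i _; rewrite indicE mem_setE in_itv.
Qed.

(** Off the normal matrices [spectral_diag] takes the default value zero, so the spectral measure is
    constant there; [measurable_spectral] needs this value. *)
Lemma non_normal_eig A i : A \isn't normalmx -> real_eig A i = 0.
Proof.
move=> nA; rewrite /real_eig /spectral_diag; case: orthomx_spectral_subproof => [e|_].
  by case/negP: nA; apply/orthomx_spectral_subproof.
by rewrite mxE.
Qed.

Lemma cmeasurable_herm_pow k i j :
  cmeasurable (fun A : borelM R n n => (herm_part A ^+ k) i j).
Proof.
elim: k i j => [|k IH] i j; first by under eq_fun do rewrite expr0; exact: cmeasurable_cst.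
under eq_fun do rewrite exprS mxE; apply: cmeasurable_sum => l _.
apply: cmeasurableM => //; under eq_fun do rewrite mxE.
apply: cmeasurableM; first exact: cmeasurable_cst.
under eq_fun do rewrite mxE; apply: cmeasurableD; first exact: cmeasurable_coord.
by under eq_fun do rewrite !mxE; apply: cmeasurable_conj; exact: cmeasurable_coord.
Qed.

Lemma measurable_poly_trace q :
  measurable_fun setT (poly_trace q : borelM R n n -> R).
Proof.
apply: measurable_funM; first exact: measurable_cst.
apply: measurable_sum => k; apply: measurable_funM; first exact: measurable_cst.
have [mr _] : cmeasurable (fun A : borelM R n n => \tr (herm_part A ^+ k)).
  by apply: cmeasurable_sum => i _; exact: cmeasurable_herm_pow.
exact: mr.
Qed.

(** A polynomial in the entries and their conjugates that vanishes exactly on the normal matrices,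
    which makes their set measurable. *)
Definition normal_defect A : R :=
  rpart (\sum_i \sum_j `|(A *m A^t* - A^t* *m A) i j| ^+ 2).

Lemma normal_defectP A : (A \is normalmx) = (normal_defect A == 0).
Proof.
have E : normal_defect A = \sum_i \sum_j (rpart ((A *m A^t* - A^t* *m A) i j) ^+ 2 +
    ipart ((A *m A^t* - A^t* *m A) i j) ^+ 2).
  rewrite /normal_defect (big_morph rpart (@rpartD R) erefl); apply: eq_bigr => i _.
  rewrite (big_morph rpart (@rpartD R) erefl); apply: eq_bigr => j _.
  by rewrite sqr_normC_part.
apply/normalmxP/eqP => [e|]; rewrite E.
  rewrite e subrr; apply: big1 => i _; apply: big1 => j _.
  by rewrite mxE -[0]/(cpair 0 0) /= expr0n addr0.
move=> e; apply/eqP; rewrite -subr_eq0; apply/eqP/matrixP => i j; rewrite [RHS]mxE.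
have ge0 k l : 0 <= rpart ((A *m A^t* - A^t* *m A) k l) ^+ 2 +
    ipart ((A *m A^t* - A^t* *m A) k l) ^+ 2 by rewrite addr_ge0 // sqr_ge0.
have /eqP := e; rewrite psumr_eq0 => [|k _]; last by apply: sumr_ge0.
move=> /allP/(_ i (mem_index_enum _)) /=; rewrite psumr_eq0 // => /allP/(_ j (mem_index_enum _)) /=.
rewrite paddr_eq0 ?sqr_ge0 // !sqrf_eq0 => /andP[/eqP r0 /eqP i0].
by apply: cpairP; rewrite ?r0 ?i0.
Qed.

Lemma measurable_normal_defect :
  measurable_fun setT (normal_defect : borelM R n n -> R).
Proof.
have mJ i j : cmeasurable (fun A : borelM R n n => (A : 'M[C]_n)^t* i j).
  by under eq_fun do rewrite !mxE; apply: cmeasurable_conj; exact: cmeasurable_coord.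
have mc i j : cmeasurable (fun A : borelM R n n => (A : 'M[C]_n) i j) by exact: cmeasurable_coord.
have mD i j : cmeasurable (fun A : borelM R n n =>
    ((A : 'M[C]_n) *m (A : 'M[C]_n)^t* - (A : 'M[C]_n)^t* *m (A : 'M[C]_n)) i j).
  under eq_fun do rewrite mxE [X in _ + X]mxE -mulN1r !mxE.
  apply: cmeasurableD; first by apply: cmeasurable_sum => k _; exact: cmeasurableM.
  apply: cmeasurableM; first exact: cmeasurable_cst.
  by apply: cmeasurable_sum => k _; exact: cmeasurableM.
have [mr _] : cmeasurable (fun A : borelM R n n => \sum_i \sum_j
    `|((A : 'M[C]_n) *m (A : 'M[C]_n)^t* - (A : 'M[C]_n)^t* *m (A : 'M[C]_n)) i j| ^+ 2).
  apply: cmeasurable_sum => i _; apply: cmeasurable_sum => j _.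
  under eq_fun do rewrite normCK; apply: cmeasurableM => //.
  exact: cmeasurable_conj.
exact: mr.
Qed.

End spectral_traces.

(** [itv_approx] on [-(m+1), m+1], with 1/(m+1) both as margin and as error. Since [a, b] is closed,
    a point outside it also leaves the widened intervals eventually. *)
Lemma itv_poly_seq (R : realType) (a b : R) : a <= b ->
  exists p : nat -> {poly R}, forall x, (p m).[x] @[m --> \oo] --> ((a <= x <= b)%R%:R : R).
Proof.
move=> ab.
have h m : exists p : {poly R}, forall x, `|x| <= m.+1%:R ->
    (a <= x <= b)%R%:R - m.+1%:R^-1 <= p.[x] <=
    (a - m.+1%:R^-1 <= x <= b + m.+1%:R^-1)%R%:R + m.+1%:R^-1.
  by apply: itv_approx; rewrite ?invr_gt0.
have [p pP] := choice h; exists p => x.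
have i0 : (m.+1%:R^-1 : R) @[m --> \oo] --> (0 : R) by exact: cvg_harmonic.
have out : \forall m \near \oo,
    (a - m.+1%:R^-1 <= x <= b + m.+1%:R^-1)%R%:R <= (a <= x <= b)%R%:R :> R.
  case: (boolP (a <= x <= b)) => [_|].
    by near=> m; case: (_ <= _ <= _); rewrite ?ler01.
  rewrite negb_and -!ltNge => /orP[xa|xb].
    have hx : 0 < a - x by rewrite subr_gt0.
    apply: filterS (@cvgr_lt _ _ _ _ _ _ i0 _ hx) => m hm.
    rewrite (_ : (_ <= _ <= _) = false) //; apply/negbTE; rewrite negb_and -!ltNge.
    by apply/orP; left; rewrite ltrBrDr -ltrBrDl.
  have hx : 0 < x - b by rewrite subr_gt0.
  apply: filterS (@cvgr_lt _ _ _ _ _ _ i0 _ hx) => m hm.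
  rewrite (_ : (_ <= _ <= _) = false) //; apply/negbTE; rewrite negb_and -!ltNge.
  by apply/orP; right; rewrite -ltrBrDl.
have big : \forall m \near \oo, `|x| <= m.+1%:R.
  exists (Num.truncn `|x|) => // m /= xm.
  by apply: le_trans (ltW (truncnS_gt _)) _; rewrite ler_nat ltnS.
apply: (@squeeze_cvgr _ _ _ _ (fun m => (a <= x <= b)%R%:R - m.+1%:R^-1)
   (fun m => (a <= x <= b)%R%:R + m.+1%:R^-1)).
- apply: filterS2 out big => m om xm.
  by have /andP[-> h2] := pP m x xm; apply: le_trans h2 _; rewrite lerD2r.
- by rewrite -[X in _ --> X]subr0; apply: cvgB => //; exact: cvg_cst.
- by rewrite -[X in _ --> X]addr0; apply: cvgD => //; exact: cvg_cst.
Unshelve. all: by end_near. Qed.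

(** Eigenvalues are not shown to be measurable one by one. On normal matrices the spectral measure
    is a pointwise limit of traces of polynomials, which are measurable; elsewhere it is a
    constant. *)
Lemma measurable_spectral (R : realType) n (a b : R) : a <= b ->
  measurable_fun setT (fun A : borelM R n n =>
    spectral_measure (A : 'M[Cplx R]_n) `[a, b]).
Proof.
move=> ab; have [p pP] := itv_poly_seq ab.
pose c : R := n%:R^-1 * \sum_(i < n) (a <= 0 <= b)%R%:R.
pose h m (A : borelM R n n) : R := if normal_defect A == 0 then poly_trace (p m) A else c.
apply: (@measurable_fun_cvg _ _ _ _ h).
  move=> m; apply: measurable_fun_ifT.
  - apply: measurable_fun_eqr; first exact: measurable_normal_defect.
    exact: measurable_cst.
  - exact: measurable_poly_trace.
  - exact: measurable_cst.
move=> A _; rewrite spectral_measure_eig /h -normal_defectP.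
case nA : (A \is normalmx).
  under eq_fun do rewrite poly_traceE //.
  by apply: cvgMl_tmp; apply: cvg_sum_seq => i _; exact: pP.
rewrite (_ : n%:R^-1 * _ = c); first exact: cvg_cst.
congr (_ * _); apply: eq_bigr => i _; rewrite non_normal_eig // nA.
by [].
Qed.

Lemma ptranspose_continuous (R : realType) d (c : Cplx R) :
  continuous (fun A : 'M[Cplx R]_(d * d) => c *: ptranspose A).
Proof.
apply: mx_continuous => i j; under eq_fun do rewrite !mxE.
apply: continuousM_C; first exact: cst_continuous.
exact: (coord_continuous (K := Cplx R)).
Qed.

Lemma reduced_state_continuous (R : realType) n p :
  continuous (@reduced_state R n p).
Proof.
apply: mx_continuous => i j; under eq_fun do rewrite mxE.
apply: continuous_csum => k; under eq_fun do rewrite mxE big_ord1 !mxE.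
apply: continuousM_C; first exact: (coord_continuous (K := Cplx R)).
move=> x; apply: continuous_comp; first exact: (coord_continuous (K := Cplx R)).
exact: conj_continuous.
Qed.

Lemma pt_state_herm (R : realType) d p (x : 'cV[Cplx R]_(d * d * p)) :
  (pt_state x)^t* = pt_state x.
Proof.
apply/matrixP => i j; rewrite !mxE rmorphM /= conjC_nat; congr (_ * _).
rewrite rmorph_sum; apply: eq_bigr => k _ /=.
by rewrite !mxE rmorph_sum; apply: eq_bigr => l _; rewrite !mxE rmorphM /= conjCK mulrC.
Qed.

Lemma pt_state_normal (R : realType) d p (x : 'cV[Cplx R]_(d * d * p)) :
  pt_state x \is normalmx.
Proof. by apply/normalmxP; rewrite pt_state_herm. Qed.

Lemma herm_part_pt (R : realType) d p (x : 'cV[Cplx R]_(d * d * p)) :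
  herm_part (pt_state x) = pt_state x.
Proof.
rewrite /herm_part pt_state_herm; move: (pt_state x) => A.
by apply/matrixP => i j; rewrite !mxE; field.
Qed.

(** * Concentration and the limit *)

Section fixed_dimension.
Context {R : realType} (d p : nat).
Hypotheses (d0 : (0 < d)%N) (p0 : (0 < p)%N).
Variable nu : probability (borelM R (d * d * p) 1) R.
Hypothesis nuS : uniform_on_sphere nu.
Local Notation C := (Cplx R).
Local Notation D := (@unit_sphere R (d * d * p) : set (borelM R (d * d * p) 1)).
Implicit Types x : 'cV[C]_(d * d * p).

Lemma ntr_real k x : ntr k x = cpair (rpart (ntr k x)) 0.
Proof.
apply: cpairP => //=; rewrite /ntr -[pt_state x]herm_part_pt normal_trace ?pt_state_normal //.
rewrite creal_nat -crealV; elim/big_ind: _ => [|z w hz hw|i _].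
- by rewrite mulr0.
- by rewrite mulrDr ipartD hz hw addr0.
- by rewrite -crealX -crealM.
Qed.

Lemma poly_trace_ntr q x :
  poly_trace q (pt_state x) = \sum_(k < size q) q`_k * rpart (ntr k x).
Proof.
rewrite /poly_trace mulr_sumr; apply: eq_bigr => k _; rewrite herm_part_pt mulrCA.
congr (_ * _); rewrite /ntr creal_nat -crealV rpartM /= mul0r subr0.
by rewrite -[(d ^ 2)%N]mulnn.
Qed.

Definition pair_moment k l : R := rpart (expect nu (fun x => ntr k x * ntr l x)).

Definition mean_square (q : {poly R}) (f : R) : R :=
  \int[nu]_(x in D) (poly_trace q (pt_state x) - f) ^+ 2.

Lemma mean_square_bounded q (f : R) : sphere_bounded (fun x : 'cV[C]_(d * d * p) =>
  cpair ((poly_trace q (pt_state x) - f) ^+ 2) 0).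
Proof.
rewrite (_ : (fun x => _) = fun x =>
   (\sum_(k < size q) cpair q`_k 0 * ntr k x + cpair (- f) 0) *
   (\sum_(k < size q) cpair q`_k 0 * ntr k x + cpair (- f) 0)); last first.
  apply/funext => x; rewrite poly_trace_ntr -expr2 crealX crealD; congr ((_ + _) ^+ 2).
  rewrite (big_morph (fun r : R => cpair r 0) (@crealD R) erefl).
  by apply: eq_bigr => k _; rewrite crealM -ntr_real.
have b : sphere_bounded (fun x : 'cV[C]_(d * d * p) =>
    \sum_(k < size q) cpair q`_k 0 * ntr k x + cpair (- f) 0).
  apply: sphere_boundedD; last exact: sphere_bounded_cst.
  apply: sphere_bounded_sum => k _; apply: sphere_boundedM; first exact: sphere_bounded_cst.
  exact: ntr_bounded.
exact: sphere_boundedM.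
Qed.

(** As [ntr 0] is 1, the linear term of the expanded square is also a combination of pair moments,
    so one convergence statement covers everything. *)
Lemma mean_squareE q (f : R) : mean_square q f =
  \sum_(k < size q) \sum_(l < size q) q`_k * q`_l * pair_moment k l
  - 2 * f * (\sum_(k < size q) q`_k * pair_moment k 0) + f ^+ 2.
Proof.
have bn k l : sphere_bounded (fun x : 'cV[C]_(d * d * p) => ntr k x * ntr l x).
  by apply: sphere_boundedM; exact: ntr_bounded.
pose c (r : R) : C := cpair r 0.
have rc r z : rpart (c r * z) = r * rpart z by rewrite rpartM /= mul0r subr0.
have bc r k l : sphere_bounded (fun x : 'cV[C]_(d * d * p) => c r * (ntr k x * ntr l x)).
  by apply: sphere_boundedM => //; exact: sphere_bounded_cst.
have ntr0 x : ntr 0 x = 1 by rewrite ntrE // cyc_sum0 expr0 invr1 mulr1.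
transitivity (rpart (expect nu (fun x =>
   \sum_(k < size q) \sum_(l < size q) c (q`_k * q`_l) * (ntr k x * ntr l x) +
   (\sum_(k < size q) c (- (2 * f) * q`_k) * (ntr k x * ntr 0 x) + c (f ^+ 2))))).
  rewrite /mean_square -[LHS]/(rpart (expect nu (fun x =>
     cpair ((poly_trace q (pt_state x) - f) ^+ 2) 0))); congr rpart; apply: eq_expect => x _.
  rewrite poly_trace_ntr; pose t : R := \sum_(k < size q) q`_k * rpart (ntr k x); rewrite -/t.
  have tE : \sum_(k < size q) \sum_(l < size q) c (q`_k * q`_l) * (ntr k x * ntr l x) = c (t ^+ 2).
    rewrite /c expr2 crealM /t (big_morph (fun r : R => cpair r 0) (@crealD R) erefl) mulr_suml.
    apply: eq_bigr => k _; rewrite mulr_sumr; apply: eq_bigr => l _.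
    by rewrite ntr_real [ntr l x]ntr_real !crealM; ring.
  have tE1 : \sum_(k < size q) c (- (2 * f) * q`_k) * (ntr k x * ntr 0 x) = c (- (2 * f) * t).
    rewrite /c crealM /t (big_morph (fun r : R => cpair r 0) (@crealD R) erefl) mulr_sumr.
    by apply: eq_bigr => k _; rewrite ntr0 mulr1 ntr_real !crealM mulrA.
  by rewrite tE tE1 /c -!crealD; congr cpair; ring.
have b1 : sphere_bounded (fun x : 'cV[C]_(d * d * p) =>
    \sum_(k < size q) \sum_(l < size q) c (q`_k * q`_l) * (ntr k x * ntr l x)).
  by apply: sphere_bounded_sum => k _; apply: sphere_bounded_sum.
have b2 : sphere_bounded (fun x : 'cV[C]_(d * d * p) =>
    \sum_(k < size q) c (- (2 * f) * q`_k) * (ntr k x * ntr 0 x)).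
  by apply: sphere_bounded_sum.
have b3 : sphere_bounded (fun x : 'cV[C]_(d * d * p) => c (f ^+ 2)).
  exact: sphere_bounded_cst.
rewrite (expectD nu b1 (sphere_boundedD b2 b3)) rpartD (expectD nu b2 b3) rpartD.
rewrite (expect_cst nuS) -addrA; congr (_ + (_ + _)).
  rewrite (expect_sum nuS) => [|k _]; last exact: sphere_bounded_sum.
  rewrite (big_morph rpart (@rpartD R) erefl); apply: eq_bigr => k _.
  rewrite (expect_sum nuS) // (big_morph rpart (@rpartD R) erefl); apply: eq_bigr => l _.
  by rewrite (expectZ nu _ (bn k l)) rc.
rewrite (expect_sum nuS) // (big_morph rpart (@rpartD R) erefl) -[RHS]mulNr mulr_sumr.
by apply: eq_bigr => k _; rewrite (expectZ nu _ (bn k 0%N)) rc mulrA.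
Qed.

(** Markov's inequality, after replacing [S] by its trace on the sphere, whose complement is
    negligible. *)
Lemma sphere_prob (S : set (borelM R (d * d * p) 1)) (h : 'cV[C]_(d * d * p) -> R) :
  measurable S -> nu.-integrable D (EFin \o h) ->
  (forall x, 0 <= h x) -> (forall x, S x -> 1 <= h x) ->
  (nu S <= (\int[nu]_(x in D) h x)%:E)%E.
Proof.
move=> mS ih h0 hS; have mD : measurable D by exact: measurable_sphere.
have DC : nu (~` D) = 0%E.
  have D1 : nu D = 1%E by exact: nuS.1.
  rewrite [LHS](probability_setC nu mD).
  by rewrite [X in (1 - X)%E]D1 subee.
have -> : nu S = nu (S `&` D).
  rewrite -[in LHS](setIT S) -(setUv D) setIUr measureU; first last.
  - by rewrite -setIIr setICr setI0.
  - by apply: measurableI => //; exact: measurableC.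
  - exact: measurableI.
  rewrite [X in (_ + X)%E](@subset_measure0 _ _ _ nu _ (~` D)) ?adde0 //.
  - by apply: measurableI => //; exact: measurableC.
  - exact: measurableC.
have fin : nu (S `&` D) \is a fin_num by apply: fin_num_measure; exact: measurableI.
rewrite -(fineK fin) lee_fin.
have -> : fine (nu (S `&` D)) = \int[nu]_(x in D) ((cst (1 : R)) \_ S) x.
  by rewrite -Rintegral_mkcondl Rintegral_cst ?mul1r //; exact: measurableI.
apply: le_Rintegral => //.
  rewrite (_ : EFin \o _ = (EFin \o cst 1) \_ S); last first.
    by apply/funext => x /=; rewrite restrict_EFin.
  apply/(integrable_restrict _ mS mD).
  by apply: finite_measure_integrable_cst; exact: measurableI.
move=> x _; rewrite patchE; case: ifPn => [/set_mem/hS //|_]; exact: h0.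
Qed.

End fixed_dimension.

Section deviation.
Context {R : realType} (d p : nat).
Variable nu : probability (borelM R (d * d * p) 1) R.
Hypothesis nuS : uniform_on_sphere nu.

Lemma measurable_deviation (s a b eps : R) : a <= b ->
  measurable [set A : borelM R (d * d) (d * d) |
    eps < `|spectral_measure ((d ^ 2)%:R *: ptranspose (A : 'M[Cplx R]_(d * d))) `[a, b] - s|].
Proof.
move=> ab.
pose f (A : borelM R (d * d) (d * d)) : borelM R (d * d) (d * d) :=
  (d ^ 2)%:R *: ptranspose (A : 'M[Cplx R]_(d * d)).
have mf : measurable_fun setT f.
  by apply: continuous_borelM; exact: ptranspose_continuous.
have mg : measurable_fun setT (fun A => `|spectral_measure (f A : 'M[Cplx R]_(d * d)) `[a, b] - s|).
  apply: (measurableT_comp (@normr_measurable R setT)); apply: measurable_funB; last exact: measurable_cst.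
  exact (measurableT_comp (measurable_spectral (n := d * d) ab) mf).
have := measurable_fun_ltr (measurable_cst eps) mg.
move=> /(_ measurableT [set true] I); rewrite setTI.
by congr measurable; apply/seteqP; split => A /=.
Qed.

(* On the deviation event one of the two polynomial traces is at distance at
   least [eps / 2] from its limit. *)
Lemma deviation_bound (q1 q2 : {poly R}) (s f1 f2 a b eps : R) : a <= b -> 0 < eps ->
  (forall x, (a <= x <= b)%R%:R <= q1.[x]) -> f1 <= s + eps / 2 ->
  (forall x, q2.[x] <= (a <= x <= b)%R%:R) -> s - eps / 2 <= f2 ->
  (nu (@reduced_state R (d * d) p @^-1` [set A |
     (eps < `|spectral_measure ((d ^ 2)%:R *: ptranspose A) `[a, b] - s|)%R]) <=
   (4 / eps ^+ 2 * (mean_square nu q1 f1 + mean_square nu q2 f2))%:E)%E.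
Proof.
move=> ab e0 q1P f1P q2P f2P.
pose t q x := poly_trace q (@pt_state R d p x).
pose h x := 4 / eps ^+ 2 * ((t q1 x - f1) ^+ 2 + (t q2 x - f2) ^+ 2).
have mD : measurable (@unit_sphere R (d * d * p) : set (borelM R (d * d * p) 1)).
  exact: measurable_sphere.
have it q f : nu.-integrable (@unit_sphere R (d * d * p))
    (EFin \o (fun x : borelM R (d * d * p) 1 => (t q x - f) ^+ 2)).
  by have [] := expect_integrable nu (mean_square_bounded _ _ q f).
have itD : nu.-integrable (@unit_sphere R (d * d * p)) (EFin \o
    (fun x : borelM R (d * d * p) 1 => (t q1 x - f1) ^+ 2 + (t q2 x - f2) ^+ 2)).
  exact: (integrableD mD (it q1 f1) (it q2 f2)).
have -> : 4 / eps ^+ 2 * (mean_square nu q1 f1 + mean_square nu q2 f2) =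
    \int[nu]_(x in @unit_sphere R (d * d * p)) h x.
  rewrite /h RintegralZl // RintegralD //; exact: it.
apply: sphere_prob => //.
- rewrite -[X in measurable X]setTI.
  apply: (continuous_borelM (@reduced_state_continuous R (d * d) p)) => //.
  exact: measurable_deviation.
- exact: (integrableZl mD (4 / eps ^+ 2) itD).
- by move=> x; rewrite mulr_ge0 ?addr_ge0 ?sqr_ge0 // divr_ge0 ?sqr_ge0.
move=> x /=; rewrite -/(pt_state x) => dev.
have nA := pt_state_normal x.
have N1 : spectral_measure (pt_state x) `[a, b] <= t q1 x.
  rewrite /t poly_traceE // spectral_measure_eig ler_wpM2l ?invr_ge0 //.
  by apply: ler_sum => i _; exact: q1P.
have N2 : t q2 x <= spectral_measure (pt_state x) `[a, b].
  rewrite /t poly_traceE // spectral_measure_eig ler_wpM2l ?invr_ge0 //.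
  by apply: ler_sum => i _; exact: q2P.
rewrite /h mulrAC ler_pdivlMr ?exprn_gt0 // mul1r.
move: dev N1 N2; move: (spectral_measure _ _) (t q1 x) (t q2 x) => N t1 t2.
(* Below s - eps the trace of the minorant deviates, above s + eps that of the majorant; the factor
   4/eps^2 normalises the square of eps/2 to 1. *)
rewrite ltNge ler_norml negb_and -!ltNge => /orP[h0 _ h2|h0 h2 _].
  have h3 : eps / 2 <= f2 - t2 by lra.
  by have := sqr_ge0 (t1 - f1); nra.
have h3 : eps / 2 <= t1 - f1 by lra.
by have := sqr_ge0 (t2 - f2); nra.
Qed.

End deviation.

(** * Growth of the ancilla dimension *)

Section truncated_quadratic.
Context {R : realType} (al : R).
Hypothesis al0 : 0 < al.
Local Notation p n := (Num.truncn (al * n%:R ^+ 2)).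

Let n_inv : (n%:R^-1 : R) @[n --> \oo] --> (0 : R).
Proof.
apply/gtr0_cvgV0; first by near=> n; rewrite ltr0n; near: n; exact: nbhs_infty_gt.
exact: cvgr_idn.
Unshelve. all: by end_near. Qed.

(** Truncation loses at most 1, hence at most 1/n^2 after division. *)
Let ratio : (p n)%:R / n%:R ^+ 2 @[n --> \oo] --> al.
Proof.
apply: (@squeeze_cvgr _ _ _ _ (fun n => al - n%:R^-1 * n%:R^-1) (fun n => al)); last exact: cvg_cst.
  near=> n.
  have n0 : 0 < n%:R :> R by rewrite ltr0n; near: n; exact: nbhs_infty_gt.
  have x0 : 0 <= al * n%:R ^+ 2 by rewrite mulr_ge0 ?sqr_ge0 // ltW.
  have /andP[h1 h2] := truncn_itv x0.
  rewrite ler_pdivrMr ?exprn_gt0 // h1 andbT ler_pdivlMr ?exprn_gt0 //.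
  rewrite mulrBl expr2 mulrACA mulVf ?gt_eqF // mulr1 -expr2 lerBlDr natr1.
  exact: ltW.
rewrite -[X in _ --> X]subr0 -(mulr0 (0 : R)); apply: cvgB; first exact: cvg_cst.
exact: cvgM.
Unshelve. all: by end_near. Qed.

Lemma truncn_ratio : n%:R ^+ 2 / (p n)%:R @[n --> \oo] --> al^-1.
Proof.
under eq_fun do rewrite -invf_div.
by apply: cvgV ratio; rewrite gt_eqF.
Qed.

Lemma truncn_pos : \forall n \near \oo, (0 < p n)%N.
Proof.
have h : \forall n \near \oo, 0 < (p n)%:R / n%:R ^+ 2 :> R by exact: cvgr_gt ratio _ al0.
apply: filterS h => n; rewrite lt0n; apply: contraTN => /eqP ->.
by rewrite mul0r ltxx.
Qed.

Lemma truncn_inv : (p n)%:R^-1 @[n --> \oo] --> (0 : R).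
Proof.
have e : \forall n \near \oo, n%:R ^+ 2 / (p n)%:R * (n%:R^-1 * n%:R^-1) = (p n)%:R^-1 :> R.
  near=> n.
  have n0 : n%:R != 0 :> R by rewrite pnatr_eq0 -lt0n; near: n; exact: nbhs_infty_gt.
  by rewrite mulrAC expr2 mulrACA divff // mulr1 mul1r.
apply: cvg_trans (near_eq_cvg e) _.
rewrite -(mulr0 al^-1) -[X in _ * X](mulr0 (0 : R)).
by apply: cvgM; [exact: truncn_ratio|exact: cvgM].
Unshelve. all: by end_near. Qed.

End truncated_quadratic.

Section moment_limit.
Context {R : realType} (al : R).
Hypothesis al0 : 0 < al.
Local Notation p n := (Num.truncn (al * n%:R ^+ 2)).
Variable nu : forall d, probability (borelM R (d * d * p d) 1) R.
Hypothesis nuS : forall d, (0 < d)%N -> (0 < p d)%N -> uniform_on_sphere (nu d).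
Local Notation c k := (sc_moment al^-1 'X^k).

Let v0 : 0 < al^-1. Proof. by rewrite invr_gt0. Qed.

Let large : \forall d \near \oo, (0 < d)%N && (0 < p d)%N.
Proof.
near=> d; apply/andP; split; near: d; first exact: nbhs_infty_gt.
exact: truncn_pos.
Unshelve. all: by end_near. Qed.

Lemma pair_moment_cvg k l : pair_moment (nu d) k l @[d --> \oo] --> c k * c l.
Proof.
have cnv := @net_cycles_cvg R ('I_k + 'I_l)%type al (fun d => p d) (truncn_inv al0)
  (truncn_ratio al0) (fun d => @nnet R d (p d) (nu d) ('I_k + 'I_l)%type) (truncn_pos al0).
have n0 : \forall n \near \oo, nnet (nu n) finset.set0 1%g (1%g : {perm 'I_k + 'I_l}) = 1.
  by apply: filterS large => d /andP[d0 pd]; apply: nnet0 => //; exact: nuS.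
have nr : \forall n \near \oo, forall (A : {set 'I_k + 'I_l}) (g h : {perm 'I_k + 'I_l}) t, t \in A ->
    nnet (nu n) A g h = \sum_(s in A) splice_weight n (p n) #|A| g h s t *
       nnet (nu n) (A :\ s) (splice s t g) (splice s t h).
  by apply: filterS large => d /andP[d0 pd] A g h t tA; apply: nnet_rec => //; exact: nuS.
have := cnv n0 nr (fun m => c m) (rot2_cycles k l) (rot2 k l) (sc_moment0 v0) (sc_momentS v0)
  (rot2_uniq k l) (rot2_fcycle k l).
rewrite rot2_full => /(_ _); rewrite !big_cons big_nil mulr1 size_map size_enum_ord size_map size_enum_ord.
have on : perm_on [set: 'I_k + 'I_l]%SET (rot2 k l) by apply/fintype.subsetP => x; rewrite inE.
move=> /(_ on); apply: cvg_trans; apply: near_eq_cvg.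
apply: filterS large => d /andP[d0 pd].
by rewrite -(expect_ntr d0 (nuS d0 pd)).
Qed.

Lemma mean_square_cvg (q : {poly R}) :
  mean_square (nu d) q (sc_moment al^-1 q) @[d --> \oo] --> (0 : R).
Proof.
set f := sc_moment al^-1 q.
have fE : f = \sum_(k < size q) q`_k * c k.
  rewrite /f -{1}[q]coefK poly_def (lin_form_sum _ _ _ (sc_moment_lin al^-1)).
  by apply: eq_bigr => k _; rewrite (lin_formZ (sc_moment_lin al^-1)).
have e : \forall d \near \oo,
    \sum_(k < size q) \sum_(l < size q) q`_k * q`_l * pair_moment (nu d) k l
     - 2 * f * (\sum_(k < size q) q`_k * pair_moment (nu d) k 0) + f ^+ 2 =
    mean_square (nu d) q f.
  apply: filterS large => d /andP[d0 pd].
  by rewrite mean_squareE //; exact: nuS.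
(* Since the limits of the pair moments factorise, the limit of the mean square is f^2 - 2 f f +
   f^2. *)
have z : \sum_(k < size q) \sum_(l < size q) q`_k * q`_l * (c k * c l)
     - 2 * f * (\sum_(k < size q) q`_k * (c k * c 0%N)) + f ^+ 2 = 0.
  rewrite (_ : \sum_(k < size q) \sum_(l < size q) _ = f ^+ 2); last first.
    rewrite expr2 [X in X * _]fE mulr_suml; apply: eq_bigr => k _.
    by rewrite [in RHS]fE mulr_sumr; apply: eq_bigr => l _; rewrite mulrACA.
  rewrite (_ : \sum_(k < size q) _ = f); first by ring.
  by rewrite fE; apply: eq_bigr => k _; rewrite (sc_moment0 v0) mulr1.
rewrite -[X in _ --> X]z; apply: cvg_trans (near_eq_cvg e) _; apply: cvgD; last exact: cvg_cst.
apply: cvgB.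
  apply: cvg_sum_seq => k _; apply: cvg_sum_seq => l _; apply: cvgMl_tmp.
  exact: pair_moment_cvg.
apply: cvgMl_tmp; apply: cvg_sum_seq => k _; apply: cvgMl_tmp.
exact: pair_moment_cvg.
Qed.

End moment_limit.

Theorem theorem3 (R : realType) (alpha : R) (alpha_gt0 : 0 < alpha)
  (disp : nat -> measure_display)
  (T : forall d : nat, measurableType (disp d))
  (P : forall d : nat, probability (T d) R)
  (rho : forall d : nat, {RV (P d) >-> borelM R (d * d) (d * d)})
  (rho_law : forall d : nat,
     (0 < d)%N -> (0 < Num.truncn (alpha * d%:R ^+ 2))%N ->
     has_law_mu (Num.truncn (alpha * d%:R ^+ 2)) (rho d))
  (a b : R) (leab : a <= b) (eps : R) (eps_gt0 : 0 < eps) :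
  (fun d : nat =>
     P d [set w : T d |
       eps < `| spectral_measure ((d ^ 2)%:R *: ptranspose (rho d w)) `[a, b]
                - semicircle 1 (1 / alpha) `[a, b] |])
  @ \oo --> 0%E.
Proof.
set s := semicircle _ _ _.
pose p d := Num.truncn (alpha * d%:R ^+ 2).
have ex d : exists nu : probability (borelM R (d * d * p d) 1) R,
    (0 < d)%N -> (0 < p d)%N -> uniform_on_sphere nu /\
    (forall A : set (borelM R (d * d) (d * d)), measurable A ->
       distribution (P d) (rho d) A = nu (@reduced_state R (d * d) (p d) @^-1` A)).
  have [/andP[d0 pd]|nd] := boolP ((0 < d)%N && (0 < p d)%N).
    by have [nu h] := rho_law d d0 pd; exists nu.
  (* a placeholder for the finitely many [d] to which [rho_law] does not apply *)
  exists (dirac ((0 : 'cV[Cplx R]_(d * d * p d)) : borelM R (d * d * p d) 1)) => d0 pd.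
  by rewrite d0 pd in nd.
pose nu d := projT1 (cid (ex d)); have nuP d := projT2 (cid (ex d)); rewrite -/(nu _) in nuP.
have nuS d (d0 : (0 < d)%N) (pd : (0 < p d)%N) := (nuP d d0 pd).1.
have v0 : 0 < alpha^-1 by rewrite invr_gt0.
(* One half of [eps] pays for replacing the indicator by polynomials; the other half is the
   deviation left to Chebyshev's inequality. *)
have e2 : 0 < eps / 2 by rewrite divr_gt0.
have [q1 q1P f1] := semicircle_majorant v0 leab e2.
have [q2 q2P f2] := semicircle_minorant v0 a b e2.
rewrite -div1r -/s in f1 f2.
set m1 := sc_moment _ q1 in f1; set m2 := sc_moment _ q2 in f2.
pose u d := 4 / eps ^+ 2 * (mean_square (nu d) q1 m1 + mean_square (nu d) q2 m2).
have u0 : u d @[d --> \oo] --> (0 : R).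
  rewrite -(mulr0 (4 / eps ^+ 2)); apply: cvgMl_tmp; rewrite -(addr0 0).
  by apply: cvgD; rewrite /m1 /m2 div1r; exact: mean_square_cvg.
apply: (@squeeze_cvge _ _ _ _ (cst 0%E) _ (fun d => (u d)%:E)).
- near=> d; rewrite measure_ge0 /=.
  have d0 : (0 < d)%N by near: d; exact: nbhs_infty_gt.
  have pd : (0 < p d)%N by near: d; exact: truncn_pos.
  apply: le_trans (deviation_bound (nuS d d0 pd) leab eps_gt0 q1P f1 q2P f2).
  (* The law of [rho d] moves the event to the sphere, which is legitimate because it is a
     measurable set of matrices. *)
  by rewrite -(nuP d d0 pd).2 //; exact: measurable_deviation.
- exact: cvg_cst.
- by apply/fine_cvgP; split => //; exact: nearW.
Unshelve. all: by end_near. Qed.
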